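(* Let $A\in\mathbb{R}^{m\times n}$, $b\in\mathbb{R}^m$, $m\ge n$, be normalized so that $\|A\|=\|b\|=1$, let $\kappa=\operatorname{cond}(A)$, let $x=\operatorname{argmin}_{x\in\mathbb{R}^n}\|b-Ax\|$, and run the FOSSILS algorithm (described in the context) in floating point arithmetic with unit roundoff $u$, with computed output $\widehat x_2$. Assume the following. (A) Numerically full-rank: $\kappa u\ll 1$. (B) Non-pathological rounding errors: the output satisfies $\|\widehat x_2\|\gtrsim \|x\|+\kappa\left(\|x\|+\kappa\|b-Ax\|\right)u$. (C) Stable sketching: $S$ is a sketching matrix for $A$ with $d\le n^3$ rows, distortion $\eta\le 0.9$, and a forward stable multiply operation $\|\operatorname{fl}(SA)-SA\|\lesssim\|A\|u$. (D) Parameters for Polyak solver: $\alpha,\beta$ are set according to a distortion $1.01\eta$, i.e., $\alpha=(1-(1.01\eta)^2)^2$, $\beta=(1.01\eta)^2$, with $|\widehat\alpha-\alpha|,|\widehat\beta-\beta|\lesssim u$, and the iteration count satisfies $$q\ge q_0:=\max\left(1+2\,\frac{\log(1/(\kappa u))}{\log(1/(1.01\eta))},\ 11\right).$$ Then FOSSILS is backward stable, i.e. $\widehat x_2$ is a backward stable solution. In particular, choosing $S$ to be a sparse sign embedding with distortion $\eta=1/2$ with parameter settings $d\ge \mathrm{const}\cdot\frac{n\log n}{\eta^2}$ and $\zeta\ge\mathrm{const}\cdot\frac{\log n}{\eta}$ (taken of the order of these lower bounds, and $q=\lceil q_0\rceil$), FOSSILS produces a backward stable solution in $\mathcal{O}(mn\log(n/u)+n^3\log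 n)$ operations.
   Context: Norms: $\|\cdot\|$ is the Euclidean norm of a vector or the spectral norm of a matrix, $\|\cdot\|_{\rm F}$ the Frobenius norm, $\operatorname{cond}(B)=\sigma_{\max}(B)/\sigma_{\min}(B)$. Asymptotic notation: $a\lesssim b$ (equivalently $b\gtrsim a$) means $a\le c(m,n)\,b$ for a prefactor $c(m,n)$ that is a polynomial in $m$ and $n$ only. $a\ll b$ means $a\le b/c(m,n)$ for some sufficiently large polynomial $c(m,n)$; a hypothesis $a\ll b$ means that the result holds for a sufficiently large choice of this polynomial (which may depend on the polynomial prefactors in the other hypotheses). Floating point model: each arithmetic operation $\star\in\{+,-,\times,/\}$ is computed with $\operatorname{fl}(a\star b)=(a\star b)(1+\delta)$, $|\delta|\le u$, where $u$ is the unit roundoff. The numerically computed version of a quantity $f$ is denoted $\operatorname{fl}(f)$ or $\widehat f$. Expressions are evaluated in the sensible order (e.g. $AR^{-1}z$ as $A(R^{-1}z)$), triangular solves are done by substitution, and QR factorizations by Householder QR. Sketching matrix: $S\in\mathbb{R}^{d\times m}$ is a sketching matrix for $B$ with distortion $0<\eta<1$ if $(1-\eta)\|By\|\le\|SBy\|\le(1+\eta)\|By\|$ for all vectors $y$. A sparse sign embedding is a random matrix $S=\zeta^{-1/2}[s_1\ \cdots\ s_m]\in\mathbb{R}^{d\times m}$ whose columns are independent, each with exactly $\zeta$ nonzero entries in uniformly random positions, the nonzero entries being $\pm1$ with equal probability; with the stated parameter settings (for suitable absolute constants) it is a sketching matrix of distortion $\eta$ with high probability, and the ''in particular'' statement refers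 to the case when this holds. FOSSILS: (1) draw a sketching matrix $S$ for $[A\ \ b]$ with distortion $\eta$; (2) compute the (economy) QR factorization $SA=QR$; (3) set $x_0=R^{-1}(Q^\top(Sb))$; (4) for $i=0,1$: set $c_i=R^{-\top}(A^\top(b-Ax_i))$; let $\delta y_i=\mathrm{Polyak}(c_i)$; set $x_{i+1}=x_i+R^{-1}\delta y_i$. Here $\mathrm{Polyak}(c)$, with parameters $\alpha,\beta$ and iteration count $q$, sets $\delta y_{(1)}=\delta y_{(0)}=c$, computes for $j=1,\dots,q-1$ $$\delta y_{(j+1)}=\delta y_{(j)}+\alpha\left(c-R^{-\top}(A^\top(A(R^{-1}\delta y_{(j)})))\right)+\beta(\delta y_{(j)}-\delta y_{(j-1)}),$$ and returns $\delta y_{(q)}$. The forward stable multiply operation of $S$ is understood to apply also to $Sb$: $\|\operatorname{fl}(Sb)-Sb\|\lesssim\|b\|u$. Backward stability: the backward error of $\widehat x$ is $\mathrm{BE}(\widehat x)=\min\{\|\Delta A\|_{\rm F}: \widehat x=\operatorname{argmin}_{z}\|b-(A+\Delta A)z\|\}$; $\widehat x$ is backward stable if $\mathrm{BE}(\widehat x)\le c\,\|A\|_{\rm F}u$ with $c$ a polynomial in $m$ and $n$. *)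

(* Defs.v *)
From HB Require Import structures.
From mathcomp Require Import all_boot all_order all_algebra.
From mathcomp Require Import all_classical all_reals all_analysis.

Set Implicit Arguments.
Unset Strict Implicit.
Unset Printing Implicit Defensive.

Import Order.TTheory GRing.Theory Num.Theory.
Local Open Scope classical_set_scope.
Local Open Scope ring_scope.

Section LinearAlgebra.
Context {R : realType}.

Definition norm2 m (x : 'cV[R]_m) : R := Num.sqrt (\sum_i x i 0 ^+ 2).

Definition normF m n (A : 'M[R]_(m, n)) : R :=
  Num.sqrt (\sum_i \sum_j A i j ^+ 2).

(* Spectral norm, as the operator norm for the Euclidean norms. *)
Definition opnorm m n (A : 'M[R]_(m, n)) : R :=
  sup [set norm2 (A *m y) | y in [set y : 'cV[R]_n | norm2 y <= 1]].

(* For [n <= m]; if [m < n] then 0 always belongs to this set. *)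
Definition singular_values m n (A : 'M[R]_(m, n)) : set R :=
  [set s | 0 <= s /\ eigenvalue (A^T *m A) (s ^+ 2)].

Definition sigma_max m n (A : 'M[R]_(m, n)) : R := sup (singular_values A).
Definition sigma_min m n (A : 'M[R]_(m, n)) : R := inf (singular_values A).

(* Equal to 0 (not infinity) if [sigma_min A = 0], as division by 0 is total. *)
Definition cond m n (A : 'M[R]_(m, n)) : R := sigma_max A / sigma_min A.

Definition is_argmin m n (A : 'M[R]_(m, n)) (b : 'cV[R]_m) (x : 'cV[R]_n) :=
  forall z, norm2 (b - A *m x) <= norm2 (b - A *m z).

(* The infimum is attained: the set of perturbations is closed (it is given by
   the normal equations) and contains [- A]. *)
Definition backward_error m n (A : 'M[R]_(m, n)) (b : 'cV[R]_m)
    (xh : 'cV[R]_n) : R :=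
  inf [set normF DA | DA in [set DA | is_argmin (A + DA) b xh]].

Definition sketching d m n (S : 'M[R]_(d, m)) (B : 'M[R]_(m, n)) (eta : R) :=
  0 < eta < 1 /\ forall y : 'cV[R]_n,
    (1 - eta) * norm2 (B *m y) <= norm2 (S *m B *m y)
      <= (1 + eta) * norm2 (B *m y).

End LinearAlgebra.

Section Prefactors.
Context {R : realType}.

Definition pval (c : {poly {poly R}}) (m n : nat) : R := c.[m%:R].[n%:R].

(* a <~ b *)
Definition lesssim (c : {poly {poly R}}) (m n : nat) (a b : R) :=
  a <= pval c m n * b.

(* a << b; only meaningful for a positive [pval c m n] *)
Definition muchless (c : {poly {poly R}}) (m n : nat) (a b : R) :=
  a <= b / pval c m n.

Definition backward_stable (c : {poly {poly R}}) (u : R) m n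
    (A : 'M[R]_(m, n)) (b : 'cV[R]_m) (xh : 'cV[R]_n) :=
  backward_error A b xh <= pval c m n * normF A * u.

End Prefactors.

(* [p v k] means that [v] is a possible result of the program [p], reached with
   [k] arithmetic operations. A program is a relation because the floating point
   model only bounds the rounding errors. *)
Definition prog (T : Type) : Type := T -> nat -> Prop.

Definition ret T (x : T) : prog T := fun y k => y = x /\ k = 0%N.

Definition bind T U (p : prog T) (f : T -> prog U) : prog U :=
  fun y k => exists x k1 k2, [/\ p x k1, f x y k2 & k = (k1 + k2)%N].

Notation "x '<~' p ';;' q" := (bind p (fun x => q))
  (at level 100, p at next level, q at level 100, right associativity).

Fixpoint mapP T U (f : T -> prog U) (s : seq T) : prog (seq U) :=
  if s is x :: s' then y <~ f x ;; ys <~ mapP f s' ;; ret (y :: ys)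
  else ret [::].

Fixpoint foldP T U (f : U -> T -> prog U) (y : U) (s : seq T) : prog U :=
  if s is x :: s' then y' <~ f y x ;; foldP f y' s' else ret y.

Fixpoint iterP T (k : nat) (f : T -> prog T) (x : T) : prog T :=
  if k is k'.+1 then y <~ f x ;; iterP k' f y else ret x.

(* Independent computation of all entries, or of all columns, of a matrix. *)
Definition entriesP (R : Type) m n (f : 'I_m -> 'I_n -> prog R) :
    prog 'M[R]_(m, n) :=
  fun X k => exists c : 'I_m -> 'I_n -> nat,
    (forall i j, f i j (X i j) (c i j)) /\ k = (\sum_i \sum_j c i j)%N.

Definition columnsP (R : Type) m n (f : 'I_n -> prog 'cV[R]_m) :
    prog 'M[R]_(m, n) :=
  fun X k => exists c : 'I_n -> nat,
    (forall j, f j (col j X) (c j)) /\ k = (\sum_j c j)%N.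

Section FloatingPoint.
Context {R : realType}.
Variable u : R. (* unit roundoff *)

(* One arithmetic operation with exact result [e]. Used for [+], [-], [*], [/],
   and also for the square roots in Householder QR. Sign changes are exact and
   are not counted. *)
Definition fl (e : R) : prog R :=
  fun v k => (exists2 delta, `|delta| <= u & v = e * (1 + delta)) /\ k = 1%N.

(* Summation in an arbitrary order. *)
Inductive sumP : seq R -> prog R :=
| sumP_nil : sumP [::] 0 0%N
| sumP_one a : sumP [:: a] a 0%N
| sumP_add s s1 s2 a1 a2 a k1 k2 k :
    perm_eq s (s1 ++ s2) -> s1 <> [::] -> s2 <> [::] ->
    sumP s1 a1 k1 -> sumP s2 a2 k2 -> fl (a1 + a2) a k ->
    sumP s a (k1 + k2 + k)%N.

Definition dotP I (s : seq I) (f g : I -> R) : prog R :=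
  ps <~ mapP (fun i => fl (f i * g i)) s ;; sumP ps.

Definition mulvP m n (A : 'M[R]_(m, n)) (x : 'cV[R]_n) : prog 'cV[R]_m :=
  entriesP (fun i _ => dotP (enum 'I_n) (A i) (x^~ 0)).

Definition addvP m (x y : 'cV[R]_m) : prog 'cV[R]_m :=
  entriesP (fun i _ => fl (x i 0 + y i 0)).

Definition subvP m (x y : 'cV[R]_m) : prog 'cV[R]_m :=
  entriesP (fun i _ => fl (x i 0 - y i 0)).

Definition scalevP m (a : R) (x : 'cV[R]_m) : prog 'cV[R]_m :=
  entriesP (fun i _ => fl (a * x i 0)).

(* Substitution for [T z = c]: entry [i] of the result is
   [(c_i - \sum_j T_ij z_j) / T_ii], with the sum over the [j] such that
   [before j i], which are the unknowns found before the [i]-th one. *)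
Definition substP n (before : rel 'I_n) (T : 'M[R]_n) (c : 'cV[R]_n) :
    prog 'cV[R]_n :=
  fun z k => exists w : 'I_n -> nat,
    (forall i,
       (ps <~ mapP (fun j => fl (T i j * z j 0))
                   [seq j : 'I_n <- enum 'I_n | before j i] ;;
        s <~ sumP (c i 0 :: map -%R ps) ;;
        fl (s / T i i)) (z i 0) (w i))
    /\ k = (\sum_i w i)%N.

(* [R^-1 c] and [R^-T c] for an upper triangular [R] *)
Definition solveP n (T : 'M[R]_n) := substP (fun j i => i < j)%N T.
Definition solvetP n (T : 'M[R]_n) := substP (fun j i => j < i)%N T^T.

Definition sign1 (x : R) : R := if 0 <= x then 1 else -1.

Definition rows_from d (k : nat) : seq 'I_d := [seq i : 'I_d <- enum 'I_d | (k <= i)%N].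

(* [(k, v, tau)] stands for the reflector [I - tau v v^T] acting on the rows
   with index at least [k]. *)
Definition reflector d : Type := (nat * 'cV[R]_d * R)%type.

Definition reflectP d (y : 'cV[R]_d) (h : reflector d) : prog 'cV[R]_d :=
  let: (k, v, tau) := h in
  t <~ dotP (rows_from d k) (v^~ 0) (y^~ 0) ;;
  s <~ fl (tau * t) ;;
  entriesP (fun i _ =>
    if (k <= i)%N then p <~ fl (s * v i 0) ;; fl (y i 0 - p) else ret (y i 0)).

(* Annihilates column [k] of [W] below the diagonal, and appends the reflector
   to the list of those already used. *)
Definition hqr_stepP d n (st : 'M[R]_(d, n) * seq (reflector d)) (k : 'I_n) :
    prog ('M[R]_(d, n) * seq (reflector d)) :=
  let: (W, hs) := st in
  xx <~ dotP (rows_from d k) (W^~ k) (W^~ k) ;;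
  sigma <~ fl (Num.sqrt xx) ;;
  v <~ entriesP (fun i (_ : 'I_1) =>
         if (i < k)%N then ret 0
         else if i == k :> nat then fl (W i k + sign1 (W i k) * sigma)
         else ret (W i k)) ;;
  vv <~ dotP (rows_from d k) (v^~ 0) (v^~ 0) ;;
  tau <~ fl (2 / vv) ;;
  W' <~ columnsP (fun j =>
          if (j < k)%N then ret (col j W)
          else if j == k then
            ret (\col_i if (i < k)%N then W i k
                        else if i == k :> nat then - sign1 (W i k) * sigma
                        else 0)
          else reflectP (col j W) (k : nat, v, tau)) ;;
  ret (W', rcons hs (k : nat, v, tau)).

(* Economy factorization [B = Q R]. The factor [R] is the top [n * n] block of
   the reduced matrix, padded with zero rows in the degenerate case [d < n]; [Q]
   is obtained by applying the reflectors to the first [n] unit vectors. *)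
Definition qrP d n (B : 'M[R]_(d, n)) : prog ('M[R]_(d, n) * 'M[R]_n) :=
  st <~ foldP (@hqr_stepP d n) (B, [::]) (enum 'I_n) ;;
  Q <~ columnsP (fun j : 'I_n =>
         foldP (@reflectP d) (\col_i (i == j :> nat)%:R) (rev st.2)) ;;
  ret (Q, \matrix_(i, j) oapp (fun i' : 'I_d => st.1 i' j) 0 (insub (val i))).

Definition polyak_stepP m n (A : 'M[R]_(m, n)) (T : 'M[R]_n) (alpha beta : R)
    (c : 'cV[R]_n) (dy : 'cV[R]_n * 'cV[R]_n) : prog ('cV[R]_n * 'cV[R]_n) :=
  let: (cur, prev) := dy in
  t1 <~ solveP T cur ;;
  t2 <~ mulvP A t1 ;;
  t3 <~ mulvP A^T t2 ;;
  t4 <~ solvetP T t3 ;;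
  r <~ subvP c t4 ;;
  ar <~ scalevP alpha r ;;
  p <~ subvP cur prev ;;
  bp <~ scalevP beta p ;;
  s <~ addvP cur ar ;;
  next <~ addvP s bp ;;
  ret (next, cur).

Definition polyakP m n (A : 'M[R]_(m, n)) (T : 'M[R]_n) (alpha beta : R)
    (q : nat) (c : 'cV[R]_n) : prog 'cV[R]_n :=
  dy <~ iterP q.-1 (polyak_stepP A T alpha beta c) (c, c) ;;
  ret dy.1.

Definition refineP m n (A : 'M[R]_(m, n)) (b : 'cV[R]_m) (T : 'M[R]_n)
    (alpha beta : R) (q : nat) (x : 'cV[R]_n) : prog 'cV[R]_n :=
  Ax <~ mulvP A x ;;
  r <~ subvP b Ax ;;
  g <~ mulvP A^T r ;;
  c <~ solvetP T g ;;
  dy <~ polyakP A T alpha beta q c ;;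
  dx <~ solveP T dy ;;
  addvP x dx.

(* The result is the second iterate. The sketching matrix only enters through
   its multiply operation [mulS]. *)
Definition fossilsP d m n
    (mulS : forall p, 'M[R]_(m, p) -> prog 'M[R]_(d, p))
    (A : 'M[R]_(m, n)) (b : 'cV[R]_m) (alpha beta : R) (q : nat) :
    prog 'cV[R]_n :=
  SA <~ mulS n A ;;
  QT <~ qrP SA ;;
  Sb <~ mulS 1%N b ;;
  y0 <~ mulvP QT.1^T Sb ;;
  x0 <~ solveP QT.2 y0 ;;
  iterP 2 (refineP A b QT.2 alpha beta q) x0.

Definition forward_stable_multiply (c : {poly {poly R}}) d m n
    (mulS : forall p, 'M[R]_(m, p) -> prog 'M[R]_(d, p))
    (S : 'M[R]_(d, m)) (A : 'M[R]_(m, n)) (b : 'cV[R]_m) :=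
  (forall SA k, mulS n A SA k ->
     lesssim c m n (opnorm (SA - S *m A)) (opnorm A * u)) /\
  (forall Sb k, mulS 1%N b Sb k ->
     lesssim c m n (norm2 (Sb - S *m b)) (norm2 b * u)).

End FloatingPoint.

Section PolyakTuning.
Context {R : realType}.

Definition inflated (eta : R) : R := 101%:R / 100%:R * eta.

Definition polyak_alpha (eta : R) : R := (1 - inflated eta ^+ 2) ^+ 2.
Definition polyak_beta (eta : R) : R := inflated eta ^+ 2.

Definition polyak_q0 (kappa u eta : R) : R :=
  Num.max (1 + 2 * (ln (1 / (kappa * u)) / ln (1 / inflated eta))) 11%:R.

End PolyakTuning.

(* Sample space: for each column, the set of positions of its [zeta] nonzero
   entries, and a sign for each position (those off the support are not used).
   Under the uniform distribution on this finite type the columns of [sse_mx]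
   are independent, with uniformly random supports and fair random signs. *)
Definition sse_sample (d m zeta : nat) : finType :=
  {ffun 'I_m -> {J : {set 'I_d} | #|J| == zeta} * {ffun 'I_d -> bool}}.

Section SparseSignEmbedding.
Context {R : realType}.
Variables d m zeta : nat.

Definition sse_support (w : sse_sample d m zeta) (j : 'I_m) : {set 'I_d} :=
  val (w j).1.

Definition sse_sign (w : sse_sample d m zeta) (i : 'I_d) (j : 'I_m) : R :=
  (-1) ^+ (w j).2 i.

Definition sse_mx (w : sse_sample d m zeta) : 'M[R]_(d, m) :=
  (Num.sqrt zeta%:R)^-1 *:
  \matrix_(i, j) (if i \in sse_support w j then sse_sign w i j else 0).

(* Sparse multiply: signed sums over the nonzero entries of each row, which are
   then multiplied by the computed value of [zeta ^ (-1/2)]. *)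
Definition sse_mulP (u : R) (w : sse_sample d m zeta) p (B : 'M[R]_(m, p)) :
    prog 'M[R]_(d, p) :=
  r <~ fl u (Num.sqrt zeta%:R) ;;
  s <~ fl u (1 / r) ;;
  entriesP (fun i j =>
    t <~ sumP u [seq sse_sign w i k * B k j
                | k <- enum 'I_m & i \in sse_support w k] ;;
    fl u (s * t)).

(* [zeta] and [d] are of the order of the bounds that guarantee distortion [eta]
   with high probability; [+ 1] allows for rounding up to an integer. *)
Definition sse_parameters (n : nat) (eta lo_d hi_d lo_z hi_z : R) :=
  lo_d * (n%:R * ln n%:R / eta ^+ 2) <= d%:R
    <= hi_d * (n%:R * ln n%:R / eta ^+ 2) + 1 /\
  lo_z * (ln n%:R / eta) <= zeta%:R <= hi_z * (ln n%:R / eta) + 1.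

End SparseSignEmbedding.

(* Main.v *)
Require Import Defs.
From mathcomp Require Import all_boot all_order all_algebra.
From mathcomp Require Import all_classical all_reals all_analysis.
From mathcomp Require Import ring lra zify.

(** Write [r = b - A x] for the optimal residual, [kap] for the condition number
    and [g] for a polynomial multiple of [u] that bounds the relative errors of
    the matrix-vector products and triangular solves.

    The theorem rests on a criterion for a small backward error: if
      [xh - x = (A^T A)^-1 w + h],  [|w| <= a |r|]  and  [|A h| <= c |xh|],
    then the backward error of [xh] is at most [a + 2 c]
    ([backward_error_split]). A rank-one perturbation acting on [xh] absorbs
    [A h]; another one along the new residual, which is at least as long as [r],
    restores the normal equations.

    The errors of a refinement step have this shape ([refineP_err]). Those of the
    transposed product and of the transposed solve perturb the right-hand side of
    the normal equations and go to [w]; those of the residual and of the inner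
    solver reach the iterate through [A] or through the inverse of the triangular
    factor [T] and go to [h]. If [e_i] is the norm of [T (x - x_i)], then the
    sketched starting point has [e_0] of the order of [|r| + g |x|]
    ([fossils_start]), and a step multiplies [e_i] by a multiple of [kap g] until
    it reaches the level [kap g |r| + g |x|] ([refine_contract]). After two steps
    the only term that is too large for the criterion is [(kap g)^2 |r|], and the
    lower bound assumed on the norm of the computed solution makes it a multiple
    of [g |xh|] ([two_steps_backward]).

    The error of the inner solver obeys the perturbed recurrence
    [z'' = B z' - e^2 z], where [e] is the inflated distortion and
    [B = (1 + e^2) - (1 - e^2)^2 M] for the preconditioned Gram matrix [M]. An
    exact step multiplies the quadratic energy
    [|z'|^2 - <B z', z> + e^2 |z|^2] by [e^2] ([energy_step]). The inflation of
    the distortion keeps the norm of [B] below [2 e], with a relative margin that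
    makes the energy equivalent to the squared norm ([hb_large]); this replaces
    a simultaneous diagonalization. When [e] is so small that rounding errors may
    exceed the margin, a weighted maximum norm contracts instead ([hb_small]).
    Both arguments give at least the rate [sqrt e], down to rounding level, and
    the iteration count ensures [e^(q - 1) <= (kap u)^2] ([q0_power]).

    Householder QR is backward stable ([qrP_back]), so [T] inherits the distortion
    of the sketch up to [kap g]. The condition number, which is defined by
    eigenvalues of [A^T A], bounds norms through the Rayleigh quotient, whose
    infimum is an eigenvalue ([rayleigh_min]).

    For the operation count, the number of iterations is at most a constant times
    [ln (n / u)] because [kap >= 1] ([q_le]); the rest is bookkeeping over the
    programs ([fossilsP_count], [ops_arith]). *)

Set Implicit Arguments.
Unset Strict Implicit.
Unset Printing Implicit Defensive.

Import Order.TTheory GRing.Theory Num.Theory.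
Local Open Scope ring_scope.

(** * Euclidean, Frobenius and spectral norms *)

Section AbsoluteValue.
Context {R : realType}.
Implicit Types x y : R.

(** A copy of the absolute value with codomain [R], for which linear arithmetic
    recognizes products of values as products in [R]. *)
Definition ab (x : R) : R := `|x|.

Lemma abM x y : ab (x * y) = ab x * ab y. Proof. exact: normrM. Qed.
Lemma abD x y : ab (x + y) <= ab x + ab y. Proof. exact: ler_normD. Qed.
Lemma abB x y : ab (x - y) <= ab x + ab y. Proof. exact: ler_normB. Qed.
Lemma abN x : ab (- x) = ab x. Proof. exact: normrN. Qed.
Lemma ab1 : ab 1 = 1. Proof. exact: normr1. Qed.
Lemma ab_ge0 x : 0 <= ab x. Proof. exact: normr_ge0. Qed.
Lemma ab_id x : 0 <= x -> ab x = x. Proof. exact: ger0_norm. Qed.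
Lemma ab_le x y : ab x <= y -> - y <= x /\ x <= y.
Proof. by rewrite /ab ler_norml => /andP. Qed.
Lemma le_ab x y : - y <= x -> x <= y -> ab x <= y.
Proof. by move=> h1 h2; rewrite /ab ler_norml h1. Qed.
Lemma mul_le (a b c d : R) : 0 <= a -> 0 <= c -> a <= b -> c <= d -> a * c <= b * d.
Proof. exact: ler_pM. Qed.
Lemma mul_lel (a b c : R) : 0 <= c -> a <= b -> c * a <= c * b.
Proof. by move=> c0; exact: ler_wpM2l. Qed.
Lemma mul_ler (a b c : R) : 0 <= c -> a <= b -> a * c <= b * c.
Proof. by move=> c0; exact: ler_wpM2r. Qed.
Lemma le_mul2l (a b c : R) : 0 < c -> c * a <= c * b -> a <= b.
Proof. by move=> c0; rewrite ler_pM2l. Qed.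
Lemma mul_ge0 (a b : R) : 0 <= a -> 0 <= b -> 0 <= a * b.
Proof. exact: mulr_ge0. Qed.

End AbsoluteValue.

Section Norms.
Context {R : realType}.

Definition dot n (x y : 'cV[R]_n) : R := (x^T *m y) 0 0.

Lemma dotE n (x y : 'cV[R]_n) : dot x y = \sum_i x i 0 * y i 0.
Proof. by rewrite /dot mxE; apply: eq_bigr => i _; rewrite mxE. Qed.

Lemma dotC n (x y : 'cV[R]_n) : dot x y = dot y x.
Proof. by rewrite !dotE; apply: eq_bigr => i _; rewrite mulrC. Qed.

Lemma dotDl n (x y z : 'cV[R]_n) : dot (x + y) z = dot x z + dot y z.
Proof. by rewrite /dot linearD /= mulmxDl mxE. Qed.

Lemma dotDr n (x y z : 'cV[R]_n) : dot z (x + y) = dot z x + dot z y.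
Proof. by rewrite /dot mulmxDr mxE. Qed.

Lemma dotZl n a (x y : 'cV[R]_n) : dot (a *: x) y = a * dot x y.
Proof. by rewrite /dot linearZ /= -scalemxAl mxE. Qed.

Lemma dotZr n a (x y : 'cV[R]_n) : dot x (a *: y) = a * dot x y.
Proof. by rewrite dotC dotZl dotC. Qed.

Lemma dotNl n (x y : 'cV[R]_n) : dot (- x) y = - dot x y.
Proof. by rewrite -scaleN1r dotZl mulN1r. Qed.

Lemma dotNr n (x y : 'cV[R]_n) : dot x (- y) = - dot x y.
Proof. by rewrite -scaleN1r dotZr mulN1r. Qed.

Lemma dotBl n (x y z : 'cV[R]_n) : dot (x - y) z = dot x z - dot y z.
Proof. by rewrite dotDl dotNl. Qed.

Lemma dotBr n (x y z : 'cV[R]_n) : dot z (x - y) = dot z x - dot z y.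
Proof. by rewrite dotDr dotNr. Qed.

Lemma dot0l n (y : 'cV[R]_n) : dot 0 y = 0.
Proof. by rewrite -(scale0r 0) dotZl mul0r. Qed.

Lemma dot0r n (y : 'cV[R]_n) : dot y 0 = 0.
Proof. by rewrite dotC dot0l. Qed.

Lemma dot_adj m n (A : 'M[R]_(m, n)) x y : dot x (A *m y) = dot (A^T *m x) y.
Proof. by rewrite /dot trmx_mul trmxK mulmxA. Qed.

Lemma dot_adjT m n (A : 'M[R]_(m, n)) x y : dot x (A^T *m y) = dot (A *m x) y.
Proof. by rewrite dot_adj trmxK. Qed.

Lemma dot_ge0 n (x : 'cV[R]_n) : 0 <= dot x x.
Proof. by rewrite dotE sumr_ge0 // => i _; rewrite -expr2 sqr_ge0. Qed.

Lemma norm2_sqE n (x : 'cV[R]_n) : norm2 x ^+ 2 = dot x x.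
Proof.
rewrite /norm2 sqr_sqrtr; last by rewrite sumr_ge0 // => i _; rewrite sqr_ge0.
by rewrite dotE; apply: eq_bigr => i _; rewrite expr2.
Qed.

Lemma norm2E n (x : 'cV[R]_n) : norm2 x = Num.sqrt (dot x x).
Proof. by rewrite -norm2_sqE sqrtr_sqr ger0_norm // sqrtr_ge0. Qed.

Lemma norm2_ge0 n (x : 'cV[R]_n) : 0 <= norm2 x.
Proof. exact: sqrtr_ge0. Qed.

Lemma dot_eq0 n (x : 'cV[R]_n) : (dot x x == 0) = (x == 0).
Proof.
apply/eqP/eqP => [|->]; last by rewrite dot0l.
rewrite dotE => /eqP; rewrite psumr_eq0 => [/allP H|i _]; last by rewrite -expr2 sqr_ge0.
apply/matrixP => i j; rewrite (ord1 j) mxE.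
by have := H i (mem_index_enum i); rewrite mulf_eq0 orbb => /eqP.
Qed.

Lemma norm2_eq0 n (x : 'cV[R]_n) : (norm2 x == 0) = (x == 0).
Proof. by rewrite -dot_eq0 -norm2_sqE sqrf_eq0. Qed.

Lemma norm2_0 n : norm2 (0 : 'cV[R]_n) = 0.
Proof. by apply/eqP; rewrite norm2_eq0. Qed.

Lemma norm2_gt0 n (x : 'cV[R]_n) : (0 < norm2 x) = (x != 0).
Proof. by rewrite lt0r norm2_ge0 andbT norm2_eq0. Qed.

(** The discriminant of a nonnegative quadratic form in [s] and [t]; the common
    source of the Cauchy-Schwarz inequalities below. *)
Lemma discr_le (a b c : R) :
  (forall s t, 0 <= s ^+ 2 * a + 2 * (s * t) * b + t ^+ 2 * c) -> b ^+ 2 <= a * c.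
Proof.
move=> H.
have a0 : 0 <= a by have := H 1 0; nra.
have c0 : 0 <= c by have := H 0 1; nra.
have [cp|] := boolP (0 < c).
  have := H c (- b).
  have -> : c ^+ 2 * a + 2 * (c * - b) * b + (- b) ^+ 2 * c = c * (a * c - b ^+ 2) by ring.
  by rewrite pmulr_rge0 // subr_ge0.
rewrite -leNgt => cn; have {cn c0} c0 : c = 0 by apply/le_anti/andP.
rewrite c0 mulr0; have [->|b0] := eqVneq b 0; first by rewrite expr0n.
have := H 1 (- (a + 1) / (2 * b)); rewrite c0.
have -> : 1 ^+ 2 * a + 2 * (1 * (- (a + 1) / (2 * b))) * b + (- (a + 1) / (2 * b)) ^+ 2 * 0 = -1 by field.
by lra.
Qed.

Lemma dot_CS n (x y : 'cV[R]_n) : dot x y ^+ 2 <= dot x x * dot y y.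
Proof.
apply: discr_le => s t.
have := dot_ge0 (s *: x + t *: y).
rewrite !(dotDl, dotDr, dotZl, dotZr) [dot y x]dotC => H.
apply: le_trans H _; rewrite le_eqVlt; apply/orP; left; apply/eqP; ring.
Qed.

Lemma dot_norm2 n (x y : 'cV[R]_n) : `|dot x y| <= norm2 x * norm2 y.
Proof.
rewrite -ler_sqr ?nnegrE ?mulr_ge0 ?norm2_ge0 //.
by rewrite real_normK ?num_real // exprMn !norm2_sqE dot_CS.
Qed.

Lemma dot_le n (x y : 'cV[R]_n) : dot x y <= norm2 x * norm2 y.
Proof. exact: le_trans (ler_norm _) (dot_norm2 _ _). Qed.

Lemma norm2Z n a (x : 'cV[R]_n) : norm2 (a *: x) = `|a| * norm2 x.
Proof.
by rewrite !norm2E dotZl dotZr mulrA -expr2 sqrtrM ?sqr_ge0 // sqrtr_sqr.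
Qed.

Lemma norm2N n (x : 'cV[R]_n) : norm2 (- x) = norm2 x.
Proof. by rewrite -scaleN1r norm2Z normrN1 mul1r. Qed.

Lemma norm2D n (x y : 'cV[R]_n) : norm2 (x + y) <= norm2 x + norm2 y.
Proof.
rewrite -ler_sqr ?nnegrE ?addr_ge0 ?norm2_ge0 //.
rewrite norm2_sqE !(dotDl, dotDr) [dot y x]dotC sqrrD !norm2_sqE.
have := dot_le x y; lra.
Qed.

Lemma norm2B n (x y : 'cV[R]_n) : norm2 (x - y) <= norm2 x + norm2 y.
Proof. by rewrite -(norm2N y) norm2D. Qed.

Lemma norm2C n (x y : 'cV[R]_n) : norm2 (x - y) = norm2 (y - x).
Proof. by rewrite -norm2N opprB. Qed.

Lemma norm2_near n (x y : 'cV[R]_n) : norm2 x <= norm2 y + norm2 (x - y).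
Proof. rewrite -{1}(subrK y x) addrC; exact: norm2D. Qed.

Lemma ler_norm2 n (x y : 'cV[R]_n) :
  (forall i, `|x i 0| <= `|y i 0|) -> norm2 x <= norm2 y.
Proof.
move=> H; rewrite ler_sqrt ?ler_sum //.
- by move=> i _; rewrite -[_ ^+ 2]real_normK ?num_real // -[leRHS]real_normK ?num_real // ler_sqr ?nnegrE.
- by rewrite sumr_ge0 // => i _; rewrite sqr_ge0.
Qed.

Lemma norm2_entry_le n (x y : 'cV[R]_n) c : 0 <= c ->
  (forall i, `|x i 0| <= c * `|y i 0|) -> norm2 x <= c * norm2 y.
Proof.
move=> c0 H; rewrite -(ger0_norm c0) -norm2Z; apply: ler_norm2 => i.
by rewrite mxE normrM (ger0_norm c0).
Qed.

Lemma norm2_ge_entry n (x : 'cV[R]_n) i : `|x i 0| <= norm2 x.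
Proof.
rewrite -ler_sqr ?nnegrE ?norm2_ge0 // norm2_sqE dotE real_normK ?num_real //.
rewrite (bigD1 i) //= -expr2 lerDl sumr_ge0 // => j _; rewrite -expr2; exact: sqr_ge0.
Qed.

Lemma normF_sqE m n (A : 'M[R]_(m, n)) : normF A ^+ 2 = \sum_i \sum_j A i j ^+ 2.
Proof.
by rewrite sqr_sqrtr // sumr_ge0 // => i _; rewrite sumr_ge0 // => j _; rewrite sqr_ge0.
Qed.

Lemma normF_ge0 m n (A : 'M[R]_(m, n)) : 0 <= normF A.
Proof. exact: sqrtr_ge0. Qed.

Lemma normF_tr m n (A : 'M[R]_(m, n)) : normF A^T = normF A.
Proof.
by rewrite /normF exchange_big /=; congr Num.sqrt; apply: eq_bigr => i _;
   apply: eq_bigr => j _; rewrite mxE.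
Qed.

Lemma normF_mxvec m n (A : 'M[R]_(m, n)) : normF A = norm2 (mxvec A)^T.
Proof.
rewrite /normF /norm2 pair_bigA /=; congr Num.sqrt.
rewrite [RHS](reindex _ (curry_mxvec_bij m n)) /=.
by apply: eq_bigr => -[i j] _; rewrite /= mxE mxvecE.
Qed.

Lemma normFD m n (A B : 'M[R]_(m, n)) : normF (A + B) <= normF A + normF B.
Proof. by rewrite !normF_mxvec !linearD /= norm2D. Qed.

Lemma normFN m n (A : 'M[R]_(m, n)) : normF (- A) = normF A.
Proof. by rewrite !normF_mxvec !linearN /= norm2N. Qed.

Lemma normFZ m n a (A : 'M[R]_(m, n)) : normF (a *: A) = `|a| * normF A.
Proof. by rewrite !normF_mxvec !linearZ /= norm2Z. Qed.

Lemma normF_rows m n (A : 'M[R]_(m, n)) : normF A ^+ 2 = \sum_i norm2 (row i A)^T ^+ 2.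
Proof.
rewrite normF_sqE; apply: eq_bigr => i _; rewrite norm2_sqE dotE.
by apply: eq_bigr => j _; rewrite !mxE expr2.
Qed.

Lemma normF_cols m n (A : 'M[R]_(m, n)) : normF A ^+ 2 = \sum_j norm2 (col j A) ^+ 2.
Proof.
rewrite -normF_tr normF_rows; apply: eq_bigr => i _.
by congr (norm2 _ ^+ 2); apply/matrixP => j k; rewrite !mxE.
Qed.

Lemma norm2_mul m n (A : 'M[R]_(m, n)) (x : 'cV[R]_n) :
  norm2 (A *m x) <= normF A * norm2 x.
Proof.
rewrite -ler_sqr ?nnegrE ?mulr_ge0 ?normF_ge0 ?norm2_ge0 //.
rewrite norm2_sqE dotE exprMn normF_rows mulr_suml; apply: ler_sum => i _.
have -> : (A *m x) i 0 = dot (row i A)^T x.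
  by rewrite /dot trmxK -row_mul [RHS]mxE.
by rewrite -expr2 !norm2_sqE dot_CS.
Qed.

Lemma normF_entry_le m n (A B : 'M[R]_(m, n)) c : 0 <= c ->
  (forall i j, `|A i j| <= c * `|B i j|) -> normF A <= c * normF B.
Proof.
move=> c0 H; rewrite !normF_mxvec; apply: norm2_entry_le => // k.
by case/mxvec_indexP: k => i j; rewrite !mxE !mxvecE.
Qed.

Lemma normF_outer m n (x : 'cV[R]_m) (y : 'cV[R]_n) :
  normF (x *m y^T) = norm2 x * norm2 y.
Proof.
have H : normF (x *m y^T) ^+ 2 = (norm2 x * norm2 y) ^+ 2.
  rewrite normF_rows exprMn (norm2_sqE x) dotE mulr_suml; apply: eq_bigr => i _.
  rewrite row_mul trmx_mul trmxK.
  have -> : (row i x)^T = (x i 0)%:M.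
    by apply/matrixP => a b; rewrite !mxE (ord1 a) (ord1 b) eqxx.
  by rewrite mul_mx_scalar norm2Z exprMn real_normK ?num_real // expr2.
apply/eqP; rewrite -(eqrXn2 (n:=2)) ?mulr_ge0 ?normF_ge0 ?norm2_ge0 //; exact/eqP.
Qed.

(** By Cauchy-Schwarz, since [|A^T w|^2] is the scalar product of [w] and
    [A (A^T w)]. *)
Lemma norm2_adj m n (A : 'M[R]_(m, n)) c : 0 <= c ->
  (forall y, norm2 (A *m y) <= c * norm2 y) ->
  forall w, norm2 (A^T *m w) <= c * norm2 w.
Proof.
move=> c0 H w; have [->|w0] := eqVneq (A^T *m w) 0.
  by rewrite norm2_0 mulr_ge0 ?norm2_ge0.
rewrite -norm2_gt0 in w0; rewrite -(ler_pM2r w0) -expr2 norm2_sqE -dot_adj.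
apply: le_trans (dot_le _ _) _; rewrite mulrAC mulrC ler_wpM2r ?norm2_ge0 //.
Qed.

Lemma opnorm_ub m n (A : 'M[R]_(m, n)) : has_ubound
  [set norm2 (A *m y) | y in [set y : 'cV[R]_n | norm2 y <= 1]]%classic.
Proof.
exists (normF A) => _ [y y1 <-]; apply: le_trans (norm2_mul _ _) _.
by rewrite -[leRHS]mulr1 ler_wpM2l ?normF_ge0.
Qed.

Lemma opnorm_ge0 m n (A : 'M[R]_(m, n)) : 0 <= opnorm A.
Proof.
rewrite -(norm2_0 m); apply: (ub_le_sup (opnorm_ub A)).
by exists 0; rewrite /= ?mulmx0 // norm2_0 ler01.
Qed.

Lemma opnormP m n (A : 'M[R]_(m, n)) y : norm2 (A *m y) <= opnorm A * norm2 y.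
Proof.
have [->|y0] := eqVneq y 0; first by rewrite mulmx0 !norm2_0 mulr0.
rewrite -norm2_gt0 in y0; rewrite -ler_pdivrMr //.
apply: (ub_le_sup (opnorm_ub A)); exists ((norm2 y)^-1 *: y) => /=.
  by rewrite norm2Z gtr0_norm ?invr_gt0 // mulVf ?gt_eqF.
by rewrite -scalemxAr norm2Z gtr0_norm ?invr_gt0 // mulrC.
Qed.

Lemma opnorm_le m n (A : 'M[R]_(m, n)) c : 0 <= c ->
  (forall y, norm2 (A *m y) <= c * norm2 y) -> opnorm A <= c.
Proof.
move=> c0 H; apply: ge_sup.
  by exists (norm2 (A *m 0)); exists 0; rewrite //= norm2_0.
move=> _ [y /= y1 <-]; apply: le_trans (H y) _.
by rewrite -[leRHS]mulr1 ler_wpM2l.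
Qed.

Lemma norm2_delta n (j : 'I_n) : norm2 (delta_mx j 0 : 'cV[R]_n) = 1.
Proof.
apply/eqP; rewrite -(eqrXn2 (n:=2)) ?norm2_ge0 ?ler01 // expr1n norm2_sqE dotE.
rewrite (bigD1 j) //= big1 => [|i ij]; first by rewrite mxE !eqxx mul1r addr0.
by rewrite mxE (negPf ij) mul0r.
Qed.

Lemma normF_le_opnorm m n (A : 'M[R]_(m, n)) : normF A <= n%:R * opnorm A.
Proof.
rewrite -ler_sqr ?nnegrE ?mulr_ge0 ?normF_ge0 ?opnorm_ge0 //.
rewrite normF_cols; apply: (@le_trans _ _ (\sum_(j < n) opnorm A ^+ 2)).
  apply: ler_sum => j _; rewrite ler_sqr ?nnegrE ?norm2_ge0 ?opnorm_ge0 //.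
  by rewrite colE; have := opnormP A (delta_mx j 0); rewrite norm2_delta mulr1.
rewrite sumr_const card_ord exprMn -[leLHS]mulr_natl ler_wpM2r ?sqr_ge0 //.
by rewrite -natrX ler_nat; case: (n) => // k; rewrite expnS expn1 leq_pmull.
Qed.

Lemma opnorm_le_normF m n (A : 'M[R]_(m, n)) : opnorm A <= normF A.
Proof. by apply: opnorm_le (normF_ge0 _) _ => y; exact: norm2_mul. Qed.

Lemma normF_col1 m (x : 'cV[R]_m) : normF x = norm2 x.
Proof. by rewrite /normF /norm2; congr Num.sqrt; apply: eq_bigr => i _; rewrite big_ord1. Qed.

(** The lower bound makes the kernel trivial, which suffices for a square matrix. *)
Lemma unitmx_lb n (B : 'M[R]_n) c : 0 < c ->
  (forall y, c * norm2 y <= norm2 (B *m y)) -> B \in unitmx.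
Proof.
move=> c0 H; rewrite -unitmx_tr -row_free_unit -kermx_eq0.
apply/eqP/row_matrixP => i; rewrite row0.
set v := row i _; have vB : v *m B^T = 0 by rewrite -row_mul mulmx_ker row0.
have : norm2 v^T <= 0.
  rewrite -(pmulr_rle0 _ c0); apply: le_trans (H _) _.
  by rewrite -[B]trmxK -trmx_mul vB trmx0 norm2_0.
move=> h; have : norm2 v^T == 0 by rewrite eq_le h norm2_ge0.
by rewrite norm2_eq0 => /eqP /(congr1 trmx); rewrite trmxK trmx0.
Qed.

End Norms.

(** * Singular values and the condition number *)

Section Singular.
Context {R : realType}.

Lemma psd_CS n (Q : 'M[R]_n) : Q^T = Q -> (forall x, 0 <= dot x (Q *m x)) ->
  forall x y, dot x (Q *m y) ^+ 2 <= dot x (Q *m x) * dot y (Q *m y).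
Proof.
move=> sQ pQ x y; apply: discr_le => s t.
have := pQ (s *: x + t *: y).
have E : dot y (Q *m x) = dot x (Q *m y) by rewrite dot_adj sQ dotC.
rewrite mulmxDr -!scalemxAr !(dotDl, dotDr, dotZl, dotZr) E => H.
apply: le_trans H _; rewrite le_eqVlt; apply/orP; left; apply/eqP; ring.
Qed.

(** For an invertible positive semidefinite [Q], Cauchy-Schwarz with [x = Q y]
    gives [|Q y|^2 <= |Q| y^T Q y], while [|y| <= |Q^-1| |Q y|]. *)
Lemma psd_unit_pos n (Q : 'M[R]_n) : Q^T = Q -> (forall x, 0 <= dot x (Q *m x)) ->
  Q \in unitmx -> exists2 c, 0 < c & forall y, c * dot y y <= dot y (Q *m y).
Proof.
move=> sQ pQ uQ.
have F0 := normF_ge0 Q; have G0 := normF_ge0 (invmx Q).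
set F := normF Q + 1; set G := normF (invmx Q) + 1.
have Fp : 0 < F by rewrite /F; lra.
have Gp : 0 < G by rewrite /G; lra.
exists (G ^+ 2 * F)^-1; first by rewrite invr_gt0 mulr_gt0 ?exprn_gt0.
move=> y; rewrite ler_pdivrMl; last by rewrite mulr_gt0 ?exprn_gt0.
have h1 : norm2 y <= G * norm2 (Q *m y).
  rewrite -{1}(mulKmx uQ y); apply: le_trans (norm2_mul _ _) _.
  by rewrite ler_wpM2r ?norm2_ge0 // /G lerDl.
have h2 : norm2 (Q *m y) ^+ 2 <= F * dot y (Q *m y).
  have [->|Qy0] := eqVneq (Q *m y) 0.
    by rewrite norm2_0 expr0n /= dot0r mulr0.
  rewrite -norm2_gt0 in Qy0.
  have h := psd_CS sQ pQ (Q *m y) y.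
  rewrite -norm2_sqE in h.
  have h3 : dot (Q *m y) (Q *m (Q *m y)) <= F * norm2 (Q *m y) ^+ 2.
    apply: le_trans (dot_le _ _) _; rewrite expr2 mulrA [leRHS]mulrC ler_wpM2l ?norm2_ge0 //.
    apply: le_trans (norm2_mul _ _) _; rewrite ler_wpM2r ?norm2_ge0 // /F lerDl //.
  have h4 := le_trans h (ler_wpM2r (pQ y) h3).
  by rewrite -(ler_pM2l (exprn_gt0 2 Qy0)); lra.
rewrite -norm2_sqE -mulrA; apply: (@le_trans _ _ (G ^+ 2 * norm2 (Q *m y) ^+ 2)).
  by rewrite -exprMn ler_sqr ?nnegrE ?norm2_ge0 // mulr_ge0 ?norm2_ge0 // ltW.
by rewrite ler_wpM2l // sqr_ge0.
Qed.

(** The infimum [mu] of the Rayleigh quotient is an eigenvalue: otherwise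
    [Q - mu] would be invertible, hence positive definite with a margin. *)
Lemma rayleigh_min n (Q : 'M[R]_n) : (0 < n)%N -> Q^T = Q ->
  exists2 mu, eigenvalue Q mu & forall y, mu * dot y y <= dot y (Q *m y).
Proof.
move=> n0 sQ.
pose S := [set dot y (Q *m y) | y in [set y : 'cV[R]_n | norm2 y = 1]]%classic.
have lbS : has_lbound S.
  exists (- normF Q) => _ [y /= y1 <-].
  have h := dot_norm2 y (Q *m y).
  have := norm2_mul Q y; rewrite y1 mulr1 mul1r in h * => h2.
  have := le_trans h h2; rewrite ler_norml => /andP[] //.
have neS : (S !=set0)%classic.
  exists (dot (delta_mx (Ordinal n0) 0) (Q *m delta_mx (Ordinal n0) 0)).
  by exists (delta_mx (Ordinal n0) 0); rewrite //= norm2_delta.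
set mu := inf S.
have Hmu y : mu * dot y y <= dot y (Q *m y).
  have [->|y0] := eqVneq y 0; first by rewrite mulmx0 !dot0l mulr0.
  rewrite -norm2_gt0 in y0.
  have : mu <= dot ((norm2 y)^-1 *: y) (Q *m ((norm2 y)^-1 *: y)).
    apply: (ge_inf lbS); exists ((norm2 y)^-1 *: y) => //=.
    by rewrite norm2Z gtr0_norm ?invr_gt0 // mulVf ?gt_eqF.
  rewrite -scalemxAr dotZl dotZr mulrA -expr2 exprVn mulrC ler_pdivlMr ?exprn_gt0 //.
  by rewrite norm2_sqE.
exists mu => //.
pose P := Q - mu%:M.
have sP : P^T = P by rewrite /P linearB /= sQ tr_scalar_mx.
have dP y : dot y (P *m y) = dot y (Q *m y) - mu * dot y y.
  by rewrite /P mulmxBl dotBr mul_scalar_mx dotZr.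
have pP y : 0 <= dot y (P *m y) by rewrite dP subr_ge0.
have nP : P \notin unitmx.
  apply/negP => uP; have [c c0 H] := psd_unit_pos sP pP uP.
  suff : mu + c <= mu by lra.
  apply: lb_le_inf => // _ [y /= y1 <-].
  by have := H y; rewrite dP -norm2_sqE y1 expr1n; lra.
rewrite /eigenvalue /eigenspace kermx_eq0 row_free_unit.
exact: nP.
Qed.

Lemma eigen_dot m n (A : 'M[R]_(m, n)) a : eigenvalue (A^T *m A) a ->
  exists2 v : 'cV[R]_n, v != 0 & norm2 (A *m v) ^+ 2 = a * norm2 v ^+ 2.
Proof.
case/eigenvalueP => v vE v0; exists v^T; first by rewrite trmx_eq0.
rewrite !norm2_sqE -dot_adjT mulmxA.
have -> : A^T *m A *m v^T = a *: v^T.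
  by apply: trmx_inj; rewrite linearZ /= trmxK -vE trmx_mul trmxK trmx_mul trmxK.
by rewrite dotZr.
Qed.

(** The infimum of the Rayleigh quotient of [A^T A] is the square of a singular
    value, hence at least the square of the smallest one. *)
Lemma sigma_min_le m n (A : 'M[R]_(m, n)) y :
  sigma_min A * norm2 y <= norm2 (A *m y).
Proof.
have [n0|n0] := posnP n.
  have -> : y = 0 by apply/matrixP => i; case: i => i hi; exfalso; rewrite n0 in hi.
  by rewrite mulmx0 !norm2_0 mulr0.
have sQ : (A^T *m A)^T = A^T *m A by rewrite trmx_mul trmxK.
have [mu ev Hmu] := rayleigh_min n0 sQ.
have [v v0 Hv] := eigen_dot ev.
rewrite -norm2_gt0 in v0.
have mu0 : 0 <= mu.
  by rewrite -(pmulr_lge0 _ (exprn_gt0 2 v0)) -Hv sqr_ge0.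
have h : sigma_min A <= Num.sqrt mu.
  apply: ge_inf; first by exists 0 => s [].
  by split; rewrite ?sqrtr_ge0 // sqr_sqrtr.
apply: (@le_trans _ _ (Num.sqrt mu * norm2 y)).
  by rewrite ler_wpM2r ?norm2_ge0.
rewrite -ler_sqr ?nnegrE ?mulr_ge0 ?sqrtr_ge0 ?norm2_ge0 //.
by rewrite exprMn (sqr_sqrtr mu0) !norm2_sqE -dot_adjT mulmxA.
Qed.

(** The same for the supremum of the Rayleigh quotient, which is the infimum for
    [- A^T A]. *)
Lemma opnorm_le_sigma_max m n (A : 'M[R]_(m, n)) : (0 < n)%N ->
  opnorm A <= sigma_max A.
Proof.
move=> n0.
have sQ : (- (A^T *m A))^T = - (A^T *m A) by rewrite linearN /= trmx_mul trmxK.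
have [mu ev Hmu] := rayleigh_min n0 sQ.
have ev' : eigenvalue (A^T *m A) (- mu).
  case/eigenvalueP: ev => v vE v0; apply/eigenvalueP; exists v => //.
  by rewrite scaleNr -vE mulmxN opprK.
have [v v0 Hv] := eigen_dot ev'.
rewrite -norm2_gt0 in v0.
have mu0 : 0 <= - mu.
  by rewrite -(pmulr_lge0 _ (exprn_gt0 2 v0)) -Hv sqr_ge0.
apply: (@le_trans _ _ (Num.sqrt (- mu))).
  apply: opnorm_le; rewrite ?sqrtr_ge0 // => y.
  rewrite -ler_sqr ?nnegrE ?mulr_ge0 ?sqrtr_ge0 ?norm2_ge0 //.
  rewrite exprMn (sqr_sqrtr mu0) !norm2_sqE -dot_adjT mulmxA mulNr lerNr.
  by rewrite -dotNr -mulNmx.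
apply: ub_le_sup; last by split; rewrite ?sqrtr_ge0 // sqr_sqrtr.
exists (opnorm A) => s [s0 /eigen_dot[w w0 Hw]].
rewrite -norm2_gt0 in w0.
rewrite -(ler_pM2r w0); apply: le_trans (opnormP A w).
rewrite -ler_sqr ?nnegrE ?mulr_ge0 ?norm2_ge0 //; by rewrite Hw exprMn.
Qed.

(** All that the analysis uses of the condition number. *)
Lemma opnorm_le_cond m n (A : 'M[R]_(m, n)) y : 0 < sigma_min A ->
  opnorm A * norm2 y <= cond A * norm2 (A *m y).
Proof.
move=> s0; have [n0|n0] := posnP n.
  have -> : y = 0 by apply/matrixP => i; case: i => i hi; exfalso; rewrite n0 in hi.
  by rewrite mulmx0 !norm2_0 !mulr0.
have h := opnorm_le_sigma_max A n0.
apply: (@le_trans _ _ (sigma_max A * norm2 y)); first by rewrite ler_wpM2r ?norm2_ge0.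
rewrite /cond -mulrA ler_wpM2l ?(le_trans (opnorm_ge0 A)) //.
by rewrite ler_pdivlMl // sigma_min_le.
Qed.

End Singular.

(** * Rounding errors of sums, products and triangular solves *)

Section Rounding.
Context {R : realType}.
Variable u : R.
Hypothesis u0 : 0 <= u.

(** The relative error accumulated by [k] roundings, in the form that composes
    exactly ([gamM]). *)
Definition gam (k : nat) : R := (1 + u) ^+ k - 1.

Lemma gam_ge0 k : 0 <= gam k.
Proof. by rewrite /gam subr_ge0 exprn_ege1 // lerDl. Qed.

Lemma gam_le k l : (k <= l)%N -> gam k <= gam l.
Proof. by move=> kl; rewrite /gam lerD2r ler_weXn2l // lerDl. Qed.

Lemma gam1 : gam 1 = u.
Proof. by rewrite /gam expr1 addrC addKr. Qed.

Lemma gamM k l (s t : R) : `|s| <= gam k -> `|t| <= gam l ->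
  `|(1 + s) * (1 + t) - 1| <= gam (k + l).
Proof.
move=> hs ht; have -> : (1 + s) * (1 + t) - 1 = s + t + s * t by ring.
have -> : gam (k + l) = gam k + gam l + gam k * gam l by rewrite /gam exprD; ring.
apply: le_trans (ler_normD _ _) _; apply: lerD.
  by apply: le_trans (ler_normD _ _) _; apply: lerD.
by rewrite normrM ler_pM.
Qed.

Lemma gam_lin k : k%:R * u <= 1 / 2 -> gam k <= 2 * (k%:R * u).
Proof.
rewrite /gam; elim: k => [|k IH]; first by rewrite mul0r expr0 mulr0 subrr.
rewrite -(natr1 k) => h.
have u0' := u0; have h1 : k%:R * u <= 1 / 2 by nra.
have := IH h1; rewrite exprS; have : 0 <= k%:R :> R by [].
by set a : R := k%:R in h h1 *; set p := _ ^+ k; nra.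
Qed.

Lemma flP e v k : fl u e v k -> exists2 d : R, `|d| <= gam 1 & v = e * (1 + d).
Proof. by case=> -[d hd ->] _; exists d; rewrite // gam1. Qed.

Lemma fl_err e v k : fl u e v k -> `|v - e| <= u * `|e|.
Proof.
case=> -[d hd ->] _; have -> : e * (1 + d) - e = e * d by ring.
by rewrite normrM mulrC ler_wpM2r.
Qed.

Lemma fl_count e v k : fl u e v k -> k = 1%N.
Proof. by case. Qed.

Lemma sumP_count s a k : sumP u s a k -> k = (size s).-1.
Proof.
elim=> {s a k} [//|//|s s1 s2 a1 a2 a k1 k2 k ps n1 n2 _ -> _ -> /fl_count ->].
rewrite (perm_size ps) size_cat.
by case: s1 n1 {ps} => // x s1 _; case: s2 n2 => // y s2 _ /=; rewrite addn1 addnS.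
Qed.

(** In every order of summation each summand goes through fewer additions than
    there are summands. The errors are indexed by an arbitrary duplicate-free
    list, because equal summands may be rounded differently. *)
Lemma sumP_theta s a k : sumP u s a k ->
  forall (I : eqType) (l : seq I) (f : I -> R), s = map f l -> uniq l ->
  exists2 th : I -> R, (forall i, `|th i| <= gam (size l).-1)
    & a = \sum_(i <- l) f i * (1 + th i).
Proof.
elim=> {s a k} [|a|s s1 s2 a1 a2 a k1 k2 k ps n1 n2 _ IH1 _ IH2 fla] I l f.
- case: l => // _ _; exists (fun _ => 0); rewrite ?big_nil // => i.
  by rewrite normr0 gam_ge0.
- case: l => [//|i [|//]] /= [->] _; exists (fun _ => 0) => [j|].
    by rewrite normr0 gam_ge0.
  by rewrite big_seq1 addr0 mulr1.
move=> sl ul.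
have [i0 i0l] : exists i0, i0 \in l.
  case: l sl {ul} => [|i l] sl; last by exists i; rewrite mem_head.
  by move: ps; rewrite sl /=; case: s1 n1 {IH1} => // x s1 _ /perm_size.
move: ps; rewrite sl perm_sym => /(perm_iotaP 0) [Is pIs eIs].
pose l' := [seq nth i0 l i | i <- Is].
have pl : perm_eq l' l.
  rewrite /l'; have := perm_map (nth i0 l) pIs; rewrite size_map => /perm_trans; apply.
  by rewrite -/(mkseq _ _) mkseq_nth perm_refl.
have e12 : s1 ++ s2 = map f l'.
  rewrite eIs -map_comp; apply/eq_in_map => j jI /=.
  have : j \in iota 0 (size (map f l)) by rewrite -(perm_mem pIs).
  by rewrite mem_iota /= add0n size_map => jl; rewrite (nth_map i0).
have ul' : uniq l' by rewrite (perm_uniq pl).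
pose l1 := take (size s1) l'; pose l2 := drop (size s1) l'.
have e1 : s1 = map f l1 by rewrite map_take -e12 take_size_cat.
have e2 : s2 = map f l2 by rewrite map_drop -e12 drop_size_cat.
have l12 : l1 ++ l2 = l' by rewrite cat_take_drop.
have : uniq (l1 ++ l2) by rewrite l12.
rewrite cat_uniq => /and3P[u1 /hasPn dis u2].
have [th1 h1 E1] := IH1 I l1 f e1 u1.
have [th2 h2 E2] := IH2 I l2 f e2 u2.
have [d hd E] := flP fla.
have sz1 : (0 < size l1)%N by rewrite -(size_map f) -e1; case: (s1) n1.
have sz2 : (0 < size l2)%N by rewrite -(size_map f) -e2; case: (s2) n2.
have sz : size l = (size l1 + size l2)%N by rewrite -(perm_size pl) -l12 size_cat.
exists (fun i => (1 + (if i \in l1 then th1 i else th2 i)) * (1 + d) - 1) => [i|].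
  case: ifP => _.
    apply: le_trans (gamM (h1 i) hd) _; apply: gam_le.
    by rewrite addn1 prednK // sz; case: (size l2) sz2 => // n _; rewrite addnS /= leq_addr.
  apply: le_trans (gamM (h2 i) hd) _; apply: gam_le.
  by rewrite addn1 prednK // sz; case: (size l1) sz1 => // n _; rewrite addSn /= leq_addl.
rewrite -(perm_big _ pl) /= -l12 big_cat /= E E1 E2 mulrDl !mulr_suml.
congr (_ + _); apply: eq_big_seq => i il.
  by rewrite il; ring.
by rewrite (negPf (dis i il)); ring.
Qed.

Lemma mapP_fun (I : eqType) (T : Type) (f : I -> prog T) l ys k :
  Defs.mapP f l ys k -> uniq l ->
  exists (g : I -> option T) (c : I -> nat),
    [/\ map Some ys = map g l,
        forall i, i \in l -> exists2 y, g i = Some y & f i y (c i)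
      & k = (\sum_(i <- l) c i)%N].
Proof.
elim: l ys k => [|x l IH] ys k /=.
  by case=> -> -> _; exists (fun _ => None), (fun _ => 0%N); split; rewrite ?big_nil.
case=> y [k1 [k2 [fy [ys' [k3 [k4 [fys [-> ->] ->]]]] ->]]] /andP[xl ul].
have [g [c [e1 e2 ->]]] := IH _ _ fys ul.
exists (fun i => if i == x then Some y else g i), (fun i => if i == x then k1 else c i).
split.
- rewrite /= eqxx; congr cons; rewrite e1; apply/eq_in_map => i il.
  by case: eqP il xl => // -> ->.
- move=> i; rewrite inE; case: eqP => [-> _|_ /= il]; first by exists y.
  exact: e2.
- rewrite big_cons eqxx addn0; congr addn.
  by apply: eq_big_seq => i il; case: eqP il xl => // -> ->.
Qed.

Lemma mapP_fl (I : eqType) (e : I -> R) l ps k :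
  Defs.mapP (fun i => fl u (e i)) l ps k -> uniq l ->
  k = size l /\ exists2 d : I -> R, (forall i, `|d i| <= gam 1) &
    ps = [seq e i * (1 + d i) | i <- l].
Proof.
move=> /mapP_fun h /h [g [c [e1 e2 ->]]]; split.
  rewrite -sum1_size; apply: eq_big_seq => i /e2 [y _].
  exact: fl_count.
have H i : exists d, `|d| <= gam 1 /\ (i \in l -> g i = Some (e i * (1 + d))).
  have [il|nil] := boolP (i \in l).
    have [y -> /flP [d hd ->]] := e2 i il; by exists d.
  by exists 0; rewrite normr0 gam_ge0.
have [d hd] := choice H; exists d => [i|]; first by case: (hd i).
apply: (inj_map (@Some_inj _)); rewrite e1 -map_comp.
by apply/eq_in_map => i il /=; case: (hd i) => _ /(_ il).
Qed.

Lemma dotP_theta (I : eqType) (l : seq I) (f g : I -> R) a k :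
  dotP u l f g a k -> uniq l ->
  (k <= 2 * size l)%N /\ exists2 th : I -> R, (forall i, `|th i| <= gam (size l))
    & a = \sum_(i <- l) f i * g i * (1 + th i).
Proof.
case=> ps [k1 [k2 [hm hs ->]]] ul.
have [-> [d hd E]] := mapP_fl hm ul.
split.
  by rewrite (sumP_count hs) E size_map mul2n -addnn leq_add2l leq_pred.
have [th hth ->] := sumP_theta hs E ul.
exists (fun i => if i \in l then (1 + d i) * (1 + th i) - 1 else 0) => [i|].
  case: ifP => [il|_]; last by rewrite normr0 gam_ge0.
  apply: le_trans (gamM (hd i) (hth i)) _; rewrite add1n prednK //.
  by case: (l) il.
apply: eq_big_seq => i il; rewrite il; ring.
Qed.

Lemma entriesP_count m n (f : 'I_m -> 'I_n -> prog R) X k b :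
  entriesP f X k -> (forall i j x c, f i j x c -> (c <= b)%N) -> (k <= m * n * b)%N.
Proof.
case=> c [hc ->] hb.
apply: (@leq_trans (\sum_(i < m) \sum_(j < n) b)%N).
  by apply: leq_sum => i _; apply: leq_sum => j _; exact: hb (hc i j).
by rewrite !sum_nat_const !card_ord mulnA.
Qed.

Lemma columnsP_count m n (f : 'I_n -> prog 'cV[R]_m) X k b :
  columnsP f X k -> (forall j x c, f j x c -> (c <= b)%N) -> (k <= n * b)%N.
Proof.
case=> c [hc ->] hb.
apply: (@leq_trans (\sum_(j < n) b)%N).
  by apply: leq_sum => j _; exact: hb (hc j).
by rewrite !sum_nat_const !card_ord.
Qed.

Lemma enum_uniqS n (P : pred 'I_n) : uniq [seq i <- enum 'I_n | P i].
Proof. by rewrite filter_uniq // enum_uniq. Qed.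

Lemma size_enumS n (P : pred 'I_n) : (size [seq i <- enum 'I_n | P i] <= n)%N.
Proof. by rewrite size_filter (leq_trans (count_size _ _)) // size_enum_ord. Qed.

Lemma mulvP_back m n (A : 'M[R]_(m, n)) x y k : mulvP u A x y k ->
  exists2 E : 'M[R]_(m, n), (forall i j, `|E i j| <= gam n * `|A i j|)
    & y = (A + E) *m x.
Proof.
case=> c [hc _].
have H i : exists th : 'I_n -> R, (forall j, `|th j| <= gam n) /\
    y i 0 = \sum_j A i j * x j 0 * (1 + th j).
  have [_ [th hth ->]] := dotP_theta (hc i 0) (enum_uniq _).
  exists th; split=> [j|]; first by have := hth j; rewrite size_enum_ord.
  by rewrite big_enum.
have [th hth] := choice H.
exists (\matrix_(i, j) (A i j * th i j)) => [i j|].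
  by rewrite mxE normrM mulrC ler_wpM2r //; case: (hth i).
apply/matrixP => i j; rewrite (ord1 j) !mxE; case: (hth i) => _ ->.
by apply: eq_bigr => l _; rewrite !mxE; ring.
Qed.

Lemma mulvP_count m n (A : 'M[R]_(m, n)) x y k : mulvP u A x y k ->
  (k <= m * (2 * n))%N.
Proof.
move=> /entriesP_count h; have := h (2 * n)%N; rewrite muln1; apply.
by move=> i _ z c /dotP_theta - /(_ (enum_uniq _)) []; rewrite size_enum_ord.
Qed.

Lemma mulvP_err m n (A : 'M[R]_(m, n)) x y k : mulvP u A x y k ->
  norm2 (y - A *m x) <= gam n * normF A * norm2 x.
Proof.
case/mulvP_back => E hE ->; rewrite mulmxDl addrC addKr.
apply: le_trans (norm2_mul _ _) _; rewrite ler_wpM2r ?norm2_ge0 //.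
by apply: normF_entry_le hE; exact: gam_ge0.
Qed.

Lemma addvP_err m (x y z : 'cV[R]_m) k : Defs.addvP u x y z k ->
  norm2 (z - (x + y)) <= u * norm2 (x + y).
Proof.
case=> c [hc _]; apply: norm2_entry_le => // i; rewrite !mxE.
exact: fl_err (hc i 0).
Qed.

Lemma subvP_err m (x y z : 'cV[R]_m) k : Defs.subvP u x y z k ->
  norm2 (z - (x - y)) <= u * norm2 (x - y).
Proof.
case=> c [hc _]; apply: norm2_entry_le => // i; rewrite !mxE.
exact: fl_err (hc i 0).
Qed.

Lemma scalevP_err m a (x z : 'cV[R]_m) k : scalevP u a x z k ->
  norm2 (z - a *: x) <= u * norm2 (a *: x).
Proof.
case=> c [hc _]; apply: norm2_entry_le => // i; rewrite !mxE.
exact: fl_err (hc i 0).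
Qed.

Lemma addvP_count m (x y z : 'cV[R]_m) k : Defs.addvP u x y z k -> (k <= m)%N.
Proof.
move=> /entriesP_count h; have := h 1%N; rewrite !muln1; apply.
by move=> i j v c /fl_count ->.
Qed.

Lemma subvP_count m (x y z : 'cV[R]_m) k : Defs.subvP u x y z k -> (k <= m)%N.
Proof.
move=> /entriesP_count h; have := h 1%N; rewrite !muln1; apply.
by move=> i j v c /fl_count ->.
Qed.

Lemma scalevP_count m a (x z : 'cV[R]_m) k : scalevP u a x z k -> (k <= m)%N.
Proof.
move=> /entriesP_count h; have := h 1%N; rewrite !muln1; apply.
by move=> i j v c /fl_count ->.
Qed.

(** Substitution: dividing the computed row equation by the factor of [c_i]
    moves all the rounding errors to the matrix. *)
Lemma substP_back n (before : rel 'I_n) (T : 'M[R]_n) c z k :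
  substP u before T c z k -> gam n.+1 <= 1 / 2 ->
  (forall i, ~~ before i i) -> (forall i, T i i != 0) ->
  (forall i j, T i j != 0 -> (j == i) || before j i) ->
  exists2 E : 'M[R]_n, (forall i j, `|E i j| <= 4 * gam n.+1 * `|T i j|)
    & (T + E) *m z = c.
Proof.
case=> w [hw _] G2 irr T0 Tb.
have G0 := gam_ge0 n.+1.
set G := gam n.+1 in G2 G0 *.
suff H i : exists e : 'I_n -> R, (forall j, `|e j| <= 4 * G) /\
    \sum_j T i j * (1 + e j) * z j 0 = c i 0.
  have [e he] := choice H.
  exists (\matrix_(i, j) (T i j * e i j)) => [i j|].
    by rewrite mxE normrM mulrC ler_wpM2r //; case: (he i).
  apply/matrixP => i j; rewrite (ord1 j) !mxE; case: (he i) => _ <-.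
  by apply: eq_bigr => l _; rewrite !mxE; ring.
have [ps [k1 [k2 [hps [s [k3 [k4 [hs hz _]]]] _]]]] := hw i.
set l := [seq j <- enum 'I_n | before j i] in hps.
have ul : uniq l by exact: enum_uniqS.
have [_ [d hd E]] := mapP_fl hps ul.
have [dz hdz Ez] := flP hz.
(* the summands of the row equation: [None] for [c_i], [Some j] for unknown [j] *)
pose l' := None :: map Some l.
pose f (o : option 'I_n) := if o is Some j then - (T i j * z j 0 * (1 + d j)) else c i 0.
have El : c i 0 :: map -%R ps = map f l'.
  by rewrite /l' /= E -!map_comp.
have ul' : uniq l'.
  rewrite /l' /= map_inj_uniq ?ul ?andbT; last by move=> a b [].
  by apply/mapP => -[].
have [th hth Es] := sumP_theta hs El ul'.
have szl : ((size l').-1 <= n)%N by rewrite /= size_map size_enumS.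
have {}hth o : `|th o| <= gam n by apply: le_trans (hth o) (gam_le szl).
have Gn : gam n <= G by apply: gam_le.
have G1 : gam 1 <= G by apply: gam_le.
have th0 : `|th None| <= G := le_trans (hth _) Gn.
have t0 : 1 + th None != 0.
  apply/eqP => h; have E1 : th None = -1 by lra.
  by move: th0; rewrite E1 normrN1 => ?; lra.
have dz0 : 1 + dz != 0.
  apply/eqP => h; have E1 : dz = -1 by lra.
  by move: hdz; rewrite E1 normrN1 => ?; lra.
rewrite /l' big_cons /= big_map in Es.
pose e j := if j == i then ((1 + th None) * (1 + dz))^-1 - 1
  else if before j i then (1 + d j) * (1 + th (Some j)) / (1 + th None) - 1 else 0.
exists e; split=> [j|].
  rewrite /e; case: ifP => _.
    have := gamM (hth None) hdz; rewrite addn1 -/G.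
    set t := (1 + th None) * (1 + dz) => ht.
    have t1 : 1 / 2 <= t by move: ht; rewrite ler_norml => /andP[]; lra.
    have tn0 : t != 0 by apply/eqP; lra.
    have -> : t^-1 - 1 = - (t - 1) / t by field.
    rewrite normrM normrN normfV (ger0_norm (_ : 0 <= t)); last by lra.
    by rewrite ler_pdivrMr; nra.
  case: ifP => _; last by rewrite normr0; lra.
  have := gamM (hd j) (hth (Some j)); rewrite add1n -/G.
  set t := _ * _ => ht.
  have tt : 1 / 2 <= 1 + th None by move: th0; rewrite ler_norml => /andP[]; lra.
  have -> : t / (1 + th None) - 1 = (t - 1 - th None) / (1 + th None) by field.
  rewrite normrM normfV (ger0_norm (_ : 0 <= 1 + th None)); last by lra.
  rewrite ler_pdivrMr; last by lra.
  apply: le_trans (ler_normB _ _) _; nra.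
have -> : \sum_j T i j * (1 + e j) * z j 0 =
    T i i * (1 + e i) * z i 0 + \sum_(j <- l) T i j * (1 + e j) * z j 0.
  rewrite (bigD1 i) //=; congr (_ + _).
  rewrite /l big_filter big_enum_cond /= [LHS]big_mkcond [RHS]big_mkcond /=; apply: eq_bigr => j _.
  case: eqP => [->|ji] /=; first by rewrite (negPf (irr i)).
  case: ifP => // nb; have [->|/Tb] := eqVneq (T i j) 0; first by rewrite !mul0r.
  by rewrite nb orbF => /eqP.
have -> : \sum_(j <- l) T i j * (1 + e j) * z j 0 =
    - (\sum_(j <- l) - (T i j * z j 0 * (1 + d j)) * (1 + th (Some j))) / (1 + th None).
  rewrite -sumrN mulr_suml; apply: eq_big_seq => j.
  rewrite mem_filter => /andP[bj _]; rewrite /e bj.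
  case: eqP => [ji|_]; first by rewrite ji (negPf (irr i)) in bj.
  by field.
rewrite {1}/e eqxx Ez Es; set S := \sum_(_ <- _) _.
by field; rewrite T0 t0 dz0.
Qed.

Lemma solveP_back n (T : 'M[R]_n) c z k :
  solveP u T c z k -> gam n.+1 <= 1 / 2 -> (forall i, T i i != 0) ->
  (forall i j : 'I_n, (j < i)%N -> T i j = 0) ->
  exists2 E : 'M[R]_n, (forall i j, `|E i j| <= 4 * gam n.+1 * `|T i j|)
    & (T + E) *m z = c.
Proof.
move=> h G2 T0 Tu; apply: (substP_back h) => // [i|i j].
  by rewrite ltnn.
case: (ltngtP i j) => [ij|ij|/val_inj ->]; rewrite ?orbT ?eqxx //.
by rewrite (Tu _ _ ij) eqxx.
Qed.

Lemma solvetP_back n (T : 'M[R]_n) c z k :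
  solvetP u T c z k -> gam n.+1 <= 1 / 2 -> (forall i, T i i != 0) ->
  (forall i j : 'I_n, (j < i)%N -> T i j = 0) ->
  exists2 E : 'M[R]_n, (forall i j, `|E i j| <= 4 * gam n.+1 * `|T i j|)
    & (T + E)^T *m z = c.
Proof.
move=> h G2 T0 Tu.
have irr (i : 'I_n) : ~~ (i < i)%N by rewrite ltnn.
have T0' i : T^T i i != 0 by rewrite mxE.
have Tb i j : T^T i j != 0 -> (j == i) || (j < i)%N.
  rewrite mxE; case: (ltngtP i j) => [ij|ij|/val_inj ->]; rewrite ?orbT ?eqxx //.
  by rewrite (Tu _ _ ij) eqxx.
have [E hE Ez] := substP_back h G2 irr T0' Tb.
exists E^T => [i j|]; first by have := hE j i; rewrite !mxE.
by rewrite linearD /= trmxK.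
Qed.

Lemma substP_count n (before : rel 'I_n) (T : 'M[R]_n) c z k :
  substP u before T c z k -> (k <= n * (2 * n + 1))%N.
Proof.
case=> w [hw ->]; apply: (@leq_trans (\sum_(i < n) (2 * n + 1))%N); last first.
  by rewrite sum_nat_const card_ord.
apply: leq_sum => i _; have [ps [k1 [k2 [hps [s [k3 [k4 [hs /fl_count -> ->]]]] ->]]]] := hw i.
have [-> [d _ E]] := mapP_fl hps (enum_uniqS _).
rewrite (sumP_count hs) /= size_map E size_map.
by rewrite addnA leq_add2r mul2n -addnn leq_add ?size_enumS.
Qed.

End Rounding.

(** * Householder reflections *)

Section Reflections.
Context {R : realType}.

(** A Householder reflection for [v != 0], and the identity for [v = 0] because
    then [2 / dot v v = 0]. *)
Definition hmat d (v : 'cV[R]_d) : 'M[R]_d := 1%:M - (2 / dot v v) *: (v *m v^T).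

Lemma outer_mul d (v y : 'cV[R]_d) : v *m v^T *m y = dot v y *: v.
Proof.
rewrite -mulmxA; have -> : v^T *m y = (dot v y)%:M.
  by apply/matrixP => i j; rewrite (ord1 i) (ord1 j) [RHS]mxE eqxx.
by rewrite mul_mx_scalar.
Qed.

Lemma hmatE d (v y : 'cV[R]_d) : hmat v *m y = y - (2 / dot v v * dot v y) *: v.
Proof. by rewrite /hmat mulmxBl mul1mx -scalemxAl outer_mul scalerA. Qed.

Lemma hmat_tr d (v : 'cV[R]_d) : (hmat v)^T = hmat v.
Proof. by rewrite /hmat linearB /= linearZ /= trmx1 trmx_mul trmxK. Qed.

Lemma hmatK d (v : 'cV[R]_d) : hmat v *m hmat v = 1%:M.
Proof.
have H (y : 'cV[R]_d) : hmat v *m (hmat v *m y) = y.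
  rewrite !hmatE dotBr dotZr; have [->|v0] := eqVneq v 0.
    by rewrite !scaler0 !subr0.
  have d0 : dot v v != 0 by rewrite dot_eq0.
  rewrite -addrA -opprD -scalerDl.
  have -> : 2 / dot v v * dot v y + 2 / dot v v * (dot v y - 2 / dot v v * dot v y * dot v v) = 0.
    by field.
  by rewrite scale0r subr0.
apply/matrixP => i j; have := congr1 (fun M : 'cV_d => M i 0) (H (delta_mx j 0)).
by rewrite mulmxA -!colE !mxE andbT.
Qed.

Lemma hmat_id d (v y : 'cV[R]_d) : dot v y = 0 -> hmat v *m y = y.
Proof. by move=> h; rewrite hmatE h mulr0 scale0r subr0. Qed.

Lemma norm2_orth m n (Q : 'M[R]_(m, n)) y : Q^T *m Q = 1%:M -> norm2 (Q *m y) = norm2 y.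
Proof. by move=> QQ; rewrite !norm2E -dot_adjT mulmxA QQ mul1mx. Qed.

Lemma norm2_hmat d (v y : 'cV[R]_d) : norm2 (hmat v *m y) = norm2 y.
Proof. by apply: norm2_orth; rewrite hmat_tr hmatK. Qed.

Definition absv n (x : 'cV[R]_n) : 'cV[R]_n := \col_i `|x i 0|.

Lemma norm2_abs n (x : 'cV[R]_n) : norm2 (absv x) = norm2 x.
Proof.
by rewrite /norm2; congr Num.sqrt; apply: eq_bigr => i _; rewrite mxE real_normK ?num_real.
Qed.

(** Entrywise bounds by a combination of two vectors lose no dimension factor. *)
Lemma norm2_le_comb n (x y z : 'cV[R]_n) a b : 0 <= a -> 0 <= b ->
  (forall i, `|x i 0| <= a * `|y i 0| + b * `|z i 0|) ->
  norm2 x <= a * norm2 y + b * norm2 z.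
Proof.
move=> a0 b0 H; apply: (@le_trans _ _ (norm2 (a *: absv y + b *: absv z))).
  apply: ler_norm2 => i; rewrite !mxE; apply: le_trans (H i) _; exact: ler_norm.
apply: le_trans (norm2D _ _) _.
by rewrite !norm2Z !norm2_abs !ger0_norm.
Qed.

Lemma dot_theta_err n (v y : 'cV[R]_n) (th : 'I_n -> R) G :
  (forall i, `|th i| <= G) ->
  `|\sum_i v i 0 * y i 0 * (1 + th i) - dot v y| <= G * (norm2 v * norm2 y).
Proof.
move=> hth; rewrite dotE -sumrB.
apply: le_trans (ler_norm_sum _ _ _) _.
have [n0|n0] := posnP n.
  rewrite big1 => [|i _]; last by exfalso; move: (ltn_ord i); rewrite {2}n0.
  have -> : v = 0 by apply/matrixP => i; exfalso; move: (ltn_ord i); rewrite {2}n0.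
  by rewrite norm2_0 mul0r mulr0.
have G0 : 0 <= G := le_trans (normr_ge0 _) (hth (Ordinal n0)).
apply: (@le_trans _ _ (G * dot (absv v) (absv y))).
  rewrite dotE mulr_sumr; apply: ler_sum => i _; rewrite !mxE.
  have -> : v i 0 * y i 0 * (1 + th i) - v i 0 * y i 0 = v i 0 * y i 0 * th i by ring.
  by rewrite !normrM mulrC ler_wpM2r ?mulr_ge0.
by rewrite ler_wpM2l // -(norm2_abs v) -(norm2_abs y) dot_le.
Qed.

End Reflections.

Section Householder.
Context {R : realType}.
Variable u : R.
Hypothesis u0 : 0 <= u.

(** [tau] is nearly the exact coefficient for the computed vector [v]; for
    [v = 0] this forces [tau = 0], a trivial reflection. *)
Definition near_refl d (G : R) (h : reflector d) : Prop :=
  let: (k, v, tau) := h in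
  (forall i : 'I_d, (i < k)%N -> v i 0 = 0) /\
  `|tau - 2 / dot v v| <= 3 * G * (2 / dot v v).

Lemma sum_rows_from d k (F : 'I_d -> R) :
  (forall i : 'I_d, (i < k)%N -> F i = 0) ->
  \sum_(i <- rows_from d k) F i = \sum_i F i.
Proof.
move=> F0; rewrite /rows_from big_filter big_enum_cond /= big_mkcond /=.
by apply: eq_bigr => i _; case: leqP => // /F0.
Qed.

Lemma size_rows_from d k : (size (rows_from d k) <= d)%N.
Proof. exact: size_enumS. Qed.

Lemma dotP_rows d k (v y : 'cV[R]_d) t c :
  dotP u (rows_from d k) (v^~ 0) (y^~ 0) t c ->
  (forall i : 'I_d, (i < k)%N -> v i 0 = 0) ->
  `|t - dot v y| <= gam u d * (norm2 v * norm2 y).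
Proof.
move=> h v0; have [_ [th hth ->]] := dotP_theta u0 h (enum_uniqS _).
rewrite sum_rows_from; last by move=> i /v0 ->; rewrite !mul0r.
apply: dot_theta_err => i; apply: le_trans (hth i) _.
exact/gam_le/size_rows_from.
Qed.

(** The errors of [tau], of the scalar product and of the update are each relative
    to [|y|], because [tau |v|^2] is nearly 2. *)
Lemma reflectP_err d (G : R) (y : 'cV[R]_d) k v tau y' c :
  gam u d.+1 <= G -> G <= 1 / 100 ->
  near_refl G (k, v, tau) -> reflectP u y (k, v, tau) y' c ->
  norm2 (y' - hmat v *m y) <= 20 * G * norm2 y.
Proof.
move=> hG G1 [v0 htau] [t [c1 [c2 [ht [s [c3 [c4 [hs [e [he _]] _]]]] _]]]].
have ul : u <= G by apply: le_trans hG; rewrite -[leLHS](gam1 u); apply: gam_le.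
have G0 : 0 <= G := le_trans u0 ul.
have {}ht : ab (t - dot v y) <= G * (norm2 v * norm2 y).
  apply: le_trans (dotP_rows ht v0) _; rewrite ler_wpM2r ?mulr_ge0 ?norm2_ge0 //.
  by apply: le_trans hG; apply: gam_le.
have [ds hds Es] := flP hs; rewrite gam1 -/(ab _) in hds.
have {hds}hds : ab ds <= G := le_trans hds ul.
set a := norm2 v in ht *; set b := norm2 y in ht *.
have a0 : 0 <= a := norm2_ge0 v; have b0 : 0 <= b := norm2_ge0 y.
pose s0 := 2 / dot v v * dot v y.
have hd : ab (dot v y) <= a * b := dot_norm2 v y.
have Ea : dot v v = a ^+ 2 by rewrite -norm2_sqE.
have [hsa hs0] : ab (s - s0) * a <= 14 * G * b /\ ab s0 * a <= 2 * b.
  have [a00|an0] := eqVneq a 0.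
    by rewrite a00 !mulr0 !mulr_ge0.
  have ap : 0 < a by rewrite lt_def an0.
  rewrite /s0 Ea; rewrite Ea in htau.
  set q := 2 / a ^+ 2 in htau *.
  have q0 : 0 <= q by rewrite /q divr_ge0 ?exprn_ge0.
  have qa : q * (a * b) * a = 2 * b by rewrite /q; field.
  set r := t - dot v y in ht; set w := tau - q in htau.
  have {}htau : ab w <= 3 * G * q := htau.
  have -> : s = (q + w) * (dot v y + r) * (1 + ds).
    by rewrite Es /r /w; ring.
  have ab0 : 0 <= a * b by rewrite mulr_ge0.
  split; last by rewrite abM (ab_id q0) -qa ler_wpM2r // ler_wpM2l.
  have -> : (q + w) * (dot v y + r) * (1 + ds) - q * dot v y =
    w * ((dot v y + r) * (1 + ds)) + q * ((dot v y + r) * ds + r) by ring.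
  have X1 : ab (dot v y + r) <= (1 + G) * (a * b).
    have := abD (dot v y) r; lra.
  have X1' : ab (dot v y + r) <= 2 * (a * b).
    by apply: le_trans X1 _; rewrite ler_wpM2r //; lra.
  have X2 : ab ((dot v y + r) * (1 + ds)) <= (1 + G) * ((1 + G) * (a * b)).
    rewrite abM mulrC mul_le ?ab_ge0 //.
    have := abD 1 ds; rewrite ab1; lra.
  have X3 : ab ((dot v y + r) * ds + r) <= 3 * G * (a * b).
    have D := abD ((dot v y + r) * ds) r; rewrite abM in D.
    have Z := mul_le (ab_ge0 _) (ab_ge0 _) X1' hds; lra.
  have -> : 14 * G * b = 7 * G * (q * (a * b)) * a by have := congr1 (fun x => 7 * G * x) qa; lra.
  rewrite ler_wpM2r //; apply: le_trans (abD _ _) _.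
  rewrite abM (abM q) (ab_id q0).
  have Y1 := mul_le (ab_ge0 _) (ab_ge0 _) htau X2.
  have Y2 : q * ab ((dot v y + r) * ds + r) <= q * (3 * G * (a * b)) by rewrite ler_wpM2l.
  apply: le_trans (lerD Y1 Y2) _.
  rewrite -subr_ge0.
  have -> : 7 * G * (q * (a * b)) - (3 * G * q * ((1 + G) * ((1 + G) * (a * b))) + q * (3 * G * (a * b)))
    = (q * (a * b)) * G * (4 - 3 * (1 + G) ^+ 2) by ring.
  by apply: mulr_ge0; [apply: mulr_ge0 => //; apply: mulr_ge0|nra].
have hs1 : ab s * a <= 22 / 10 * b.
  have := ler_wpM2r a0 (abD (s - s0) s0); rewrite subrK mulrDl.
  have : G * b <= 1 / 100 * b by rewrite ler_wpM2r.
  lra.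
rewrite hmatE -/s0.
have S0 : 0 <= ab s * (2 + G) by rewrite mulr_ge0 ?ab_ge0 //; lra.
apply: (@le_trans _ _ ((ab (s - s0) + G * (ab s * (2 + G))) * a + G * b)); last first.
  have : G * (ab s * (2 + G)) * a <= G * (22 / 10 * b * (2 + 1 / 100)).
    rewrite -mulrA ler_wpM2l // mulrAC mul_le ?mulr_ge0 ?ab_ge0 //; lra.
  have := mulr_ge0 G0 b0; lra.
apply: norm2_le_comb => //.
  by rewrite addr_ge0 ?ab_ge0 // mulr_ge0.
move=> i; rewrite !mxE.
have [d1 [d2 [h1 h2 ->]]] : exists d1 d2 : R, [/\ ab d1 <= G, ab d2 <= G &
    y' i 0 = (y i 0 - s * v i 0 * (1 + d1)) * (1 + d2)].
  have := he i 0; case: leqP => hk.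
    case=> p [k1 [k2 [/flP [d1 h1 ->] /flP [d2 h2 ->] _]]].
    exists d1, d2; rewrite gam1 in h1 h2.
    by split => //; apply: le_trans ul.
  case=> -> _; exists 0, 0; rewrite /ab normr0; split => //.
  by rewrite (v0 _ hk); ring.
rewrite -!/(ab _).
set yi := y i 0; set vi := v i 0.
have -> : (yi - s * vi * (1 + d1)) * (1 + d2) - (yi - s0 * vi) =
  - ((s - s0) * vi) - s * vi * d1 + (yi - s * vi * (1 + d1)) * d2 by ring.
apply: le_trans (abD _ _) _.
apply: le_trans (lerD (abB _ _) (lexx _)) _.
rewrite abN !abM.
have z1 : ab (yi - s * vi * (1 + d1)) <= ab yi + ab s * ab vi * (1 + G).
  apply: le_trans (abB _ _) _; rewrite lerD2l !abM ler_wpM2l ?mulr_ge0 ?ab_ge0 //.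
  have := abD 1 d1; rewrite ab1; lra.
have z2 := mul_le (ab_ge0 _) (ab_ge0 _) z1 h2.
have z3 : ab s * ab vi * ab d1 <= ab s * ab vi * G.
  by rewrite ler_wpM2l ?mulr_ge0 ?ab_ge0.
lra.
Qed.

End Householder.

(** * One step of Householder reduction *)

Section HouseholderStep.
Context {R : realType}.

Lemma hmat_self d (v : 'cV[R]_d) : hmat v *m v = - v.
Proof.
rewrite hmatE; have [->|v0] := eqVneq v 0; first by rewrite scaler0 subr0 oppr0.
have d0 : dot v v != 0 by rewrite dot_eq0.
by rewrite mulfVK // scaler_nat mulr2n opprD addrA subrr sub0r.
Qed.

(** The reflection that exchanges [t] and [z] when [|t| = |z|] is the one along
    [t - z]; it nearly does so when [v] is near [t - z] and [|z|] near [|t|]. *)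
Lemma hmat_swap d (t z v : 'cV[R]_d) (G : R) : 0 <= G -> G <= 1 / 100 ->
  norm2 (v - (t - z)) <= 3 * G * norm2 t ->
  ab (norm2 z - norm2 t) <= 3 * G * norm2 t ->
  norm2 t / 2 <= norm2 v ->
  norm2 (hmat v *m t - z) <= 40 * G * norm2 t.
Proof.
move=> G0 G1 hf hz hv; set f := v - (t - z) in hf.
set N := norm2 t in hf hz hv *.
have N0 : 0 <= N := norm2_ge0 t.
have [Nz|Nn0] := eqVneq N 0.
  have tz : t = 0 by apply/eqP; rewrite -norm2_eq0 -/N Nz.
  have zz : z = 0.
    apply/eqP; rewrite -norm2_eq0; apply/eqP/le_anti; rewrite norm2_ge0 andbT.
    by have [] := ab_le hz; rewrite Nz; lra.
  by rewrite tz zz mulmx0 subr0 norm2_0 mulr_ge0 //; lra.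
have Np : 0 < N by rewrite lt_def Nn0.
have E : hmat v *m t - z = (1 / 2) *: ((hmat v *m (t + z) - (t + z)) - (f + hmat v *m f)).
  have -> : hmat v *m (t + z) - (t + z) - (f + hmat v *m f) = 2 *: (hmat v *m t - z).
    rewrite {1 2}/f !mulmxDr !mulmxN hmat_self mulmxDr mulmxN.
    rewrite scaler_nat mulr2n; apply/matrixP => i j; rewrite !mxE; ring.
  by rewrite scalerA (_ : 1 / 2 * 2 = 1) ?scale1r //; field.
rewrite E norm2Z -/(ab _) (ab_id (_ : 0 <= 1 / 2)); last by lra.
have h1 := norm2B (hmat v *m (t + z) - (t + z)) (f + hmat v *m f).
have h2 := norm2D f (hmat v *m f); rewrite norm2_hmat in h2.
have GN0 := mulr_ge0 G0 N0.
suff : norm2 (hmat v *m (t + z) - (t + z)) <= 60 * G * N by lra.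
rewrite hmatE addrC addKr norm2N norm2Z -/(ab _).
have {hz} [hz1 hz2] := ab_le hz.
have z0 := norm2_ge0 z.
have vtz : ab (dot v (t + z)) <= 15 * G * N * N.
  have -> : v = t - z + f by rewrite /f addrC subrK.
  rewrite dotDl; apply: le_trans (abD _ _) _.
  have f1 : ab (dot f (t + z)) <= (3 * G * N) * (203 / 100 * N).
    apply: le_trans (dot_norm2 _ _) _; rewrite mul_le ?norm2_ge0 //.
    apply: le_trans (norm2D _ _) _; rewrite -/N.
    have : G * N <= 1 / 100 * N by rewrite ler_wpM2r.
    lra.
  have f2 : ab (dot (t - z) (t + z)) <= 6 * G * N * N * (203 / 200).
    have -> : dot (t - z) (t + z) = (N - norm2 z) * (N + norm2 z).
      rewrite dotBl !dotDr [dot z t]dotC.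
      have -> : dot t t = N ^+ 2 by rewrite norm2_sqE.
      have -> : dot z z = norm2 z ^+ 2 by rewrite norm2_sqE.
      by ring.
    have -> : 6 * G * N * N * (203 / 200) = (3 * G * N) * (203 / 100 * N) by field.
    rewrite abM mul_le ?ab_ge0 //; first by apply: le_ab; lra.
    rewrite ab_id; last by lra.
    have : G * N <= 1 / 100 * N by rewrite ler_wpM2r.
    lra.
  have : 0 <= G * N * N by rewrite !mulr_ge0.
  lra.
have vp : 0 < norm2 v by lra.
have -> : dot v v = norm2 v ^+ 2 by rewrite norm2_sqE.
rewrite abM (ab_id (_ : 0 <= 2 / norm2 v ^+ 2)); last by rewrite divr_ge0 ?exprn_ge0 ?norm2_ge0.
have -> : 2 / norm2 v ^+ 2 * ab (dot v (t + z)) * norm2 v = 2 * ab (dot v (t + z)) / norm2 v.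
  by field; rewrite gt_eqF.
rewrite ler_pdivrMr //.
apply: (@le_trans _ _ (60 * G * N * (N / 2))); first lra.
by rewrite ler_wpM2l // !mulr_ge0.
Qed.

(** Here [X] is a computed value of [N^2]; the relative error of its square root is
    found from [X - N^2 = (sqrt X - N) (sqrt X + N)]. *)
Lemma sqrt_err (X N G : R) : 0 <= N -> 0 <= G -> G <= 1 -> ab (X - N ^+ 2) <= G * N ^+ 2 ->
  ab (Num.sqrt X - N) <= G * N.
Proof.
move=> N0 G0 G1 /ab_le [h1 h2].
have N20 : 0 <= N ^+ 2 by rewrite exprn_ge0.
have X0 : 0 <= X.
  have : G * N ^+ 2 <= 1 * N ^+ 2 by rewrite ler_wpM2r.
  lra.
have a0 : 0 <= Num.sqrt X := sqrtr_ge0 X.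
have Ea : Num.sqrt X ^+ 2 = X by rewrite sqr_sqrtr.
set a : R := Num.sqrt X in a0 Ea *.
have [Nz|Nn0] := eqVneq N 0.
  have : a = 0 by apply/eqP; rewrite -sqrf_eq0 Ea; apply/eqP; rewrite Nz in h1 h2; lra.
  by rewrite Nz => ->; rewrite mulr0 subr0 /ab normr0.
have Np : 0 < N by rewrite lt_def Nn0.
rewrite -(ler_pM2r Np); apply: (@le_trans _ _ (ab (a - N) * (a + N))).
  by rewrite ler_wpM2l ?ab_ge0 // lerDr.
have aN : 0 <= a + N by lra.
rewrite -(ab_id aN) -abM.
have -> : (a - N) * (a + N) = X - N ^+ 2 by rewrite -Ea; ring.
by rewrite -mulrA -expr2; apply: le_ab.
Qed.

Definition reduced_upto d n (k : nat) (W : 'M[R]_(d, n)) :=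
  forall (i : 'I_d) (j : 'I_n), (j < k)%N -> (j < i)%N -> W i j = 0.

Variable u : R.
Hypothesis u0 : 0 <= u.

Lemma tau_near d (G : R) (v : 'cV[R]_d) vv tau c : u <= G -> G <= 1 / 100 ->
  ab (vv - dot v v) <= G * dot v v -> fl u (2 / vv) tau c ->
  ab (tau - 2 / dot v v) <= 3 * G * (2 / dot v v).
Proof.
move=> uG G1 hv /flP [dl hdl ->]; rewrite gam1 -/(ab _) in hdl.
have G0 : 0 <= G := le_trans u0 uG.
have a0 := dot_ge0 v; set a := dot v v in hv a0 *.
have [az|an0] := eqVneq a 0.
  have -> : vv = 0.
    by have [g1 g2] := ab_le hv; rewrite az in g1 g2; lra.
  by rewrite az invr0 !mulr0 mul0r subr0 /ab normr0.
have ap : 0 < a by rewrite lt_def an0.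
pose w := (vv - a) / a.
have hw : ab w <= G.
  by rewrite /w abM (@ab_id _ a^-1) ?invr_ge0 // ler_pdivrMr.
have Ev : vv = a * (1 + w) by rewrite /w; field.
have [w1 w2] := ab_le hw.
have w3 : 1 + w != 0 by apply/eqP; lra.
have -> : 2 / vv * (1 + dl) - 2 / a = 2 / a * ((dl - w) / (1 + w)).
  by rewrite Ev; field; apply/andP; split.
have q0 : 0 <= 2 / a by rewrite divr_ge0.
rewrite abM (ab_id q0) mulrC ler_wpM2r // abM (@ab_id _ (1 + w)^-1); last first.
  by rewrite invr_ge0; lra.
rewrite ler_pdivrMr; last lra.
have B1 := abB dl w; have B2 := le_trans hdl uG.
have B3 : G * (- G) <= G * w by rewrite ler_wpM2l.
have B4 : G * G <= G * (1 / 100) by rewrite ler_wpM2l.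
lra.
Qed.

(** The choice of the sign in [v] avoids cancellation, so that [|v|] is at least
    half the norm of the part being reduced and [hmat_swap] applies to it. The
    entries that are overwritten by exact zeros cost no more than this error. *)
Lemma hqr_stepP_err d n (G : R) (W : 'M[R]_(d, n)) hs (k : 'I_n) W' hs' c :
  gam u d.+1 <= G -> G <= 1 / 100 -> (n <= d)%N -> reduced_upto k W ->
  hqr_stepP u (W, hs) k (W', hs') c ->
  exists h : reflector d, [/\ hs' = rcons hs h, near_refl G h, reduced_upto k.+1 W' &
    forall j, norm2 (col j W' - hmat h.1.2 *m col j W) <= 40 * G * norm2 (col j W)].
Proof.
move=> hG G1 nd up [xx [c1 [c2 [hxx [sg [c3 [c4 [hsg
  [v [c5 [c6 [hv [vv [c7 [c8 [hvv [tau [c9 [c10 [htau [W2 [c11 [c12 [hW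
  [[-> ->] _] _]]]] _]]]] _]]]] _]]]] _]]]] _]]]].
have ul : u <= G by apply: le_trans hG; rewrite -[leLHS](gam1 u); apply: gam_le.
have Gd : gam u d <= G by apply: le_trans hG; apply: gam_le.
have G0 : 0 <= G := le_trans u0 ul.
pose kd : 'I_d := widen_ord nd k.
have kdE (i : 'I_d) : (i == k :> nat) = (i == kd) by [].
case: hv => cv [hv _].
have v0 (i : 'I_d) : (i < k)%N -> v i 0 = 0.
  by move=> ik; have := hv i 0; rewrite ik => -[].
have vgt (i : 'I_d) : (k < i)%N -> v i 0 = W i k.
  move=> ki; have := hv i 0; rewrite ltnNge (ltnW ki) /= (gtn_eqF ki).
  by case.
have [d2 hd2 Evk] : exists2 d2 : R, ab d2 <= G &
    v kd 0 = (W kd k + sign1 (W kd k) * sg) * (1 + d2).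
  have := hv kd 0; rewrite /= ltnn eqxx => /flP [d2 hd2 E].
  by exists d2 => //; rewrite gam1 in hd2; exact: le_trans ul.
have {}hvv : ab (vv - dot v v) <= G * dot v v.
  apply: le_trans (dotP_rows u0 hvv v0) _.
  by rewrite -expr2 norm2_sqE ler_wpM2r // dot_ge0.
pose t : 'cV[R]_d := \col_i (if (k <= i)%N then W i k else 0).
pose h : 'cV[R]_d := \col_i (if (k <= i)%N then 0 else W i k).
have Eth : col k W = t + h.
  by apply/matrixP => i j; rewrite !mxE; case: ifP; rewrite ?addr0 ?add0r.
set N := norm2 t.
have N0 : 0 <= N := norm2_ge0 t.
have hxN : ab (xx - N ^+ 2) <= G * N ^+ 2.
  have [_ [th hth ->]] := dotP_theta u0 hxx (enum_uniqS _).
  have -> : \sum_(i <- rows_from d k) W i k * W i k * (1 + th i) =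
     \sum_i t i 0 * t i 0 * (1 + th i).
    rewrite -(@sum_rows_from _ d k).
      by apply: eq_big_seq => i; rewrite mem_filter => /andP[ki _]; rewrite !mxE ki.
    by move=> i ik; rewrite mxE leqNgt ik /= !mul0r.
  have hthG i : `|th i| <= G.
    apply: le_trans (hth i) _; apply: le_trans Gd; exact/gam_le/size_rows_from.
  by have := dot_theta_err t t hthG; rewrite -norm2_sqE -/N -expr2.
have hsq : ab (Num.sqrt xx - N) <= G * N by apply: sqrt_err => //; lra.
have [d1 hd1 Esg] := flP hsg; rewrite gam1 -/(ab _) in hd1.
have {}hd1 := le_trans hd1 ul.
have sq0 : 0 <= Num.sqrt xx := sqrtr_ge0 xx.
have GN : 0 <= G * N by rewrite mulr_ge0.
have GN1 : G * N <= 1 / 100 * N by rewrite ler_wpM2r.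
have [hs1 hs2] := ab_le hsq.
set sq : R := Num.sqrt xx in hsq Esg sq0 hs1 hs2.
have sq2 : sq <= 2 * N by lra.
have sqd : ab (sq * d1) <= 2 * N * G by rewrite abM ab_id // mul_le ?ab_ge0.
have hsN : ab (sg - N) <= 3 * G * N.
  have D := abD (sq - N) (sq * d1).
  have E : sq - N + sq * d1 = sg - N by rewrite Esg; ring.
  rewrite E in D; lra.
have [hsN1 hsN2] := ab_le hsN.
set x := W kd k in Evk.
have sg0 : 0 <= sg by lra.
pose s := sign1 x.
have hxs : ab (x + s * sg) = ab x + sg.
  rewrite /s /sign1; case: (leP 0 x) => hx.
    by rewrite mul1r (ab_id hx) ab_id //; lra.
  by rewrite mulN1r -abN (ab_id (_ : 0 <= - (x - sg))) ?opprB /ab ?ltr0_norm //; lra.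
have hxN2 : ab x <= N.
  have := norm2_ge_entry t kd; by rewrite mxE /= leqnn.
pose z : 'cV[R]_d := (- s * sg) *: delta_mx kd 0.
have nz : norm2 z = sg.
  rewrite norm2Z norm2_delta mulr1 -/(ab _) mulNr abN abM (ab_id sg0).
  by rewrite /s /sign1; case: ifP; rewrite ?abN ab1 mul1r.
have Ev : v - (t - z) = ((x + s * sg) * d2) *: delta_mx kd 0.
  apply/matrixP => i j; rewrite (ord1 j) !mxE.
  case: (ltngtP i k) => ik /=.
  - have -> : (i == kd) = false by rewrite -kdE ltn_eqF.
    by rewrite v0 //= !mulr0; ring.
  - have -> : (i == kd) = false by rewrite -kdE gtn_eqF.
    by rewrite vgt //= !mulr0; ring.
  - have -> : i = kd by apply: val_inj.
    by rewrite Evk eqxx /= -/x -/s; ring.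
have near : near_refl G (k : nat, v, tau).
  by split => //; exact: tau_near htau.
have vN : N / 2 <= norm2 v.
  have : ab (v kd 0) <= norm2 v := norm2_ge_entry v kd.
  rewrite Evk abM hxs; apply: le_trans.
  have [e1 e2] := ab_le hd2; rewrite (ab_id (_ : 0 <= 1 + d2)); last lra.
  apply: (@le_trans _ _ ((96 / 100 * N) * (96 / 100))); first lra.
  rewrite mul_le //; [lra| |lra]; have := ab_ge0 x; lra.
exists (k : nat, v, tau); split => //.
- move=> i j jk ji.
  case: hW => cW [hW _]; have := hW j.
  have Wij : col j W2 i 0 = W2 i j by rewrite mxE.
  move: jk; rewrite ltnS leq_eqVlt => /orP[/eqP/val_inj jk|jk].
    have jkf : (j < k)%N = false by rewrite jk ltnn.
    have jke : j == k by rewrite jk.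
    rewrite jkf jke => -[E _]; rewrite -Wij E mxE; rewrite jk in ji.
    by rewrite ltnNge (ltnW ji) /= (gtn_eqF ji).
  by rewrite jk => -[E _]; rewrite -Wij E mxE; apply: up.
move=> j /=; case: hW => cW [hW _]; have := hW j.
case: (ltngtP j k) => jk.
- case=> -> _; rewrite hmat_id; first by rewrite subrr norm2_0 !mulr_ge0 ?norm2_ge0.
  rewrite dotE big1 // => i _; rewrite mxE.
  have [ik|ki] := ltnP i k; first by rewrite v0 // mul0r.
  by rewrite up ?mulr0 // (leq_trans jk).
- have -> : (j == k) = false by rewrite -val_eqE gtn_eqF.
  move=> /(reflectP_err u0 hG G1 near) /le_trans; apply.
  by rewrite ler_wpM2r ?norm2_ge0 //; lra.
rewrite (val_inj jk) eqxx => -[-> _].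
have -> : \col_i (if (i < k)%N then W i k else if i == k :> nat then - sign1 (W i k) * sg else 0) = h + z.
  apply/matrixP => i l; rewrite (ord1 l) !mxE kdE.
  case: (ltnP i k) => ik.
    have -> : (i == kd) = false by rewrite -kdE ltn_eqF.
    by rewrite mulr0 addr0.
  by rewrite add0r; case: eqP => [->|_]; rewrite ?mulr1 ?mulr0.
rewrite Eth mulmxDr (@hmat_id _ _ _ h); last first.
  rewrite dotE big1 // => i _; rewrite mxE; case: leqP => ik; rewrite ?mulr0 //.
  by rewrite v0 // mul0r.
have -> : h + z - (hmat v *m t + h) = - (hmat v *m t - z).
  by rewrite [h + z]addrC [_ *m t + h]addrC addrKA opprB.
rewrite norm2N; apply: (@le_trans _ _ (40 * G * N)).
  apply: hmat_swap => //; last by rewrite nz.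
  rewrite Ev norm2Z norm2_delta mulr1 -/(ab _) abM hxs mulrC.
  apply: (@le_trans _ _ (G * (3 * N))); last by rewrite -/N; lra.
  by rewrite mul_le ?ab_ge0 // ?addr_ge0 ?ab_ge0 //; lra.
rewrite ler_wpM2l //; first lra.
rewrite -Eth; apply: ler_norm2 => i; rewrite !mxE; case: ifP => _ //.
by rewrite normr0.
Qed.

End HouseholderStep.

(** * Backward stability of Householder QR *)

Section HouseholderQR.
Context {R : realType}.

Lemma col_mul m n p (A : 'M[R]_(m, n)) (B : 'M[R]_(n, p)) j :
  col j (A *m B) = A *m col j B.
Proof. by rewrite !colE mulmxA. Qed.

Lemma foldP_enum n (T : Type) (f : T -> 'I_n -> prog T) (Inv : nat -> T -> Prop) st st' c :
  (forall (k : 'I_n) s s' a, Inv k s -> f s k s' a -> Inv k.+1 s') ->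
  Inv 0%N st -> foldP f st (enum 'I_n) st' c -> Inv n st'.
Proof.
move=> step I0.
suff H p s : (p <= n)%N -> Inv p s -> foldP f s (drop p (enum 'I_n)) st' c -> Inv n st'.
  by rewrite -[enum 'I_n]drop0; apply: H.
elim: {p}(n - p)%N {-2}p (leqnn (n - p)) s c {st I0} => [|m IH] p hp s c pn Is.
  have -> : p = n by apply/eqP; rewrite eqn_leq pn -subn_eq0 -leqn0.
  by rewrite drop_oversize ?size_enum_ord // => -[-> _]; rewrite (_ : n = p) //; apply/eqP; rewrite eqn_leq pn -subn_eq0 -leqn0 hp.
have [np|pn'] := leqP n p.
  have np' : n = p by apply/eqP; rewrite eqn_leq pn np.
  by rewrite drop_oversize ?size_enum_ord // => -[-> _]; rewrite {1}np'.
rewrite (drop_nth (Ordinal pn')) ?size_enum_ord // => -[s1 [c1 [c2 [h1 h2 _]]]].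
have E : nth (Ordinal pn') (enum 'I_n) p = p :> nat by rewrite nth_enum_ord.
apply: IH h2 => //; first by rewrite subnS -ltnS (leq_trans _ hp) // prednK // subn_gt0.
by rewrite -E; apply: step h1; rewrite E.
Qed.

Variable u : R.
Hypothesis u0 : 0 <= u.

(** State of the reduction of [B] after [k] columns: [W] is nearly [Q^T B], and
    applying the stored reflectors in reverse order nearly multiplies by [Q]. *)
Definition qr_inv d n (B : 'M[R]_(d, n)) (e : R) (k : nat)
    (st : 'M[R]_(d, n) * seq (reflector d)) :=
  reduced_upto k st.1 /\ exists Q : 'M[R]_d, [/\ Q^T *m Q = 1%:M, Q *m Q^T = 1%:M,
    forall j, norm2 (col j st.1 - Q^T *m col j B) <= gam e k * norm2 (col j B) &
    forall y y' c, foldP (@reflectP R u d) y (rev st.2) y' c ->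
      norm2 (y' - Q *m y) <= gam e k * norm2 y].

Lemma gamS (e : R) k : gam e k.+1 = gam e k * (1 + e) + e.
Proof. by rewrite /gam exprS; ring. Qed.

Lemma qr_invP d n (B : 'M[R]_(d, n)) (G : R) st c :
  gam u d.+1 <= G -> G <= 1 / 100 -> (n <= d)%N ->
  foldP (@hqr_stepP R u d n) (B, [::]) (enum 'I_n) st c ->
  qr_inv B (40 * G) n st.
Proof.
move=> hG G1 nd.
have ul : u <= G by apply: le_trans hG; rewrite -[leLHS](gam1 u); apply: gam_le.
have G0 : 0 <= G := le_trans u0 ul.
have e0 : 0 <= 40 * G by lra.
set e : R := 40 * G in e0 *.
apply: foldP_enum => [k [W hs] [W' hs'] a|]; last first.
  split => //; exists 1%:M; rewrite trmx1 mulmx1; split => //= [j|y y' c' [-> _]].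
    by rewrite mul1mx subrr norm2_0 /gam expr0 subrr mul0r.
  by rewrite mul1mx subrr norm2_0 /gam expr0 subrr mul0r.
case=> up [Q [QQ QQ' hW hF]] /(hqr_stepP_err u0 hG G1 nd up) [[[k' v] tau] [Ehs near up' hW']].
have Gk : 0 <= gam e k by apply: gam_ge0.
split => //; exists (Q *m hmat v); split => /=.
- by rewrite trmx_mul hmat_tr -mulmxA (mulmxA Q^T) QQ mul1mx hmatK.
- by rewrite trmx_mul hmat_tr -mulmxA (mulmxA (hmat v)) hmatK mul1mx.
- move=> j; have := hW' j => /=; rewrite -/e => h1.
  have h2 := hW j; rewrite /= in h2.
  set b := norm2 (col j B) in h2 *; have b0 : 0 <= b := norm2_ge0 _.
  have h3 : norm2 (col j W) <= (1 + gam e k) * b.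
    apply: le_trans (norm2_near _ (Q^T *m col j B)) _.
    rewrite (@norm2_orth _ _ _ Q^T) ?trmxK // -/b; lra.
  rewrite trmx_mul hmat_tr gamS.
  have -> : col j W' - hmat v *m Q^T *m col j B =
    (col j W' - hmat v *m col j W) + hmat v *m (col j W - Q^T *m col j B).
    by rewrite mulmxBr !mulmxA addrA subrK.
  apply: le_trans (norm2D _ _) _; rewrite norm2_hmat.
  have := ler_wpM2l e0 h3; lra.
- move=> y y' c'; rewrite Ehs rev_rcons => -[y1 [c1 [c2 [h1 h2 _]]]].
  have {}h1 := reflectP_err u0 hG G1 near h1.
  have {}h2 := hF _ _ _ h2.
  have y0 := norm2_ge0 y.
  have h3 : norm2 (y1 - hmat v *m y) <= e * norm2 y.
    by apply: le_trans h1 _; rewrite ler_wpM2r // /e; lra.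
  have h4 : norm2 y1 <= (1 + e) * norm2 y.
    apply: le_trans (norm2_near _ (hmat v *m y)) _; rewrite norm2_hmat; lra.
  have -> : y' - Q *m hmat v *m y = (y' - Q *m y1) + Q *m (y1 - hmat v *m y).
    by rewrite (mulmxBr Q y1)  (mulmxA Q (hmat v) y) addrA subrK.
  apply: le_trans (norm2D _ _) _; rewrite (norm2_orth _ QQ) gamS.
  have := ler_wpM2l Gk h4; lra.
Qed.

Lemma normF_col_bound m n (A : 'M[R]_(m, n)) (x : 'I_n -> R) :
  (forall j, norm2 (col j A) <= x j) -> (forall j, 0 <= x j) ->
  normF A ^+ 2 <= \sum_j x j ^+ 2.
Proof.
move=> h h0; rewrite normF_cols; apply: ler_sum => j _.
by rewrite ler_sqr ?nnegrE ?norm2_ge0.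
Qed.

(** [Qt] is the exactly orthonormal matrix formed by the first columns of the
    product of the exact reflections along the computed vectors; both the reduced
    matrix and the computed [Q] are compared with that product. *)
Lemma qrP_back d n (B : 'M[R]_(d, n)) (G : R) Q T c :
  gam u d.+1 <= G -> G <= 1 / 100 -> (n <= d)%N ->
  qrP u B (Q, T) c ->
  (forall i j : 'I_n, (j < i)%N -> T i j = 0) /\
  exists Qt : 'M[R]_(d, n), [/\ Qt^T *m Qt = 1%:M,
    normF (Qt *m T - B) <= gam (40 * G) n * normF B &
    normF (Q - Qt) <= gam (40 * G) n * n%:R].
Proof.
move=> hG G1 nd [[W hs] [c1 [c2 [hfold [Q' [c3 [c4 [hQ [[-> ->] _] _]]]] _]]]].
have ul : u <= G by apply: le_trans hG; rewrite -[leLHS](gam1 u); apply: gam_le.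
have G0 : 0 <= G := le_trans u0 ul.
have [up [Q0 [QQ QQ' hW hF]]] := qr_invP hG G1 nd hfold.
have e0 : 0 <= 40 * G by lra.
set e : R := 40 * G in e0 hW hF *.
have Gn : 0 <= gam e n by apply: gam_ge0.
rewrite /= in up hW hF hQ *.
pose J : 'M[R]_(d, n) := \matrix_(i, j) (i == j :> nat)%:R.
set T' := (X in _ /\ exists Qt, [/\ _, normF (Qt *m X - B) <= _ & _]).
have TE (i : 'I_n) (hi : (i < d)%N) j : T' i j = W (Ordinal hi) j.
  by rewrite mxE /= insubT.
have WJ : W = J *m T'.
  apply/matrixP => i j; rewrite mxE.
  have [ni|iN] := leqP n i.
    rewrite up // ?(leq_trans (ltn_ord j)) // big1 // => l _.
    by rewrite mxE gtn_eqF ?mul0r // (leq_trans (ltn_ord l)).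
  rewrite (bigD1 (Ordinal iN)) //= big1 => [|l hl]; last first.
    rewrite mxE (_ : (i == l :> nat) = false) ?mul0r //.
    by apply: contraNF hl => /eqP h; apply/eqP/val_inj.
  rewrite mxE eqxx mul1r addr0 (TE (Ordinal iN) (ltn_ord i)).
  by have -> : Ordinal (ltn_ord i) = i by apply: val_inj.
split.
  move=> i j ji; rewrite (TE i (leq_trans (ltn_ord i) nd)).
  by apply: up.
have JJ : J^T *m J = 1%:M.
  apply/matrixP => i j; rewrite !mxE.
  rewrite (bigD1 (widen_ord nd i)) //= big1 => [|l hl]; last first.
    rewrite !mxE (_ : (l == i :> nat) = false) ?mul0r //.
    by apply: contraNF hl => /eqP h; apply/eqP/val_inj.
  by rewrite !mxE eqxx mul1r addr0 -val_eqE.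
exists (Q0 *m J); split.
- by rewrite trmx_mul -mulmxA (mulmxA Q0^T) QQ mul1mx.
- rewrite -ler_sqr ?nnegrE ?mulr_ge0 ?normF_ge0 // exprMn normF_cols (normF_cols B) mulr_sumr.
  apply: ler_sum => j _; rewrite -exprMn ler_sqr ?nnegrE ?mulr_ge0 ?norm2_ge0 //.
  apply: le_trans (hW j); rewrite -mulmxA -WJ linearB /= -(norm2_orth (col j W - Q0^T *m col j B) QQ).
  by rewrite mulmxBr mulmxA QQ' mul1mx -col_mul.
- have hcol j : norm2 (col j (Q' - Q0 *m J)) <= gam e n.
    case: hQ => cQ [hQ _]; have := hF _ _ _ (hQ j).
    have -> : \col_i (i == j :> nat)%:R = col j J by apply/matrixP => a b; rewrite !mxE.
    rewrite linearB /= col_mul; set jJ := col j J.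
    have -> : norm2 jJ = 1; last by rewrite mulr1.
    by rewrite /jJ colE norm2_orth // norm2_delta.
  rewrite -ler_sqr ?nnegrE ?mulr_ge0 ?normF_ge0 //.
  apply: le_trans (normF_col_bound hcol _) _ => //.
  rewrite sumr_const card_ord -[leLHS]mulr_natr exprMn ler_wpM2l ?sqr_ge0 //.
  by rewrite -natrX ler_nat; case: (n) => // k; rewrite expnS expn1 leq_pmull.
Qed.

End HouseholderQR.

(** * Perturbed heavy-ball recurrences *)

Section HeavyBall.
Context {R : realType}.

(** Polarization bounds a symmetric form by its quadratic form. *)
Lemma sym_form_bound n (B : 'M[R]_n) (K : R) : B^T = B ->
  (forall x, ab (dot x (B *m x)) <= K * dot x x) ->
  forall x y, ab (dot x (B *m y)) <= K * norm2 x * norm2 y.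
Proof.
move=> sB hB.
have H x y : norm2 x = 1 -> norm2 y = 1 -> dot x (B *m y) <= K.
  move=> x1 y1.
  have sxy : dot y (B *m x) = dot x (B *m y) by rewrite dot_adj sB dotC.
  have [_ h1] := ab_le (hB (x + y)); have [h2 _] := ab_le (hB (x - y)).
  move: h1 h2; rewrite !(mulmxDr, mulmxN, mulmxBr) !(dotDl, dotDr, dotNl, dotNr) sxy.
  by rewrite -!norm2_sqE x1 y1 [dot y x]dotC; lra.
have H' x y : dot x (B *m y) <= K * norm2 x * norm2 y.
  have [->|x0] := eqVneq x 0; first by rewrite dot0l norm2_0 mulr0 mul0r.
  have [->|y0] := eqVneq y 0; first by rewrite mulmx0 dot0r norm2_0 mulr0.
  rewrite -norm2_gt0 in x0; rewrite -norm2_gt0 in y0.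
  have n1 z : 0 < norm2 z -> norm2 ((norm2 z)^-1 *: z) = 1 :> R.
    by move=> z0; rewrite norm2Z gtr0_norm ?invr_gt0 // mulVf ?gt_eqF.
  have := H _ _ (n1 _ _ x0) (n1 _ _ y0).
  rewrite dotZl -scalemxAr dotZr mulrA -invfM mulrC ler_pdivrMr ?mulr_gt0 //.
  by rewrite mulrA.
move=> x y; apply: le_ab => //; rewrite lerNl -dotNl -(norm2N x); exact: H'.
Qed.

Variables (n : nat) (M : 'M[R]_n) (s e eps : R).
Hypothesis sM : M^T = M.
Hypotheses (s0 : 0 <= s) (s1 : s < 1).
Hypothesis Mlo : forall x, dot x x <= (1 + s) ^+ 2 * dot x (M *m x).
Hypothesis Mhi : forall x, (1 - s) ^+ 2 * dot x (M *m x) <= dot x x.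

(** Matrix of the heavy-ball recurrence [z'' = B z' - e^2 z] with the
    parameters tuned to the distortion [e]. *)
Definition hbmx : 'M[R]_n := (1 + e ^+ 2)%:M - (1 - e ^+ 2) ^+ 2 *: M.

Lemma hbmx_sym : hbmx^T = hbmx.
Proof. by rewrite /hbmx linearB /= linearZ /= tr_scalar_mx sM. Qed.

Lemma hbmx_form x : dot x (hbmx *m x) =
  (1 + e ^+ 2) * dot x x - (1 - e ^+ 2) ^+ 2 * dot x (M *m x).
Proof. by rewrite /hbmx mulmxBl mul_scalar_mx -scalemxAl dotBr !dotZr. Qed.

Lemma hbmx_bound (K : R) : 0 <= K ->
  (1 - e ^+ 2) ^+ 2 <= (1 - s) ^+ 2 * (1 + e ^+ 2 + K) ->
  (1 + s) ^+ 2 * (1 + e ^+ 2 - K) <= (1 - e ^+ 2) ^+ 2 ->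
  forall x y, ab (dot x (hbmx *m y)) <= K * norm2 x * norm2 y.
Proof.
move=> K0 h1 h2; apply: sym_form_bound; first exact: hbmx_sym.
move=> x; rewrite hbmx_form; have lo := Mlo x; have hi := Mhi x.
set a := dot x x in lo hi *; set b := dot x (M *m x) in lo hi *.
set w := (1 - e ^+ 2) ^+ 2 in h1 h2 *.
have a0 : 0 <= a := dot_ge0 x.
have ss0 := s0; have ss1 := s1.
have p1 : 0 < (1 - s) ^+ 2 by rewrite exprn_gt0 //; lra.
have p2 : 0 < (1 + s) ^+ 2 by rewrite exprn_gt0 //; lra.
have w0 : 0 <= w by rewrite /w sqr_ge0.
apply: le_ab.
  have : w * b <= (1 + e ^+ 2 + K) * a; last by lra.
  rewrite -(ler_pM2l p1); apply: (@le_trans _ _ (w * a)).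
    by have := mul_lel w0 hi; lra.
  by have := mul_ler a0 h1; lra.
have : (1 + e ^+ 2 - K) * a <= w * b; last by lra.
rewrite -(ler_pM2l p2); apply: (@le_trans _ _ (w * a)).
  by have := mul_ler a0 h2; lra.
by have := mul_lel w0 lo; lra.
Qed.

Lemma hbmx_norm (K : R) : 0 <= K ->
  (forall x y, ab (dot x (hbmx *m y)) <= K * norm2 x * norm2 y) ->
  forall x, norm2 (hbmx *m x) <= K * norm2 x.
Proof.
move=> K0 H x; have := H (hbmx *m x) x; rewrite (ab_id (dot_ge0 _)) -norm2_sqE.
have [->|h0] := eqVneq (norm2 (hbmx *m x)) 0.
  by rewrite mulr_ge0 ?norm2_ge0.
have hp : 0 < norm2 (hbmx *m x) by rewrite lt_def h0 norm2_ge0.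
by move=> h; apply: (le_mul2l hp); lra.
Qed.

(** The states are errors of the iterates, but rounding errors are relative to the
    iterates themselves; [C], of the size of the limit, makes up for the
    difference. *)
Definition hb_run (C : R) (p : nat) (w : nat -> 'cV[R]_n * 'cV[R]_n) :=
  forall i, (i < p)%N -> (w i.+1).2 = (w i).1 /\
    norm2 ((w i.+1).1 - (hbmx *m (w i).1 - e ^+ 2 *: (w i).2))
      <= eps * (norm2 (w i).1 + norm2 (w i).2 + C).

Hypotheses (e0 : 0 <= e) (eps0 : 0 <= eps).

(** The weighted maximum norm of [|a|] and [rho |b|] contracts by [rho]: the norm
    of the matrix is of the order of [rho^2], and the momentum term is of the order
    of [rho^3] in the weighted norm. *)
Lemma hb_small (C rho K : R) (p : nat) w : 0 <= C -> hb_run C p w ->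
  0 < rho -> rho <= 1 / 5 -> e <= rho ^+ 2 -> 10 * eps <= rho ^+ 2 ->
  K <= 3 * rho ^+ 2 + 4 * eps ->
  (forall x, norm2 (hbmx *m x) <= K * norm2 x) ->
  norm2 (w 0%N).1 <= 5 * C -> norm2 (w 0%N).2 <= 5 * C ->
  norm2 (w p).1 <= rho ^+ p * (5 * C) + 3 * eps * C.
Proof.
move=> C0 hw r0 r1 er epr hK hB w1 w2.
have ee0 := e0; have eeps0 := eps0.
suff H i : (i <= p)%N -> norm2 (w i).1 <= rho ^+ i * (5 * C) + 3 * eps * C /\
    rho * norm2 (w i).2 <= rho ^+ i * (5 * C) + 3 * eps * C by case: (H p).
have epsC : 0 <= eps * C by rewrite mulr_ge0.
elim: i => [|i IH] ip.
  rewrite expr0 mul1r; split; first lra.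
  have := norm2_ge0 (w 0%N).2; nra.
have [IH1 IH2] := IH (ltnW ip); have [Ep hz] := hw i ip.
set N := rho ^+ i * (5 * C) + 3 * eps * C in IH1 IH2.
have EN : rho ^+ i.+1 * (5 * C) = rho * N - rho * (3 * eps * C).
  by rewrite /N exprS; ring.
have N0 : 0 <= N := le_trans (norm2_ge0 _) IH1.
set a := norm2 (w i).1 in IH1 hz; set b := norm2 (w i).2 in IH2 hz.
have a0 : 0 <= a := norm2_ge0 _.
have b0 : 0 <= b := norm2_ge0 _.
have re : rho * (eps * C) <= 1 / 5 * (eps * C) by rewrite ler_wpM2r.
split; last first.
  by rewrite Ep -/a EN; have := mul_lel (ltW r0) IH1; lra.
apply: le_trans (norm2_near _ (hbmx *m (w i).1 - e ^+ 2 *: (w i).2)) _.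
have t1 := norm2B (hbmx *m (w i).1) (e ^+ 2 *: (w i).2).
rewrite norm2Z -/(ab _) (ab_id (sqr_ge0 e)) -/b in t1.
have t2 := hB (w i).1; rewrite -/a in t2.
have t3 : K * a <= (3 * rho ^+ 2 + 4 * (rho ^+ 2 / 10)) * N.
  apply: (@le_trans _ _ ((3 * rho ^+ 2 + 4 * (rho ^+ 2 / 10)) * a)).
    by rewrite ler_wpM2r //; lra.
  by rewrite ler_wpM2l //; nra.
have t4 : e ^+ 2 * b <= rho ^+ 3 * N.
  apply: (@le_trans _ _ ((rho ^+ 2) ^+ 2 * b)).
    by rewrite ler_wpM2r // ler_sqr ?nnegrE ?sqr_ge0.
  have -> : (rho ^+ 2) ^+ 2 * b = rho ^+ 3 * (rho * b) by ring.
  by rewrite ler_wpM2l // exprn_ge0 // ltW.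
have t5 : eps * a <= rho ^+ 2 / 10 * N by apply: mul_le => //; lra.
have t6 : eps * b <= rho / 10 * N.
  apply: (@le_trans _ _ (rho ^+ 2 / 10 * b)); first by rewrite ler_wpM2r //; lra.
  have -> : rho ^+ 2 / 10 * b = rho / 10 * (rho * b) by ring.
  by rewrite ler_wpM2l //; lra.
have t7 : (3 * rho ^+ 2 + 4 * (rho ^+ 2 / 10)) * N + rho ^+ 3 * N + rho ^+ 2 / 10 * N + rho / 10 * N <= rho * N.
  rewrite -!mulrDl ler_wpM2r //.
  have -> : rho ^+ 3 = rho * rho ^+ 2 by ring.
  have : rho ^+ 2 <= 1 / 5 * rho by rewrite expr2 ler_wpM2r // ltW.
  have : rho * rho ^+ 2 <= 1 / 5 * rho ^+ 2 by rewrite ler_wpM2r // sqr_ge0.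
  lra.
rewrite EN; lra.
Qed.

(** The quadratic form that each exact step of the recurrence multiplies by [e^2].
    It sees all eigenvectors of [M] at once, without diagonalization. *)
Definition energy (a b : 'cV[R]_n) : R :=
  dot a a - dot (hbmx *m a) b + e ^+ 2 * dot b b.

Lemma hbmx_dot a b : dot (hbmx *m a) b = dot a (hbmx *m b).
Proof. by rewrite dot_adj hbmx_sym. Qed.

Lemma energy_step a b :
  energy (hbmx *m a - e ^+ 2 *: b) a = e ^+ 2 * energy a b.
Proof.
rewrite /energy hbmx_dot; set c := hbmx *m a.
rewrite !(dotBl, dotBr, dotZl, dotZr) [dot b c]dotC; ring.
Qed.

Lemma energy_lb (K gm : R) a b : K <= 2 * e * (1 - gm) -> gm <= 1 ->
  (forall x y, ab (dot x (hbmx *m y)) <= K * norm2 x * norm2 y) ->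
  gm * (norm2 a ^+ 2 + e ^+ 2 * norm2 b ^+ 2) <= energy a b.
Proof.
move=> hK gm1 hB; rewrite /energy hbmx_dot.
have [_ h] := ab_le (hB a b).
rewrite -(norm2_sqE a) -(norm2_sqE b).
have a0 := norm2_ge0 a; have b0 := norm2_ge0 b.
set x := norm2 a in h a0 *; set y := norm2 b in h b0 *.
have h2 : K * x * y <= 2 * e * (1 - gm) * (x * y).
  by rewrite -mulrA mul_ler // mul_ge0.
have h3 : (1 - gm) * (2 * e * (x * y)) <= (1 - gm) * (x ^+ 2 + e ^+ 2 * y ^+ 2).
  by rewrite mul_lel ?subr_ge0 //; have := sqr_ge0 (x - e * y); lra.
lra.
Qed.

(** Completing the square in [a] gives [|a - B b / 2|^2 <= energy a b], from which
    the triangle inequality for the square root of the energy follows. *)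
Lemma energy_perturb (K : R) a b f S : 0 <= K -> K <= 2 * e ->
  (forall x, norm2 (hbmx *m x) <= K * norm2 x) ->
  0 <= S -> energy a b <= S ^+ 2 -> energy (a + f) b <= (S + norm2 f) ^+ 2.
Proof.
move=> K0 hK hB S0 hS.
have ee0 := e0.
pose g := a - (1 / 2) *: (hbmx *m b).
have -> : energy (a + f) b = energy a b + 2 * dot f g + norm2 f ^+ 2.
  rewrite norm2_sqE /energy /g !hbmx_dot !(dotDl, dotDr, dotNr, dotZr) [dot a f]dotC.
  by field.
have hg : norm2 g <= S.
  rewrite -ler_sqr ?nnegrE ?norm2_ge0 //; apply: le_trans hS.
  have -> : norm2 g ^+ 2 = energy a b + (norm2 (hbmx *m b) ^+ 2 / 4 - e ^+ 2 * norm2 b ^+ 2).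
    rewrite !norm2_sqE /energy /g hbmx_dot; set c := hbmx *m b.
    rewrite !(dotBl, dotBr, dotZl, dotZr) [dot c a]dotC; by field.
  have : norm2 (hbmx *m b) ^+ 2 <= (2 * e * norm2 b) ^+ 2.
    have hb2 : norm2 (hbmx *m b) <= 2 * e * norm2 b.
      by apply: le_trans (hB b) _; rewrite mul_ler ?norm2_ge0.
    have hb3 := norm2_ge0 (hbmx *m b).
    by rewrite ler_sqr ?nnegrE //; apply: le_trans hb2.
  lra.
have d := dot_le f g; have f0 := norm2_ge0 f.
have := mul_lel f0 hg; lra.
Qed.

(** For a distortion bounded away from 0 the energy is equivalent to the squared
    norm, so that the perturbed recurrence still contracts by [sqrt e]. *)
Lemma hb_large (C r K gm G : R) (p : nat) w : 0 <= C -> hb_run C p w ->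
  1 / 100 <= e -> e = r ^+ 2 -> 0 < r -> r <= 96 / 100 ->
  0 <= gm -> gm <= 1 -> 1 <= G -> gm * G ^+ 2 = 1 ->
  101 * G * eps <= r * (1 - r) ->
  0 <= K -> K <= 2 * e * (1 - gm) ->
  (forall x y, ab (dot x (hbmx *m y)) <= K * norm2 x * norm2 y) ->
  norm2 (w 0%N).1 <= 5 * C -> norm2 (w 0%N).2 <= 5 * C ->
  norm2 (w p).1 <= G * (r ^+ p * (10 * C) + 25 * eps * C).
Proof.
move=> C0 hw e1 er r0 r1 gm0 gm1 G1 gmG hr K0 hK hB w1 w2.
have hB' := hbmx_norm K0 hB.
have ee0 := e0; have eeps0 := eps0.
have e1' : e <= 1 by rewrite er exprn_ile1 //; lra.
have epsC : 0 <= eps * C by rewrite mul_ge0.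
have G0 : 0 <= G by lra.
pose V i := energy (w i).1 (w i).2.
have lb a b S : 0 <= S -> energy a b <= S ^+ 2 -> norm2 a <= G * S /\ norm2 b <= 100 * (G * S).
  move=> S0 hS; have h := le_trans (energy_lb a b hK gm1 hB) hS.
  have a0 := norm2_ge0 a; have b0 := norm2_ge0 b.
  have GS : 0 <= G * S by rewrite mul_ge0.
  have {}h : norm2 a ^+ 2 + e ^+ 2 * norm2 b ^+ 2 <= (G * S) ^+ 2.
    have := mul_lel (sqr_ge0 G) h; rewrite exprMn mulrA [G ^+ 2 * gm]mulrC gmG mul1r.
    by [].
  have q1 : 0 <= (e * norm2 b) ^+ 2 by rewrite sqr_ge0.
  have q2 := sqr_ge0 (norm2 a).
  rewrite -exprMn in h.
  have x1 : norm2 a <= G * S by rewrite -ler_sqr ?nnegrE //; lra.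
  have x2 : e * norm2 b <= G * S by rewrite -ler_sqr ?nnegrE ?mul_ge0 //; lra.
  split => //; have := mul_ler b0 e1; lra.
have hK2 : K <= 2 * e.
  by apply: le_trans hK _; rewrite -[leRHS]mulr1 mul_lel // ?mul_ge0 //; lra.
clear gm gm0 gm1 gmG hK.
suff H i : (i <= p)%N -> V i <= (r ^+ i * (10 * C) + 25 * eps * C) ^+ 2.
  have := H p (leqnn p); set S := _ + _ => /lb [] //.
  by rewrite addr_ge0 ?mul_ge0 ?exprn_ge0 ?(ltW r0) //; lra.
elim: i => [|i IH] ip.
  rewrite expr0 mul1r; apply: (@le_trans _ _ ((10 * C) ^+ 2)); last first.
    rewrite ler_sqr ?nnegrE; lra.
  rewrite /V /energy hbmx_dot.
  have [h _] := ab_le (hB (w 0%N).1 (w 0%N).2).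
  rewrite -!norm2_sqE.
  have a0 := norm2_ge0 (w 0%N).1; have b0 := norm2_ge0 (w 0%N).2.
  set x := norm2 (w 0%N).1 in h a0 w1 *; set y := norm2 (w 0%N).2 in h b0 w2 *.
  have k1 : K * x * y <= 2 * (5 * C) * (5 * C).
    by rewrite mul_le ?mul_ge0 // mul_le //; lra.
  have k2 : x ^+ 2 <= (5 * C) ^+ 2 by rewrite ler_sqr ?nnegrE //; lra.
  have k3 : e ^+ 2 * y ^+ 2 <= 1 * (5 * C) ^+ 2.
    by rewrite mul_le ?sqr_ge0 //; [rewrite exprn_ile1|rewrite ler_sqr ?nnegrE //; lra].
  lra.
have {}IH := IH (ltnW ip); have [Ep hz] := hw i ip.
rewrite /V Ep.
set a := (w i).1 in hz *; set b := (w i).2 in hz *.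
set S := (X in V i <= X ^+ 2) in IH.
have S0 : 0 <= S.
  by rewrite addr_ge0 ?mul_ge0 ?exprn_ge0 ?(ltW r0) //; lra.
have [ha hb] := lb _ _ _ S0 IH.
set f := _ - _ in hz.
have -> : (w i.+1).1 = (hbmx *m a - e ^+ 2 *: b) + f by rewrite /f addrC subrK.
have E1 : energy (hbmx *m a - e ^+ 2 *: b) a <= (e * S) ^+ 2.
  by rewrite energy_step exprMn mul_lel ?sqr_ge0.
have eS : 0 <= e * S by rewrite mul_ge0.
apply: le_trans (energy_perturb f K0 hK2 hB' eS E1) _.
have fn := norm2_ge0 f.
have ES : r ^+ i.+1 * (10 * C) + 25 * eps * C = r * S + 25 * (1 - r) * (eps * C).
  by rewrite /S exprS; ring.
rewrite ES.
have e3 : eps * (norm2 a + norm2 b + C) <= eps * (101 * (G * S) + C).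
  rewrite mul_lel //. have GS : G * 0 <= G * S by rewrite mul_lel. lra.
have e4 : 101 * G * eps * S <= r * (1 - r) * S by rewrite mul_ler.
have e5 : 1 * (eps * C) <= 25 * (1 - r) * (eps * C) by rewrite mul_ler //; lra.
have hfin : e * S + norm2 f <= r * S + 25 * (1 - r) * (eps * C).
  rewrite er; lra.
rewrite ler_sqr ?nnegrE //; first by rewrite addr_ge0.
by apply: le_trans hfin; rewrite addr_ge0.
Qed.

End HeavyBall.

(** * Convergence with the tuned parameters *)

Section Tuning.
Context {R : realType}.

(** For a small distortion it is enough to bound the matrix by about [3 e] instead
    of the critical value [2 e]; the term [4 eps] allows the rounding level [eps]
    to dominate [e]. *)
Lemma tuning_small (s e eps : R) : 0 <= e -> e <= 1 / 100 -> 0 <= eps ->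
  eps <= 1 / 1000 -> 0 <= s -> s <= e + eps ->
  (1 - e ^+ 2) ^+ 2 <= (1 - s) ^+ 2 * (1 + e ^+ 2 + (3 * e + 4 * eps)) /\
  (1 + s) ^+ 2 * (1 + e ^+ 2 - (3 * e + 4 * eps)) <= (1 - e ^+ 2) ^+ 2.
Proof.
move=> e0 e1 eps0 eps1 s0 s1.
pose t := e + eps; have t0 : 0 <= t by rewrite /t; lra.
have t1 : t <= 1 / 20 by rewrite /t; lra.
have st : s <= t := s1.
have e2 : e ^+ 2 <= 1 / 100 * e by rewrite expr2 mul_ler.
have ee2 := sqr_ge0 e.
have t2 : t ^+ 2 <= 1 / 20 * t by rewrite expr2 mul_ler.
have tt2 := sqr_ge0 t.
have t3 : 0 <= t * t ^+ 2 by rewrite mul_ge0.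
have t3' : t * t ^+ 2 <= 1 / 20 * t ^+ 2 by rewrite mul_ler.
have s2 : s ^+ 2 <= t ^+ 2 by rewrite ler_sqr ?nnegrE.
have ss2 := sqr_ge0 s.
split.
  apply: (@le_trans _ _ 1); first by rewrite exprn_ile1 //; lra.
  apply: (@le_trans _ _ ((1 - t) ^+ 2 * (1 + 3 * t))); first lra.
  rewrite mul_le ?sqr_ge0 //; first lra.
    by rewrite ler_sqr ?nnegrE; lra.
  by rewrite /t; lra.
apply: (@le_trans _ _ ((1 + t) ^+ 2 * (1 - 28 / 10 * t))).
  rewrite mul_le ?sqr_ge0 //; first lra.
    by rewrite ler_sqr ?nnegrE; lra.
  by rewrite /t; lra.
apply: (@le_trans _ _ (1 - 2 * e ^+ 2)); last by have := sqr_ge0 (e ^+ 2); lra.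
have te : e <= t by rewrite /t; lra.
lra.
Qed.

(** The safety factor of the tuning leaves a relative gap [gm] below the
    critical value [2 e]. *)
Lemma tuning_large (s e gm : R) : 0 <= e -> e <= 909 / 1000 -> 0 <= gm ->
  100 * gm <= 4 / 10 / 1000 -> 0 <= s -> s <= 991 / 1000 * e ->
  (1 - e ^+ 2) ^+ 2 <= (1 - s) ^+ 2 * (1 + e ^+ 2 + 2 * e * (1 - gm)) /\
  (1 + s) ^+ 2 * (1 + e ^+ 2 - 2 * e * (1 - gm)) <= (1 - e ^+ 2) ^+ 2.
Proof.
move=> e0 e1 gm0 gm1 s0 s1.
pose t := 991 / 1000 * e.
have t1 : t <= 1 by rewrite /t; lra.
have st : s <= t := s1.
split.
  apply: (@le_trans _ _ ((1 - t) ^+ 2 * (1 + e ^+ 2 + 2 * e * (1 - gm)))); last first.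
    rewrite mul_ler ?ler_sqr ?nnegrE //; [|lra..].
    have : 0 <= e * (1 - gm) by rewrite mul_ge0 //; lra.
    have := sqr_ge0 e; lra.
  have -> : (1 - t) ^+ 2 * (1 + e ^+ 2 + 2 * e * (1 - gm)) =
    (1 - e ^+ 2) ^+ 2 + e * ((18 / 1000 * (1 - e) + 9 / 1000 * (9 / 1000 * e)) * (1 + e) ^+ 2 - 2 * gm * (1 - t) ^+ 2).
    by rewrite /t; field.
  set A := (1 - e ^+ 2) ^+ 2; set X := _ - _.
  suff X0 : 0 <= X by have := mul_ge0 e0 X0; clear; lra.
  rewrite subr_ge0.
  apply: (@le_trans _ _ (2 * gm * 1)).
    rewrite mul_lel //; first lra.
    by rewrite exprn_ile1 //; rewrite /t; lra.
  apply: (@le_trans _ _ (18 / 1000 * (91 / 1000) * 1)); first lra.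
  apply: mul_le; [lra|lra| |have := sqr_ge0 e; lra].
  have := sqr_ge0 e; lra.
apply: (@le_trans _ _ ((1 + t) ^+ 2 * (1 + e ^+ 2 - 2 * e * (1 - gm)))).
  rewrite mul_ler ?ler_sqr ?nnegrE //; [|lra..].
  have : 0 <= e * gm by rewrite mul_ge0.
  have := sqr_ge0 (1 - e); lra.
have -> : (1 + t) ^+ 2 * (1 + e ^+ 2 - 2 * e * (1 - gm)) =
  (1 - e ^+ 2) ^+ 2 - e * ((18 / 1000 * (1 + e) - 9 / 1000 * (9 / 1000 * e)) * (1 - e) ^+ 2 - 2 * gm * (1 + t) ^+ 2).
  by rewrite /t; field.
set A := (1 - e ^+ 2) ^+ 2; set X := _ * (1 - e) ^+ 2 - _.
suff X0 : 0 <= X by have := mul_ge0 e0 X0; clear; lra.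
rewrite subr_ge0.
apply: (@le_trans _ _ (2 * gm * 2 ^+ 2)).
  rewrite mul_lel //; first lra.
  by rewrite ler_sqr ?nnegrE //; rewrite /t; lra.
apply: (@le_trans _ _ (17 / 1000 * (91 / 1000) ^+ 2)); first lra.
apply: mul_le; [lra|exact: sqr_ge0|lra|].
by rewrite ler_sqr ?nnegrE; lra.
Qed.

(** Contraction of the perturbed recurrence, uniformly in the distortion: after
    [p] steps with [e^p <= nu^2] the initial error is reduced to [nu]. *)
Lemma hb_conv n (M : 'M[R]_n) (eta s e eps nu C : R) (p : nat) w :
  M^T = M -> 0 < eta -> eta <= 9 / 10 -> e = 101 / 100 * eta ->
  0 <= s -> s <= eta + eps -> 0 < eps -> 100 * 100 * 100 * eps <= 1 / 1000 ->
  (forall x, dot x x <= (1 + s) ^+ 2 * dot x (M *m x)) ->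
  (forall x, (1 - s) ^+ 2 * dot x (M *m x) <= dot x x) ->
  0 <= C -> hb_run M e eps C p w ->
  norm2 (w 0%N).1 <= 5 * C -> norm2 (w 0%N).2 <= 5 * C ->
  0 <= nu -> e ^+ p <= nu ^+ 2 -> (2 <= p)%N ->
  norm2 (w p).1 <= 500 * (30 * (nu + eps) * C).
Proof.
move=> sM eta0 eta1 Ee s0 s2 eps0 eps1 Mlo Mhi C0 hw w1 w2 nu0 hp p2.
have e0 : 0 < e by lra.
have e1 : e <= 909 / 1000 by lra.
have ss1 : s < 1 by lra.
have epsC : 0 <= eps * C by rewrite mul_ge0 // ltW.
have nuC : 0 <= nu * C by rewrite mul_ge0.
have sq_le (r : R) : 0 <= r -> r ^+ 2 = e -> r ^+ p <= nu.
  move=> r0 re; rewrite -ler_sqr ?nnegrE ?exprn_ge0 //.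
  by rewrite -exprM mulnC exprM re.
have e0' := ltW e0; have eps0' := ltW eps0.
have [esm|elg] := leP e (1 / 100).
  have [t1 t2] : _ /\ _ := @tuning_small s e eps e0' esm eps0' ltac:(lra) s0 ltac:(lra).
  have hN : 0 <= 3 * e + 4 * eps by lra.
  have hB := hbmx_bound sM s0 ss1 Mlo Mhi hN t1 t2.
  have hB' := hbmx_norm hN hB.
  (* the rate is [sqrt e], unless the rounding level dominates the distortion *)
  pose rho2 := Num.max e (10 * eps); pose rho := Num.sqrt rho2.
  have rho20 : 0 < rho2 by rewrite lt_max e0.
  have rho0 : 0 < rho by rewrite sqrtr_gt0.
  have rhoE : rho ^+ 2 = rho2 by rewrite sqr_sqrtr // ltW.
  have rho21 : rho2 <= 1 / 100 by rewrite /rho2 ge_max esm /=; lra.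
  have rho0' := ltW rho0.
  have rho1 : rho <= 1 / 5.
    have h5 : rho ^+ 2 <= (1 / 5) ^+ 2 by rewrite rhoE; lra.
    by move: h5; rewrite ler_sqr ?nnegrE //; lra.
  have er : e <= rho ^+ 2 by rewrite rhoE le_max lexx.
  have epr : 10 * eps <= rho ^+ 2 by rewrite rhoE le_max lexx orbT.
  have hK' : 3 * e + 4 * eps <= 3 * rho ^+ 2 + 4 * eps by lra.
  have h := hb_small e0' eps0' C0 hw rho0 rho1 er epr hK' hB' w1 w2.
  have hr : rho ^+ p <= nu + 10 * eps.
    have [h10|h10] := leP e (10 * eps).
      apply: (@le_trans _ _ (rho ^+ 2)); first by rewrite ler_wiXn2l //; lra.
      rewrite rhoE /rho2 (max_idPr h10); lra.
    have rr : rho ^+ 2 = e by rewrite rhoE /rho2 (max_idPl (ltW h10)).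
    have h' := sq_le rho rho0' rr; lra.
  have := mul_ler C0 hr; lra.
pose r := Num.sqrt e.
have r0 : 0 < r by rewrite sqrtr_gt0.
have rE : r ^+ 2 = e by rewrite sqr_sqrtr.
have r1 : r <= 96 / 100.
  have h5 : r ^+ 2 <= (96 / 100) ^+ 2 by rewrite rE; lra.
  by move: h5; rewrite ler_sqr ?nnegrE ?(ltW r0) //; lra.
have r2 : 1 / 10 <= r.
  have h5 : (1 / 10) ^+ 2 <= r ^+ 2 by rewrite rE; lra.
  by move: h5; rewrite ler_sqr ?nnegrE ?(ltW r0) //; lra.
(* [gm = 1 / 500^2] is the largest gap that [tuning_large] allows; [G = 500] *)
have [h h5 h0] : exists2 h : R, 500 * h = 1 & 0 <= h.
  by clear; exists (1 / 5 * (1 / 100)); lra.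
pose gm : R := h ^+ 2.
have gmE : gm * 500 ^+ 2 = 1 by rewrite -exprMn mulrC h5 expr1n.
have gm0 : 0 <= gm by rewrite exprn_ge0.
have gm1 : 100 * gm <= 4 / 10 / 1000.
  have -> : 100 * gm = (100 * h) * h by rewrite /gm; ring.
  have -> : 100 * h = 1 / 5 by lra.
  lra.
have s3 : s <= 991 / 1000 * e by lra.
clearbody gm.
have [t1 t2] := tuning_large e0' e1 gm0 gm1 s0 s3.
have gm2 : gm <= 1 by clear - gm1; lra.
have hN : 0 <= 2 * e * (1 - gm) by rewrite !mul_ge0 //; lra.
have hB := hbmx_bound sM s0 ss1 Mlo Mhi hN t1 t2.
have hG : 101 * 500 * eps <= r * (1 - r).
  have h3 : 1 / 10 * (4 / 100) <= r * (1 - r) by clear - r1 r2; apply: mul_le; lra.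
  by apply: (le_trans _ h3); clear - eps1; lra.
have one500 : 1 <= 500 :> R by lra.
have hmain := hb_large sM e0' eps0' C0 hw (ltW elg) (esym rE) r0 r1 gm0 gm2 one500 gmE hG hN (lexx _) hB w1 w2.
have hr := mul_ler C0 (sq_le r (ltW r0) rE).
apply: le_trans hmain _; apply: mul_lel; first by clear; lra.
clear - hr epsC nuC; lra.
Qed.

End Tuning.

(** * Rounding errors of the preconditioned iteration *)

Lemma iterP_seq (T : Type) (f : T -> prog T) k x y c : iterP k f x y c ->
  exists w : nat -> T, [/\ w 0%N = x, w k = y &
    forall i, (i < k)%N -> exists a, f (w i) (w i.+1) a].
Proof.
elim: k x c => [|k IH] x c /=; first by case=> -> _; exists (fun _ => x).
case=> x1 [c1 [c2 [fx /IH[w [w0 wk wS]] _]]].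
exists (fun i => if i is j.+1 then w j else x); split => // -[|i] ik /=.
  by exists c1; rewrite w0.
exact: wS.
Qed.

Lemma scale_perturb (R : realType) n (al ah g delta : R) (x r y : 'cV[R]_n) :
  0 <= al -> al <= 1 -> 0 <= g -> g <= 1 -> ab (ah - al) <= g ->
  norm2 (y - ah *: r) <= g * norm2 (ah *: r) -> norm2 (r - x) <= delta ->
  norm2 (y - al *: x) <= delta + 3 * (g * norm2 r).
Proof.
move=> al0 al1 g0 g1 hah hy hr.
have -> : y - al *: x = (y - ah *: r) + ((ah - al) *: r + al *: (r - x)).
  by apply/matrixP => i j; rewrite !mxE; ring.
have n1 := norm2D (y - ah *: r) ((ah - al) *: r + al *: (r - x)).
have n2 := norm2D ((ah - al) *: r) (al *: (r - x)).
rewrite !norm2Z -!/(ab _) (ab_id al0) in n2 hy.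
have r0 := norm2_ge0 r.
have n4 : al * norm2 (r - x) <= 1 * norm2 (r - x).
  by apply: mul_ler => //; exact: norm2_ge0.
have n5 : ab (ah - al) * norm2 r <= g * norm2 r by apply: mul_ler.
have n6 : ab ah <= 2.
  have := abD (ah - al) al; rewrite subrK (ab_id al0); clear - hah al1 g1; lra.
have n7 : g * (ab ah * norm2 r) <= g * (2 * norm2 r).
  by apply: mul_lel => //; apply: mul_ler.
clear - n1 n2 n4 n5 n7 hy hr; lra.
Qed.

Section Preconditioner.
Context {R : realType}.

(** The properties of the triangular factor [T] of a sketch of [A]: [s] is the
    distortion of the sketch, increased by the rounding errors of the
    factorization, and [kap] bounds the condition number of [A]. *)
Record precond m n (A : 'M[R]_(m, n)) (T : 'M[R]_n) (kap s : R) : Prop := {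
  precA1 : forall y, norm2 (A *m y) <= norm2 y;
  precAk : forall y, norm2 y <= kap * norm2 (A *m y);
  prec_kap1 : 1 <= kap;
  prec_s0 : 0 <= s;
  prec_s1 : s <= 91 / 100;
  precTlo : forall y, (1 - s) * norm2 (A *m y) <= norm2 (T *m y);
  precThi : forall y, norm2 (T *m y) <= (1 + s) * norm2 (A *m y) }.

Lemma prec_kap0 m n (A : 'M[R]_(m, n)) (T : 'M[R]_n) (kap s : R) :
  precond A T kap s -> 0 <= kap.
Proof. by move=> H; apply: le_trans (prec_kap1 H). Qed.

Lemma prec_A m n (A : 'M[R]_(m, n)) (T : 'M[R]_n) (kap s : R)
    (H : precond A T kap s) y : norm2 (A *m y) <= 12 * norm2 (T *m y).
Proof.
have h := (precTlo H) y; have a0 := norm2_ge0 (A *m y).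
have : 9 / 100 * norm2 (A *m y) <= (1 - s) * norm2 (A *m y).
  by have h1 := (prec_s1 H); apply: mul_ler => //; lra.
lra.
Qed.

Lemma prec_T m n (A : 'M[R]_(m, n)) (T : 'M[R]_n) (kap s : R)
    (H : precond A T kap s) y : norm2 (T *m y) <= 2 * norm2 (A *m y).
Proof.
apply: le_trans (precThi H y) _; have h1 := (prec_s1 H); apply: mul_ler; first exact: norm2_ge0.
lra.
Qed.

Lemma prec_x m n (A : 'M[R]_(m, n)) (T : 'M[R]_n) (kap s : R)
    (H : precond A T kap s) y : norm2 y <= 12 * (kap * norm2 (T *m y)).
Proof.
apply: le_trans (precAk H y) _; have := mul_lel (prec_kap0 H) (prec_A H y); lra.
Qed.

Lemma prec_unit m n (A : 'M[R]_(m, n)) (T : 'M[R]_n) (kap s : R)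
    (H : precond A T kap s) : T \in unitmx.
Proof.
have k0 : 0 < kap by apply: lt_le_trans (prec_kap1 H).
apply: (@unitmx_lb _ _ _ (12 * kap)^-1); first by rewrite invr_gt0 mulr_gt0.
move=> y; rewrite ler_pdivrMl ?mulr_gt0 //; have := (prec_x H) y; lra.
Qed.

(** The preconditioned matrix [A T^-1], whose singular values are between
    [1 / (1 + s)] and [1 / (1 - s)]. *)
Definition prec_op m n (A : 'M[R]_(m, n)) (T : 'M[R]_n) : 'M[R]_(m, n) := A *m invmx T.
Definition prec_gram m n (A : 'M[R]_(m, n)) (T : 'M[R]_n) : 'M[R]_n := (prec_op A T)^T *m (prec_op A T).

Lemma prec_opT m n (A : 'M[R]_(m, n)) (T : 'M[R]_n) (kap s : R)
    (H : precond A T kap s) (y : 'cV[R]_n) : (prec_op A T) *m (T *m y) = A *m y.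
Proof. by rewrite /prec_op -mulmxA mulKmx // (prec_unit H). Qed.

Lemma prec_op_norm m n (A : 'M[R]_(m, n)) (T : 'M[R]_n) (kap s : R)
    (H : precond A T kap s) (z : 'cV[R]_n) : norm2 ((prec_op A T) *m z) <= 12 * norm2 z.
Proof. by rewrite -(mulKVmx (prec_unit H) z) (prec_opT H) (prec_A H). Qed.

Lemma prec_opt_norm m n (A : 'M[R]_(m, n)) (T : 'M[R]_n) (kap s : R)
    (H : precond A T kap s) (z : 'cV[R]_m) : norm2 ((prec_op A T)^T *m z) <= 12 * norm2 z.
Proof. by apply: norm2_adj => //; exact: (prec_op_norm H). Qed.

Lemma prec_inv_norm m n (A : 'M[R]_(m, n)) (T : 'M[R]_n) (kap s : R)
    (H : precond A T kap s) (z : 'cV[R]_n) : norm2 (invmx T *m z) <= 12 * (kap * norm2 z).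
Proof. by have := (prec_x H) (invmx T *m z); rewrite mulKVmx ?(prec_unit H). Qed.

Lemma prec_invt_norm m n (A : 'M[R]_(m, n)) (T : 'M[R]_n) (kap s : R)
    (H : precond A T kap s) (z : 'cV[R]_n) : norm2 (invmx T^T *m z) <= 12 * (kap * norm2 z).
Proof.
rewrite -trmx_inv mulrA; apply: norm2_adj; first exact: mul_ge0 (ler0n _ _) (prec_kap0 H).
by move=> y; rewrite -mulrA (prec_inv_norm H).
Qed.

Lemma prec_opt_E m n (A : 'M[R]_(m, n)) (T : 'M[R]_n) (z : 'cV[R]_m) : invmx T^T *m (A^T *m z) = (prec_op A T)^T *m z.
Proof. by rewrite /prec_op trmx_mul trmx_inv mulmxA. Qed.

Lemma prec_gram_sym m n (A : 'M[R]_(m, n)) (T : 'M[R]_n) : (prec_gram A T)^T = (prec_gram A T).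
Proof. by rewrite /prec_gram trmx_mul trmxK. Qed.

Lemma prec_gram_dot m n (A : 'M[R]_(m, n)) (T : 'M[R]_n) (x : 'cV[R]_n) : dot x ((prec_gram A T) *m x) = norm2 ((prec_op A T) *m x) ^+ 2.
Proof. by rewrite /prec_gram -mulmxA dot_adjT norm2_sqE. Qed.

Lemma prec_gram_lo m n (A : 'M[R]_(m, n)) (T : 'M[R]_n) (kap s : R)
    (H : precond A T kap s) (x : 'cV[R]_n) : dot x x <= (1 + s) ^+ 2 * dot x ((prec_gram A T) *m x).
Proof.
have s0' := prec_s0 H.
rewrite prec_gram_dot -norm2_sqE -exprMn ler_sqr ?nnegrE ?norm2_ge0 ?mul_ge0 ?norm2_ge0 ?addr_ge0 //.
by rewrite -{1}(mulKVmx (prec_unit H) x) /prec_op -mulmxA (precThi H).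
Qed.

Lemma prec_gram_hi m n (A : 'M[R]_(m, n)) (T : 'M[R]_n) (kap s : R)
    (H : precond A T kap s) (x : 'cV[R]_n) : (1 - s) ^+ 2 * dot x ((prec_gram A T) *m x) <= dot x x.
Proof.
have h1 := (prec_s1 H).
rewrite prec_gram_dot -norm2_sqE -exprMn ler_sqr ?nnegrE ?norm2_ge0 ?mul_ge0 ?norm2_ge0 //; last by lra.
by rewrite -{2}(mulKVmx (prec_unit H) x) /prec_op -mulmxA (precTlo H).
Qed.

Lemma gram_unit m n (A : 'M[R]_(m, n)) (T : 'M[R]_n) (kap s : R)
    (H : precond A T kap s) : A^T *m A \in unitmx.
Proof.
have kk := prec_kap0 H; have k0 : 0 < kap by apply: lt_le_trans (prec_kap1 H).
apply: (@unitmx_lb _ _ _ (kap ^+ 2)^-1); first by rewrite invr_gt0 exprn_gt0.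
move=> y; rewrite ler_pdivrMl ?exprn_gt0 //.
have [->|y0] := eqVneq y 0; first by rewrite mulmx0 norm2_0 mulr0.
rewrite -norm2_gt0 in y0.
apply: (le_mul2l y0); have h := (precAk H) y.
have h2 : norm2 y ^+ 2 <= kap ^+ 2 * norm2 (A *m y) ^+ 2.
  by rewrite -exprMn ler_sqr ?nnegrE ?norm2_ge0 ?mul_ge0 ?norm2_ge0.
rewrite -expr2; apply: le_trans h2 _.
rewrite [norm2 (A *m y) ^+ 2]norm2_sqE -dot_adjT mulmxA mulrCA.
by apply: mul_lel; [rewrite exprn_ge0|exact: dot_le].
Qed.

(** The orthogonal projection onto the range of [A] does not increase norms. *)
Lemma gram_solve_A m n (A : 'M[R]_(m, n)) (T : 'M[R]_n) (kap s : R)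
    (H : precond A T kap s) (d : 'cV[R]_m) : norm2 (A *m (invmx (A^T *m A) *m (A^T *m d))) <= norm2 d.
Proof.
set y := invmx _ *m _.
have Ey : A^T *m (A *m y) = A^T *m d by rewrite /y mulmxA mulKVmx ?(gram_unit H).
have [->|y0] := eqVneq (A *m y) 0; first by rewrite norm2_0 norm2_ge0.
rewrite -norm2_gt0 in y0; apply: (le_mul2l y0); rewrite -expr2 norm2_sqE.
by rewrite -dot_adjT Ey dot_adjT dot_le.
Qed.

Lemma gram_solve_w m n (A : 'M[R]_(m, n)) (T : 'M[R]_n) (kap s : R)
    (H : precond A T kap s) (w : 'cV[R]_n) : norm2 (A *m (invmx (A^T *m A) *m w)) <= kap * norm2 w.
Proof.
have kk := prec_kap0 H; set y := invmx _ *m _.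
have Ey : A^T *m (A *m y) = w by rewrite /y mulmxA mulKVmx ?(gram_unit H).
have [->|y0] := eqVneq (A *m y) 0; first by rewrite norm2_0 mul_ge0 ?norm2_ge0.
rewrite -norm2_gt0 in y0; apply: (le_mul2l y0); rewrite -expr2 norm2_sqE.
rewrite -dot_adjT Ey; apply: le_trans (dot_le _ _) _.
by rewrite mulrA [_ * kap]mulrC; apply: mul_ler; [exact: norm2_ge0|exact: (precAk H)].
Qed.

Lemma prec_gram_inv m n (A : 'M[R]_(m, n)) (T : 'M[R]_n) (kap s : R)
    (H : precond A T kap s) (c : 'cV[R]_n) : (prec_gram A T) *m (T *m (invmx (A^T *m A) *m (T^T *m c))) = c.
Proof.
rewrite /prec_gram -mulmxA (prec_opT H) -prec_opt_E (mulmxA A^T) mulKVmx ?(gram_unit H) //.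
by rewrite mulKmx // unitmx_tr (prec_unit H).
Qed.

Lemma prec_gram_inv_norm m n (A : 'M[R]_(m, n)) (T : 'M[R]_n) (kap s : R)
    (H : precond A T kap s) (y : 'cV[R]_n) : norm2 y <= 4 * norm2 ((prec_gram A T) *m y).
Proof.
have [->|y0] := eqVneq y 0; first by rewrite norm2_0 mul_ge0 ?norm2_ge0.
rewrite -norm2_gt0 in y0; apply: (le_mul2l y0); rewrite -expr2 norm2_sqE.
have ss := (prec_s0 H); have ss1 := (prec_s1 H).
apply: le_trans (prec_gram_lo H y) _.
have d0 : 0 <= dot y ((prec_gram A T) *m y) by rewrite prec_gram_dot sqr_ge0.
have h1 : (1 + s) ^+ 2 * dot y ((prec_gram A T) *m y) <= 2 ^+ 2 * dot y ((prec_gram A T) *m y).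
  apply: mul_ler => //; rewrite ler_sqr ?nnegrE; lra.
have := dot_le y ((prec_gram A T) *m y); lra.
Qed.

(** One level [g] for the errors of all products and solves. The residual of a
    triangular solve is small relative to its computed solution; a bound relative
    to the right-hand side costs a factor [kap] ([solve_norm]). *)
Record rounding m n (A : 'M[R]_(m, n)) (T : 'M[R]_n) (u g : R) : Prop := {
  rnd_u0 : 0 <= u;
  rnd_ug : u <= g;
  rnd_mulA : forall x y k, mulvP u A x y k -> norm2 (y - A *m x) <= g * norm2 x;
  rnd_mulAt : forall x y k, mulvP u A^T x y k -> norm2 (y - A^T *m x) <= g * norm2 x;
  rnd_solve : forall c z k, solveP u T c z k -> norm2 (T *m z - c) <= g * norm2 z;
  rnd_solvet : forall c z k, solvetP u T c z k -> norm2 (T^T *m z - c) <= g * norm2 z }.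

Lemma rnd_g0 m n (A : 'M[R]_(m, n)) (T : 'M[R]_n) (u g : R) : rounding A T u g -> 0 <= g.
Proof. by move=> Hr; exact: le_trans (rnd_u0 Hr) (rnd_ug Hr). Qed.

Lemma rnd_h0 m n (A : 'M[R]_(m, n)) (T : 'M[R]_n) (kap s u g : R) :
  precond A T kap s -> rounding A T u g -> 0 <= kap * g.
Proof. by move=> H Hr; apply: mul_ge0; [exact: prec_kap0 H|exact: rnd_g0 Hr]. Qed.

Lemma rnd_gh m n (A : 'M[R]_(m, n)) (T : 'M[R]_n) (kap s u g : R) :
  precond A T kap s -> rounding A T u g -> g <= kap * g.
Proof.
move=> H Hr; rewrite -{1}[g]mul1r; apply: mul_ler; [exact: rnd_g0 Hr|exact: prec_kap1 H].
Qed.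

Lemma addvP_rel m n (A : 'M[R]_(m, n)) (T : 'M[R]_n) (u g : R)
    (Hr : rounding A T u g) p (x y z : 'cV[R]_p) k : Defs.addvP u x y z k ->
  norm2 (z - (x + y)) <= g * norm2 (x + y).
Proof.
move=> h; apply: le_trans (addvP_err (rnd_u0 Hr) h) _.
by apply: mul_ler; [exact: norm2_ge0|exact: (rnd_ug Hr)].
Qed.

Lemma subvP_rel m n (A : 'M[R]_(m, n)) (T : 'M[R]_n) (u g : R)
    (Hr : rounding A T u g) p (x y z : 'cV[R]_p) k : Defs.subvP u x y z k ->
  norm2 (z - (x - y)) <= g * norm2 (x - y).
Proof.
move=> h; apply: le_trans (subvP_err (rnd_u0 Hr) h) _.
by apply: mul_ler; [exact: norm2_ge0|exact: (rnd_ug Hr)].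
Qed.

Lemma scalevP_rel m n (A : 'M[R]_(m, n)) (T : 'M[R]_n) (u g : R)
    (Hr : rounding A T u g) p a (x z : 'cV[R]_p) k : scalevP u a x z k ->
  norm2 (z - a *: x) <= g * norm2 (a *: x).
Proof.
move=> h; apply: le_trans (scalevP_err (rnd_u0 Hr) h) _.
by apply: mul_ler; [exact: norm2_ge0|exact: (rnd_ug Hr)].
Qed.

Lemma solve_norm m n (A : 'M[R]_(m, n)) (T : 'M[R]_n) (kap s u g : R)
    (H : precond A T kap s) (Hr : rounding A T u g) (hs : kap * g <= 1 / 1000 / 1000) c z k : solveP u T c z k ->
  norm2 z <= 24 * (kap * norm2 c) /\ norm2 (T *m z - c) <= 24 * (kap * g) * norm2 c.
Proof.
move=> /(rnd_solve Hr) hz.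
have kk := prec_kap0 H; have gg0 := rnd_g0 Hr.
have z1 := (prec_x H) z; have z2 := norm2_near (T *m z) c.
have c0 := norm2_ge0 c; have z0 := norm2_ge0 z.
have z3 : kap * norm2 (T *m z) <= kap * (norm2 c + g * norm2 z).
  by apply: mul_lel => //; lra.
have z4 : kap * g * norm2 z <= 1 / 1000 * norm2 z by have hh := hs; apply: mul_ler => //; lra.
have z6 := mul_ge0 (prec_kap0 H) c0.
have z5 : norm2 z <= 24 * (kap * norm2 c) by lra.
split => //.
have := mul_lel (rnd_g0 Hr) z5; lra.
Qed.

(** The two products and the two solves contribute errors of level [g]; the
    inverses of [T] and of its transpose amplify them by multiples of [kap], and
    their product with [A] by a constant only. *)
Lemma prec_apply m n (A : 'M[R]_(m, n)) (T : 'M[R]_n) (kap s u g : R)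
    (H : precond A T kap s) (Hr : rounding A T u g) (hs : kap * g <= 1 / 1000 / 1000) y t1 t2 t3 t4 k1 k2 k3 k4 :
  solveP u T y t1 k1 -> mulvP u A t1 t2 k2 -> mulvP u A^T t2 t3 k3 ->
  solvetP u T t3 t4 k4 ->
  norm2 (t4 - (prec_gram A T) *m y) <= 80 * (100 * (kap * g)) * norm2 y.
Proof.
move=> /(solve_norm H Hr hs) [z1 z2] /(rnd_mulA Hr) e2 /(rnd_mulAt Hr) e3 /(rnd_solvet Hr) e4.
have kk := prec_kap0 H; have hh := hs; have hh0 := (rnd_h0 H Hr); have ggh := (rnd_gh H Hr); have gg0 := (rnd_g0 Hr).
have y0 := norm2_ge0 y.
have q1 : norm2 (A *m t1 - (prec_op A T) *m y) <= 12 * (24 * (kap * g) * norm2 y).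
  have -> : A *m t1 - (prec_op A T) *m y = (prec_op A T) *m (T *m t1 - y).
    by rewrite mulmxBr (prec_opT H).
  by apply: le_trans (prec_op_norm H _) _; apply: mul_lel.
have q2 : norm2 (t2 - (prec_op A T) *m y) <= 312 * (kap * g) * norm2 y.
  have -> : t2 - (prec_op A T) *m y = (t2 - A *m t1) + (A *m t1 - (prec_op A T) *m y).
    by rewrite addrA subrK.
  have := norm2D (t2 - A *m t1) (A *m t1 - (prec_op A T) *m y).
  have := mul_lel gg0 z1; lra.
have hy : kap * g * norm2 y <= 1 / 1000 / 1000 * norm2 y by apply: mul_ler => //; lra.
have q3 : norm2 t2 <= 13 * norm2 y.
  have := norm2_near t2 ((prec_op A T) *m y); have := (prec_op_norm H) y; lra.
set f := (t3 - A^T *m t2) + (T^T *m t4 - t3).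
have Et4 : t4 = (prec_op A T)^T *m t2 + invmx T^T *m f.
  rewrite -prec_opt_E -mulmxDr /f addrCA addrA subrK addrC subrK.
  by rewrite mulKmx // unitmx_tr (prec_unit H).
have t40 := norm2_ge0 t4.
have q4 : norm2 f <= g * (13 * norm2 y) + g * norm2 t4.
  apply: le_trans (norm2D _ _) _; apply: lerD => //.
  by apply: le_trans e3 _; apply: mul_lel.
have q5 : norm2 (invmx T^T *m f) <= 12 * (kap * (g * (13 * norm2 y) + g * norm2 t4)).
  apply: le_trans (prec_invt_norm H _) _; apply: mul_lel => //.
  by apply: mul_lel.
have q6 : kap * g * norm2 t4 <= 1 / 1000 / 1000 * norm2 t4 by apply: mul_ler => //; lra.
have q7 : norm2 t4 <= 320 * norm2 y.
  have := norm2D ((prec_op A T)^T *m t2) (invmx T^T *m f); rewrite -Et4.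
  have := (prec_opt_norm H) t2; lra.
have -> : t4 - (prec_gram A T) *m y = (prec_op A T)^T *m (t2 - (prec_op A T) *m y) + invmx T^T *m f.
  by rewrite /prec_gram -mulmxA mulmxBr {1}Et4 addrAC.
apply: le_trans (norm2D _ _) _.
have := (prec_opt_norm H) (t2 - (prec_op A T) *m y).
have := mul_lel hh0 q7.
have := mul_ge0 hh0 y0.
lra.
Qed.

(** The factor [kap] comes from the triangular solves alone, but is used for all
    the errors. *)
Lemma polyak_step_err m n (A : 'M[R]_(m, n)) (T : 'M[R]_n) (kap s u g : R)
    (H : precond A T kap s) (Hr : rounding A T u g) (hs : kap * g <= 1 / 1000 / 1000) (al be ah bh : R) c cur prev next cur' k :
  0 <= al -> al <= 1 -> 0 <= be -> be <= 1 ->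
  ab (ah - al) <= g -> ab (bh - be) <= g ->
  polyak_stepP u A T ah bh c (cur, prev) (next, cur') k ->
  cur' = cur /\
  norm2 (next - (cur + al *: (c - (prec_gram A T) *m cur) + be *: (cur - prev)))
    <= 120 * (100 * (kap * g)) * (norm2 cur + norm2 prev + norm2 c).
Proof.
move=> al0 al1 be0 be1 hah hbh.
case=> t1 [k1 [k1' [e1 [t2 [k2 [k2' [e2 [t3 [k3 [k3' [e3 [t4 [k4 [k4' [e4]]]]]]]]]]]]]]].
case=> [r [k5 [k5' [/(subvP_rel Hr) e5 [ar [k6 [k6' [/(scalevP_rel Hr) e6]]]]]]]].
case=> [p [k7 [k7' [/(subvP_rel Hr) e7 [bp [k8 [k8' [/(scalevP_rel Hr) e8]]]]]]]].
case=> [sm [k9 [k9' [/(addvP_rel Hr) e9 [nx [k10 [k10' [/(addvP_rel Hr) e10]]]]]]]].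
case=> [[-> ->] _] _ _ _ _ _ _ _ _ _ _; split => //.
have e4' := prec_apply H Hr hs e1 e2 e3 e4.
have kk := prec_kap0 H; have hh := hs; have hh0 := (rnd_h0 H Hr); have ggh := (rnd_gh H Hr); have gg0 := (rnd_g0 Hr).
set M := (prec_gram A T) in e4' *.
have c0 := norm2_ge0 c; have y0 := norm2_ge0 cur; have p0 := norm2_ge0 prev.
have hM : norm2 (M *m cur) <= 144 * norm2 cur.
  rewrite /M /prec_gram -mulmxA; have := (prec_opt_norm H) ((prec_op A T) *m cur).
  have := (prec_op_norm H) cur; clear; lra.
have hh1 : kap * g <= 1 / 1000 / 1000 by clear - hh; lra.
have g1 : g <= 1 / 1000 by clear - ggh hh1; lra.
have g11 : g <= 1 by clear - g1; lra.
have hy : kap * g * norm2 cur <= 1 / 1000 / 1000 * norm2 cur by apply: mul_ler.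
have h4 : norm2 t4 <= 150 * norm2 cur.
  have := norm2_near t4 (M *m cur); clear - e4' hM hy y0; lra.
have h5 : norm2 (c - t4) <= norm2 c + 150 * norm2 cur.
  have := norm2B c t4; clear - h4; lra.
have gr : g * norm2 (c - t4) <= 1 / 1000 * norm2 (c - t4).
  by apply: mul_ler => //; exact: norm2_ge0.
have h5g : g * norm2 (c - t4) <= g * (norm2 c + 150 * norm2 cur) by apply: mul_lel.
have hr : norm2 r <= 2 * (norm2 c + 150 * norm2 cur).
  have := norm2_near r (c - t4); have := norm2_ge0 (c - t4).
  clear - e5 gr h5 y0 c0; lra.
have r0 := norm2_ge0 r.
have gr2 : g * norm2 r <= g * (2 * (norm2 c + 150 * norm2 cur)) by apply: mul_lel.
have hres : norm2 (r - (c - M *m cur)) <=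
    80 * (100 * (kap * g)) * norm2 cur + g * (norm2 c + 150 * norm2 cur).
  have -> : r - (c - M *m cur) = (r - (c - t4)) - (t4 - M *m cur).
    by apply/matrixP => i j; rewrite !mxE; ring.
  apply: le_trans (norm2B _ _) _; clear - e4' e5 h5g; lra.
have har := scale_perturb al0 al1 gg0 g11 hah e6 hres.
have hal : norm2 (al *: (c - M *m cur)) <= norm2 c + 150 * norm2 cur.
  rewrite norm2Z -/(ab _) (ab_id al0).
  have : al * norm2 (c - M *m cur) <= 1 * norm2 (c - M *m cur).
    by apply: mul_ler => //; exact: norm2_ge0.
  have := norm2B c (M *m cur); clear - hM y0; lra.
have g2 : g * (norm2 c + 150 * norm2 cur) <= 1 / 1000 * (norm2 c + 150 * norm2 cur).
  by apply: mul_ler => //; clear - c0 y0; lra.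
have hary : norm2 ar <= 2 * (norm2 c + 150 * norm2 cur).
  have := norm2_near ar (al *: (c - M *m cur)).
  clear - har hal gr2 g2 hy c0 y0; lra.
have hcp := norm2B cur prev; have cp0 := norm2_ge0 (cur - prev).
have gcp : g * norm2 (cur - prev) <= g * (norm2 cur + norm2 prev) by apply: mul_lel.
have gcp1 : g * (norm2 cur + norm2 prev) <= 1 / 1000 * (norm2 cur + norm2 prev).
  by apply: mul_ler => //; clear - y0 p0; lra.
have hp : norm2 p <= 2 * (norm2 cur + norm2 prev).
  have := norm2_near p (cur - prev); clear - e7 gcp gcp1 hcp y0 p0; lra.
have gp : g * norm2 p <= g * (2 * (norm2 cur + norm2 prev)) by apply: mul_lel.
have hbp := scale_perturb be0 be1 gg0 g11 hbh e8 e7.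
have hbe : norm2 (be *: (cur - prev)) <= norm2 cur + norm2 prev.
  rewrite norm2Z -/(ab _) (ab_id be0).
  have : be * norm2 (cur - prev) <= 1 * norm2 (cur - prev) by apply: mul_ler.
  clear - hcp; lra.
have hbpn : norm2 bp <= 2 * (norm2 cur + norm2 prev).
  have := norm2_near bp (be *: (cur - prev)).
  clear - hbe hbp gp gcp gcp1 y0 p0; lra.
have hs1 := norm2D cur ar.
have gs1 : g * norm2 (cur + ar) <= g * (norm2 cur + 2 * (norm2 c + 150 * norm2 cur)).
  by apply: mul_lel => //; clear - hs1 hary; lra.
have hsm : norm2 sm <= 2 * norm2 cur + 3 * (norm2 c + 150 * norm2 cur).
  have : g * norm2 (cur + ar) <= 1 / 1000 * norm2 (cur + ar).
    by apply: mul_ler => //; exact: norm2_ge0.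
  have := norm2_near sm (cur + ar); clear - e9 hs1 hary c0 y0; lra.
have hs2 := norm2D sm bp.
have gs2 : g * norm2 (sm + bp) <= g * (2 * norm2 cur + 3 * (norm2 c + 150 * norm2 cur) + 2 * (norm2 cur + norm2 prev)).
  by apply: mul_lel => //; clear - hs2 hsm hbpn; lra.
have -> : nx - (cur + al *: (c - M *m cur) + be *: (cur - prev)) =
  (nx - (sm + bp)) + ((sm - (cur + ar)) + ((ar - al *: (c - M *m cur)) + (bp - be *: (cur - prev)))).
  by apply/matrixP => i j; rewrite !mxE; ring.
have d1 := norm2D (nx - (sm + bp)) ((sm - (cur + ar)) + ((ar - al *: (c - M *m cur)) + (bp - be *: (cur - prev)))).
have d2 := norm2D (sm - (cur + ar)) ((ar - al *: (c - M *m cur)) + (bp - be *: (cur - prev))).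
have d3 := norm2D (ar - al *: (c - M *m cur)) (bp - be *: (cur - prev)).
have x1 : g * norm2 c <= kap * g * norm2 c by apply: mul_ler.
have x2 : g * norm2 cur <= kap * g * norm2 cur by apply: mul_ler.
have x3 : g * norm2 prev <= kap * g * norm2 prev by apply: mul_ler.
have x4 := mul_ge0 hh0 c0; have x5 := mul_ge0 hh0 y0; have x6 := mul_ge0 hh0 p0.
clear - d1 d2 d3 x1 x2 x3 x4 x5 x6 e9 e10 gs1 gs2 har hbp gr2 gp gcp.
lra.
Qed.


End Preconditioner.

(** * One refinement step *)

Section Refinement.
Context {R : realType}.

(** The solution of [T^-T A^T A T^-1 y = c], written without the inverse of [T]. *)
Definition prec_sol m n (A : 'M[R]_(m, n)) (T : 'M[R]_n) (c : 'cV[R]_n) : 'cV[R]_n :=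
  T *m (invmx (A^T *m A) *m (T^T *m c)).

Lemma prec_sol_norm m n (A : 'M[R]_(m, n)) (T : 'M[R]_n) (kap s : R)
    (H : precond A T kap s) c : norm2 (prec_sol A T c) <= 4 * norm2 c.
Proof.
have := prec_gram_inv_norm H (prec_sol A T c).
by rewrite /prec_sol (prec_gram_inv H).
Qed.

(** The errors of the iterates form a run of the perturbed heavy-ball recurrence,
    because the exact solution is a fixed point of the exact iteration. They start
    from at most [5 |c|], since the first iterate is [c] itself. *)
Lemma polyak_err m n (A : 'M[R]_(m, n)) (T : 'M[R]_n) (kap s u g : R)
    (H : precond A T kap s) (Hr : rounding A T u g)
    (eta ah bh : R) (q : nat) c dy k :
  0 < eta -> eta <= 9 / 10 -> s <= eta + kap * g -> 0 < g ->
  100 * 100 * 100 * (1100 * (100 * (kap * g))) <= 1 / 1000 ->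
  ab (ah - polyak_alpha eta) <= g -> ab (bh - polyak_beta eta) <= g ->
  inflated eta ^+ q.-1 <= (kap * g) ^+ 2 -> (3 <= q)%N ->
  polyakP u A T ah bh q c dy k ->
  norm2 (dy - prec_sol A T c) <=
    500 * (30 * (kap * g + 1100 * (100 * (kap * g)))) * norm2 c.
Proof.
move=> eta0 eta1 hs g0 hsm hah hbh hq q3 [[cur prev] [k1 [k2 [hit [-> _] _]]]] /=.
have [w [w0 wq wS]] := iterP_seq hit.
have hh0 := rnd_h0 H Hr.
have k1' := prec_kap1 H.
have hp : 0 < kap * g by apply: mulr_gt0 => //; clear - k1'; lra.
have hsm' : kap * g <= 1 / 1000 / 1000 by clear - hsm hp; lra.
set eps := 1100 * (100 * (kap * g)) in hsm *.
have eps0 : 0 < eps by rewrite /eps; clear - hp; lra.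
have s_eps : s <= eta + eps by rewrite /eps; clear - hs hp; lra.
set e := inflated eta in hq.
have Ee : e = 101 / 100 * eta by [].
have e0 : 0 <= e by clear - Ee eta0; lra.
have e1 : e <= 1 by clear - Ee eta1; lra.
have be0 : 0 <= polyak_beta eta by rewrite /polyak_beta sqr_ge0.
have be1 : polyak_beta eta <= 1 by rewrite /polyak_beta exprn_ile1.
have al0 : 0 <= polyak_alpha eta by rewrite /polyak_alpha sqr_ge0.
have al1 : polyak_alpha eta <= 1.
  rewrite /polyak_alpha -/(polyak_beta eta) exprn_ile1 //.
    by clear - be1; lra.
  by clear - be0; lra.
pose ys := prec_sol A T c.
have Mys : prec_gram A T *m ys = c by exact: (prec_gram_inv H).
have nys : norm2 ys <= 4 * norm2 c by exact: prec_sol_norm H c.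
pose z i := ((w i).1 - ys, (w i).2 - ys).
have c0 := norm2_ge0 c.
have hz0 : norm2 (c - ys) <= 5 * norm2 c by have := norm2B c ys; clear - nys; lra.
have hrun : hb_run (prec_gram A T) e eps (norm2 c) q.-1 z.
  move=> i /wS [a]; rewrite /z; case: (w i) => cu pr; case: (w i.+1) => nx cu' st /=.
  have [-> hst] := polyak_step_err H Hr hsm' al0 al1 be0 be1 hah hbh st.
  split => //.
  have -> : nx - ys - (hbmx (prec_gram A T) e *m (cu - ys) - e ^+ 2 *: (pr - ys)) =
     nx - (cu + polyak_alpha eta *: (c - prec_gram A T *m cu) + polyak_beta eta *: (cu - pr)).
    rewrite -{1}Mys -mulmxBr /hbmx mulmxBl mul_scalar_mx -scalemxAl -[ys - cu]opprB mulmxN.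
    rewrite /polyak_alpha /polyak_beta -/e.
    by move: (prec_gram A T *m (cu - ys)) => Z; apply/matrixP => a' b'; rewrite !mxE; ring.
  apply: le_trans hst _.
  have h1 := norm2_near cu ys; have h2 := norm2_near pr ys.
  have h3 : norm2 cu + norm2 pr + norm2 c <= 9 * (norm2 (cu - ys) + norm2 (pr - ys) + norm2 c).
    have := norm2_ge0 (cu - ys); have := norm2_ge0 (pr - ys); clear - h1 h2 nys c0; lra.
  apply: (@le_trans _ _ (120 * (100 * (kap * g)) * (9 * (norm2 (cu - ys) + norm2 (pr - ys) + norm2 c)))).
    by apply: mul_lel => //; clear - hp; lra.
  have h4 : 0 <= norm2 (cu - ys) + norm2 (pr - ys) + norm2 c by rewrite !addr_ge0 ?norm2_ge0.
  have := mul_ge0 hh0 h4; rewrite /eps; clear; set X := _ + norm2 c; set hh := kap * g; lra.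
have p2 : (2 <= q.-1)%N by rewrite -subn1 leq_subRL // (leq_trans _ q3).
have := @hb_conv R n (prec_gram A T) eta s e eps (kap * g) (norm2 c) q.-1 z
  (prec_gram_sym A T) eta0 eta1 Ee (prec_s0 H) s_eps eps0 hsm (prec_gram_lo H) (prec_gram_hi H) c0 hrun.
rewrite /z w0 wq /= -/ys => /(_ hz0 hz0 hh0 hq p2).
move=> h; apply: le_trans h _; rewrite le_eqVlt; apply/orP; left; apply/eqP.
by clear; move: (norm2 c) => C; move: (kap * g) => hh; ring.
Qed.

(** The errors of the product with [A^T] and of the transposed solve perturb the
    right-hand side of the normal equations and make up [w]. All others are
    transformed by [A] or by [T^-1] before they reach the new iterate, and make up
    [h]; the error of the inner solver is among them. *)
Lemma refineP_err m n (A : 'M[R]_(m, n)) (T : 'M[R]_n) (kap s u g ep : R)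
    (H : precond A T kap s) (Hr : rounding A T u g)
    (ah bh : R) (q : nat) b x x1 x2 k :
  (forall c dy k', polyakP u A T ah bh q c dy k' ->
     norm2 (dy - prec_sol A T c) <= ep * norm2 c) ->
  120 * (kap * g) <= ep -> 100 * (100 * ep) <= 1 / 10 ->
  A^T *m (b - A *m x) = 0 ->
  refineP u A b T ah bh q x1 x2 k ->
  exists w h : 'cV[R]_n,
    [/\ x2 - x = invmx (A^T *m A) *m w + h,
      norm2 w <= g * (3 * norm2 (b - A *m x) + 400 * norm2 (T *m (x - x1)) + 110 * (g * norm2 x1)) &
      norm2 (A *m h) <= 3 * g * norm2 x1 + 2 * g * norm2 x2 + 2 * g * norm2 (b - A *m x)
        + 24 * 100 * ep * (kap * g) * norm2 (b - A *m x)
        + 100 * (100 * ep) * norm2 (T *m (x - x1))].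
Proof.
move=> hpol hep ep1 hx.
case=> Ax [k1 [k1' [/(rnd_mulA Hr) e1 [r [k2 [k2' [/(subvP_rel Hr) e2 [gv [k3 [k3' [/(rnd_mulAt Hr) e3]]]]]]]]]]].
case=> [c [k4 [k4' [/(rnd_solvet Hr) e4 [dy [k5 [k5' [/hpol e5 [dx [k6 [k6' [e6' /(addvP_rel Hr) e7]]]]]]]]]]]].
move=> _ _ _ _ _ _.
have gg0 := rnd_g0 Hr; have hh0 := rnd_h0 H Hr; have ggh := rnd_gh H Hr; have kk := prec_kap0 H.
have ep0 : 0 <= ep by clear - hep hh0; lra.
have hsm : kap * g <= 1 / 1000 / 1000 by clear - hep ep1 hh0; lra.
have g1 : g <= 1 / 1000 / 1000 by clear - hsm ggh; lra.
have [_ e6] := solve_norm H Hr hsm e6'.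
set rho := norm2 (b - A *m x); set e := norm2 (T *m (x - x1)); set X := norm2 x1.
have rho0 : 0 <= rho := norm2_ge0 _; have ee0 : 0 <= e := norm2_ge0 _; have X0 : 0 <= X := norm2_ge0 _.
have small a : 0 <= a -> g * a <= 1 / 1000 / 1000 * a by move=> a0; apply: mul_ler.
have small' a : 0 <= a -> kap * g * a <= 1 / 1000 / 1000 * a by move=> a0; apply: mul_ler.
pose r1 := b - A *m x1.
have nr1 : norm2 r1 <= rho + 12 * e.
  have -> : r1 = (b - A *m x) + A *m (x - x1) by rewrite /r1 mulmxBr addrA subrK.
  apply: le_trans (norm2D _ _) _; have := prec_A H (x - x1); rewrite -/e -/rho; clear; lra.
pose d := r - r1.
have nd : norm2 d <= 2 * g * (X + rho + 12 * e).
  have h1 : norm2 (b - Ax) <= norm2 r1 + g * X.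
    apply: le_trans (norm2_near _ r1) _; rewrite lerD2l.
    have -> : b - Ax - r1 = - (Ax - A *m x1).
      by rewrite /r1 !opprB addrC addrA subrK.
    by rewrite norm2N.
  have h2 : norm2 d <= g * norm2 (b - Ax) + g * X.
    have -> : d = (r - (b - Ax)) - (Ax - A *m x1).
      by rewrite -addrA -opprD addrA subrK.
    by apply: le_trans (norm2B _ _) _; apply: lerD.
  have h3 := mul_lel gg0 h1; have h4 := mul_lel gg0 nr1.
  have h5 := mul_lel gg0 (small X X0); have h6 := mul_ge0 gg0 X0.
  have h7 := mul_ge0 gg0 rho0; have h8 := mul_ge0 gg0 ee0.
  clear - h2 h3 h4 h5 h6 h7 h8; lra.
have nr : norm2 r <= 2 * rho + 24 * e + 2 * g * X.
  have Er : r = r1 + d by rewrite /d addrC subrK.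
  have := norm2D r1 d; rewrite -Er.
  have := small rho rho0; have := small e ee0; clear - nr1 nd rho0 ee0; lra.
(* [d] is the error of the residual, [w] that of the two transposed operations *)
pose w := (gv - A^T *m r) + (T^T *m c - gv).
have Ec : T^T *m c = A^T *m (A *m (x - x1)) + (A^T *m d + w).
  have -> : A^T *m (A *m (x - x1)) = A^T *m r1.
    by rewrite /r1 -[RHS]subr0 -hx -mulmxBr; congr (_ *m _); rewrite mulmxBr opprB [RHS]addrC addrA subrK.
  rewrite addrA -mulmxDr [r1 + d]addrC subrK /w.
  by rewrite addrA (addrC (A^T *m r)) subrK addrC subrK.
have nc0 := norm2_ge0 c.
have nw : norm2 w <= g * norm2 r + g * norm2 c.
  by apply: le_trans (norm2D _ _) _; apply: lerD.
have nc : norm2 c <= 300 * e + 100 * g * X + 100 * (kap * g) * rho.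
  have Ec' : c = (prec_op A T)^T *m (A *m (x - x1) + d) + invmx T^T *m w.
    rewrite -prec_opt_E -mulmxDr (mulmxDr A^T) -addrA -Ec.
    by rewrite mulKmx // unitmx_tr (prec_unit H).
  have h1 := norm2D ((prec_op A T)^T *m (A *m (x - x1) + d)) (invmx T^T *m w).
  rewrite -Ec' in h1.
  have h2 := prec_opt_norm H (A *m (x - x1) + d).
  have h3 := norm2D (A *m (x - x1)) d.
  have h4 := prec_A H (x - x1); rewrite -/e in h4.
  have h5 := prec_invt_norm H w; have h6 := mul_lel kk nw.
  have h7 := small' _ nc0.
  have h8 := mul_lel hh0 nr.
  have h9 := small' _ ee0.
  have h10 := mul_lel gg0 (small' X X0).
  have h11 := small _ ee0.
  have h12 : g * rho <= kap * g * rho by apply: mul_ler.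
  have h13 := mul_ge0 gg0 X0; have h14 := mul_ge0 hh0 rho0.
  have h6' : kap * norm2 w <= kap * g * norm2 r + kap * g * norm2 c.
    by apply: le_trans h6 _; rewrite mulrDr !mulrA.
  clear - h1 h2 h3 h4 h5 h6' h7 h8 h9 h10 h11 h12 h13 h14 nd ee0 nc0.
  lra.
pose f5 := T *m dx - dy.
pose f4 := dy - prec_sol A T c.
pose f6 := x2 - (x1 + dx).
pose gi := invmx (A^T *m A).
pose h := gi *m (A^T *m d) + (invmx T *m (f4 + f5) + f6).
have Edx : dx = gi *m (T^T *m c) + invmx T *m (f4 + f5).
  have -> : f4 + f5 = T *m (dx - gi *m (T^T *m c)).
    rewrite mulmxBr /f4 /f5 /prec_sol -/gi addrC addrA subrK.
    by [].
  by rewrite mulKmx ?(prec_unit H) // addrC subrK.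
have Ex2 : x2 - x = gi *m w + h.
  have -> : x2 = x1 + dx + f6 by rewrite /f6 addrC subrK.
  have EgTc : gi *m (T^T *m c) = (x - x1) + (gi *m (A^T *m d) + gi *m w).
    by rewrite Ec (mulmxDr gi) (mulmxDr gi (A^T *m d)) (mulmxA A^T) /gi mulKmx ?(gram_unit H).
  rewrite Edx EgTc /h.
  clearbody f6; move: (gi *m w) (gi *m (A^T *m d)) (invmx T *m (f4 + f5)) => p1 p2 p3.
  by apply/matrixP => i j; rewrite !mxE; ring.
exists w, h; split => //.
  have h1 := mul_lel gg0 nr; have h2 := mul_lel gg0 nc.
  have h4 := mul_lel gg0 (small' _ rho0).
  have h5 := mul_ge0 gg0 (mul_ge0 gg0 X0); have h6 := mul_ge0 gg0 rho0; have h7 := mul_ge0 gg0 ee0.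
  clear - nw h1 h2 h4 h5 h6 h7; lra.
have nf4 : norm2 f4 <= ep * norm2 c by exact: e5.
have ndy : norm2 dy <= 5 * norm2 c.
  have := norm2_near dy (prec_sol A T c); have := prec_sol_norm H c.
  have : ep * norm2 c <= 1 * norm2 c by apply: mul_ler => //; clear - ep1 ep0; lra.
  rewrite -/f4; clear - nf4; lra.
have nf5 : norm2 f5 <= ep * norm2 c.
  apply: le_trans e6 _; apply: (@le_trans _ _ (24 * (kap * g) * (5 * norm2 c))).
    by apply: mul_lel => //; clear - hh0; lra.
  by have := mul_ler nc0 hep; clear; lra.
have nf6 : norm2 f6 <= 2 * (g * norm2 x2).
  have h1 := norm2_near (x1 + dx) x2; rewrite norm2C -/f6 in h1.
  have h2 : norm2 f6 <= g * norm2 (x1 + dx) := e7.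
  have h3 := mul_lel gg0 h1.
  have h4 := small _ (norm2_ge0 f6).
  have h5 := norm2_ge0 f6.
  clear - h2 h3 h4 h5; lra.
have EAh : A *m h = A *m (gi *m (A^T *m d)) + (prec_op A T *m (f4 + f5) + A *m f6).
  by rewrite /h (mulmxDr A) (mulmxDr A (invmx T *m (f4 + f5))) /prec_op -(mulmxA A (invmx T)).
rewrite EAh.
have h1 := norm2D (A *m (gi *m (A^T *m d))) (prec_op A T *m (f4 + f5) + A *m f6).
have h2 := norm2D (prec_op A T *m (f4 + f5)) (A *m f6).
have h3 := gram_solve_A H d; rewrite -/gi in h3.
have h4 := prec_op_norm H (f4 + f5).
have h5 := norm2D f4 f5.
have h6 := precA1 H f6.
have h7 := mul_lel ep0 nc.
have h8 : 24 * (100 * (ep * (g * X))) <= g * X.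
  have gX := mul_ge0 gg0 X0.
  have : 24 * 100 * ep * (g * X) <= 1 * (g * X).
    by apply: mul_ler => //; clear - ep1; lra.
  clear; lra.
have h9 : g * e <= ep * e by apply: mul_ler => //; clear - hep ggh hh0; lra.
have h10 := mul_ge0 ep0 ee0.
clear - h1 h2 h3 h4 h5 h6 h7 h8 h9 h10 nd nf4 nf5 nf6.
lra.
Qed.

End Refinement.

(** * Backward error of an approximate least-squares solution *)

Section BackwardError.
Context {R : realType}.

Lemma normal_argmin m n (A : 'M[R]_(m, n)) b x :
  A^T *m (b - A *m x) = 0 -> is_argmin A b x.
Proof.
move=> h z; rewrite -ler_sqr ?nnegrE ?norm2_ge0 // !norm2_sqE.
have -> : b - A *m z = (b - A *m x) + A *m (x - z) by rewrite mulmxBr addrA subrK.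
set r := b - A *m x in h *.
have h1 : dot r (A *m (x - z)) = 0 by rewrite dot_adj h dot0l.
clearbody r; rewrite !(dotDl, dotDr) [dot (A *m _) r]dotC h1.
have := dot_ge0 (A *m (x - z)); lra.
Qed.

(** Otherwise a short step along [A^T r] would decrease the residual. *)
Lemma argmin_normal m n (A : 'M[R]_(m, n)) b x :
  is_argmin A b x -> A^T *m (b - A *m x) = 0.
Proof.
move=> h; set r := b - A *m x in h *; set y := A^T *m r.
apply/eqP; rewrite -dot_eq0; apply/eqP/le_anti; rewrite dot_ge0 andbT.
set Y := dot y y; have Y0 : 0 <= Y := dot_ge0 y.
pose c := dot (A *m y) (A *m y); have c0 : 0 <= c := dot_ge0 _.
pose t := Y / (c + 1).
have c1 : 0 < c + 1 by lra.
have tc : t * (c + 1) = Y by rewrite /t mulfVK // gt_eqF.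
have t0 : 0 <= t by rewrite divr_ge0 // ltW.
have h1 := h (x + t *: y); rewrite -ler_sqr ?nnegrE ?norm2_ge0 // !norm2_sqE -/r in h1.
have E1 : b - A *m (x + t *: y) = r - t *: (A *m y).
  by rewrite mulmxDr -scalemxAr opprD addrA.
have ry : dot r (A *m y) = Y by rewrite dot_adj.
have E2 (a a' : 'cV[R]_m) : dot (a - a') (a - a') = dot a a - 2 * dot a a' + dot a' a'.
  by rewrite !(dotDl, dotDr, dotNl, dotNr) [dot a' a]dotC; ring.
rewrite E1 (E2 r (t *: (A *m y))) !(dotZl, dotZr) ry -/c in h1.
have h3 : 2 * (t * Y) <= t * (t * c) by clear - h1; lra.
have [tz|tn] := eqVneq t 0; first by rewrite -tc tz mul0r.
have tp : 0 < t by rewrite lt_def tn.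
have h4 : 2 * Y <= t * c by apply: (le_mul2l tp); lra.
lra.
Qed.

Lemma backward_error_le m n (A DA : 'M[R]_(m, n)) b xh :
  is_argmin (A + DA) b xh -> backward_error A b xh <= normF DA.
Proof.
move=> h; apply: ge_inf; last by exists DA.
by exists 0 => _ [D _ <-]; exact: normF_ge0.
Qed.

Lemma outer_apply m n (a : 'cV[R]_m) (y z : 'cV[R]_n) :
  a *m y^T *m z = dot y z *: a.
Proof.
rewrite -mulmxA; have -> : y^T *m z = (dot y z)%:M.
  by apply/matrixP => i j; rewrite (ord1 i) (ord1 j) [RHS]mxE eqxx.
by rewrite mul_mx_scalar.
Qed.

(** A rank-one perturbation of [A] that maps [xh] to [- A h] removes the part [A h]
    of the residual; the new residual [r']
    satisfies [A^T r' = - w] and [|r'| >= |b - A x|], and a second rank-one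
    perturbation along [r'] makes it orthogonal to the range. *)
Lemma backward_error_split m n (A : 'M[R]_(m, n)) b x xh w h (a c : R) :
  A^T *m A \in unitmx -> A^T *m (b - A *m x) = 0 ->
  xh - x = invmx (A^T *m A) *m w + h -> 0 <= a -> 0 <= c ->
  norm2 w <= a * norm2 (b - A *m x) -> norm2 (A *m h) <= c * norm2 xh ->
  backward_error A b xh <= a + 2 * c.
Proof.
move=> uA hx hxh a0 c0 hw hh.
set r := b - A *m x in hx hw *; set v := invmx (A^T *m A) *m w in hxh.
have Ev : A^T *m (A *m v) = w by rewrite /v mulmxA mulKVmx.
pose r' := r - A *m v.
have Atr' : A^T *m r' = - w by rewrite /r' mulmxBr hx Ev sub0r.
have nr' : norm2 r <= norm2 r'.
  rewrite -ler_sqr ?nnegrE ?norm2_ge0 // !norm2_sqE /r'.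
  have h1 : dot r (A *m v) = 0 by rewrite dot_adj hx dot0l.
  clearbody r; rewrite !(dotDl, dotDr, dotNl, dotNr) [dot (A *m v) r]dotC h1.
  have := dot_ge0 (A *m v); lra.
pose E2 := - ((norm2 xh ^+ 2)^-1 *: (A *m h *m xh^T)).
have E2x : E2 *m xh = - (A *m h).
  rewrite /E2 mulNmx -scalemxAl outer_apply scalerA -norm2_sqE.
  have [xz|xn] := eqVneq (norm2 xh) 0; last by rewrite mulVf ?scale1r // sqrf_eq0.
  have : norm2 (A *m h) == 0 by rewrite eq_le norm2_ge0 andbT; move: hh; rewrite xz mulr0.
  by rewrite norm2_eq0 => /eqP ->; rewrite scaler0.
have nE2 : normF E2 <= c.
  rewrite /E2 normFN normFZ normF_outer -/(ab _) ab_id ?invr_ge0 ?sqr_ge0 //.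
  have [xz|xn] := eqVneq (norm2 xh) 0; first by rewrite xz !mulr0.
  have xp : 0 < norm2 xh by rewrite lt_def xn norm2_ge0.
  rewrite mulrC ler_pdivrMr ?exprn_gt0 // expr2 mulrA.
  by apply: mul_ler => //; exact: ltW.
have res2 : b - (A + E2) *m xh = r'.
  rewrite mulmxDl E2x; have -> : xh = x + (v + h) by rewrite -hxh addrC subrK.
  rewrite !mulmxDr /r' /r; move: (A *m x) (A *m v) (A *m h) => p1 p2 p3.
  by apply/matrixP => i j; rewrite !mxE; ring.
pose A2 := A + E2; pose y := A2^T *m r'.
have ny : norm2 y <= (a + c) * norm2 r'.
  rewrite /y /A2 [(A + E2)^T]linearD /= mulmxDl Atr'; apply: le_trans (norm2D _ _) _.
  rewrite norm2N mulrDl; apply: lerD.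
    by apply: le_trans hw _; apply: mul_lel.
  apply: le_trans (norm2_mul _ _) _; rewrite normF_tr.
  by apply: mul_ler => //; exact: norm2_ge0.
pose E1 := - ((norm2 r' ^+ 2)^-1 *: (r' *m y^T)).
have r'y : norm2 r' = 0 -> y = 0.
  by move=> /eqP; rewrite norm2_eq0 => /eqP rz; rewrite /y rz mulmx0.
have nE1 : normF E1 <= a + c.
  rewrite /E1 normFN normFZ normF_outer -/(ab _) ab_id ?invr_ge0 ?sqr_ge0 //.
  have [xz|xn] := eqVneq (norm2 r') 0; first by rewrite xz mul0r mulr0 addr_ge0.
  have xp : 0 < norm2 r' by rewrite lt_def xn norm2_ge0.
  rewrite mulrC ler_pdivrMr ?exprn_gt0 // mulrC expr2 mulrA.
  by apply: mul_ler => //; exact: ltW.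
have E1t : E1^T *m r' = - y.
  rewrite /E1 linearN /= linearZ /= trmx_mul trmxK mulNmx -scalemxAl outer_apply scalerA -norm2_sqE.
  have [xz|xn] := eqVneq (norm2 r') 0; first by rewrite (r'y xz) scaler0.
  by rewrite mulVf ?scale1r // sqrf_eq0.
have hfin : is_argmin (A + (E2 + E1)) b xh.
  apply: normal_argmin.
  have -> : b - (A + (E2 + E1)) *m xh = (1 + (norm2 r' ^+ 2)^-1 * dot y xh) *: r'.
    rewrite addrA mulmxDl opprD addrA res2 /E1 mulNmx opprK -scalemxAl outer_apply.
    by rewrite scalerA scalerDl scale1r.
  rewrite -scalemxAr addrA [(A + E2 + E1)^T]linearD /= mulmxDl E1t -/y subrr.
  by rewrite scaler0.
apply: le_trans (backward_error_le hfin) _.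
apply: le_trans (normFD _ _) _; lra.
Qed.

End BackwardError.

(** * Two refinement steps *)

Section Combination.
Context {R : realType}.

(** The error of an iterate contracts by a multiple of [ep] down to the level
    [kap g |b - A x| + g |x|] of forward stability. *)
Lemma refine_contract m n (A : 'M[R]_(m, n)) (T : 'M[R]_n) (kap s u g ep : R)
    (H : precond A T kap s) (Hr : rounding A T u g) b x x1 x2 w h :
  120 * (kap * g) <= ep -> 100 * (100 * ep) <= 1 / 10 ->
  x2 - x = invmx (A^T *m A) *m w + h ->
  norm2 w <= g * (3 * norm2 (b - A *m x) + 400 * norm2 (T *m (x - x1)) + 110 * (g * norm2 x1)) ->
  norm2 (A *m h) <= 3 * g * norm2 x1 + 2 * g * norm2 x2 + 2 * g * norm2 (b - A *m x)
        + 24 * 100 * ep * (kap * g) * norm2 (b - A *m x)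
        + 100 * (100 * ep) * norm2 (T *m (x - x1)) ->
  norm2 (T *m (x - x2)) <= 22 * (kap * g * norm2 (b - A *m x) + g * norm2 x)
    + 600 * (100 * ep) * norm2 (T *m (x - x1)).
Proof.
move=> hep ep1 hx2 hw hh.
have gg0 := rnd_g0 Hr; have hh0 := rnd_h0 H Hr; have ggh := rnd_gh H Hr; have kk := prec_kap0 H.
have t1 : norm2 (T *m (x - x2)) <= 2 * (kap * norm2 w + norm2 (A *m h)).
  apply: le_trans (prec_T H _) _; apply: mul_lel => //.
  have -> : A *m (x - x2) = - (A *m (invmx (A^T *m A) *m w) + A *m h).
    by rewrite -mulmxDr -hx2 -mulmxN opprB.
  rewrite norm2N; apply: le_trans (norm2D _ _) _; apply: lerD => //.
  exact: gram_solve_w H w.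
have px (z : 'cV[R]_n) : norm2 z <= norm2 x + 12 * (kap * norm2 (T *m (x - z))).
  have := norm2_near z x; rewrite norm2C; have := prec_x H (x - z); clear; lra.
have p1 := px x1; have p2 := px x2.
set e := norm2 (T *m (x - x1)) in hw hh p1 *; set e' := norm2 (T *m (x - x2)) in t1 p2 *.
set rho := norm2 (b - A *m x) in hw hh *; set X1 := norm2 x1 in hw hh p1.
set X2 := norm2 x2 in hh p2; set xi := norm2 x in p1 p2 *.
have rho0 : 0 <= rho := norm2_ge0 _; have ee0 : 0 <= e := norm2_ge0 _.
have e'0 : 0 <= e' := norm2_ge0 _; have X10 : 0 <= X1 := norm2_ge0 _; have xi0 : 0 <= xi := norm2_ge0 _.
have q1 := mul_lel gg0 p1; have q2 := mul_lel gg0 p2; have q3 := mul_lel kk hw.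
have gX := mul_ge0 gg0 X10.
set hq := kap * g in hep hh0 ggh hh *.
have hq1 : hq <= 1 / 1000 / 1000 by clear - hep ep1 hh0; lra.
have q3' : kap * norm2 w <= hq * (3 * rho + 400 * e + 110 * (g * X1)).
  by apply: le_trans q3 _; rewrite mulrA.
have q4 : hq * (g * X1) <= 1 / 1000 / 1000 * (g * X1) by apply: mul_ler.
have q5 : g * rho <= hq * rho by apply: mul_ler.
have q6 : hq * e' <= 1 / 1000 / 1000 * e' by apply: mul_ler.
have q7 : 120 * hq * e <= ep * e by apply: mul_ler.
have hr := mul_ge0 hh0 rho0; have gxi := mul_ge0 gg0 xi0.
have epe : 0 <= ep * e by apply: mul_ge0 => //; clear - hep hh0; lra.
have q8 : 24 * 100 * ep * (hq * rho) <= 1 * (hq * rho).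
  by apply: mul_ler => //; clear - ep1; lra.
have q1' : g * X1 <= g * xi + 12 * (hq * e) by move: q1; rewrite /hq; clear; lra.
have q2' : g * X2 <= g * xi + 12 * (hq * e') by move: q2; rewrite /hq; clear; lra.
clear - t1 q3' hh q4 q5 q6 q7 q8 q1' q2' hr gxi epe e'0.
lra.
Qed.

(** After the second step the error is split for [backward_error_split] according
    to the sizes of the residual, of the solution and of the rounding level. If the
    residual is longer than the solution, then all errors are counted as errors of
    the normal equations. If it is shorter than [g |x|], then all of them are moved
    to the range of [A], at the price of a factor [kap] that is harmless for such a
    small residual. In between, the split of [refineP_err] is used as it is. *)
Lemma two_steps_backward m n (A : 'M[R]_(m, n)) (T : 'M[R]_n) (kap s u g K C1 cB L : R)
    (H : precond A T kap s) (Hr : rounding A T u g)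
    (ah bh : R) (q : nat) b x x0 x1 x2 k k' :
  120 <= K -> C1 = 22 + 600 * (100 * (30 * K)) ->
  1000 * (1000 * (1000 * (K * C1))) * (kap * g) <= 1 ->
  (forall c dy k', polyakP u A T ah bh q c dy k' ->
     norm2 (dy - prec_sol A T c) <= K * (kap * g) * norm2 c) ->
  A^T *m (b - A *m x) = 0 ->
  norm2 (T *m (x - x0)) <= 30 * (norm2 (b - A *m x) + g * norm2 x) ->
  refineP u A b T ah bh q x0 x1 k -> refineP u A b T ah bh q x1 x2 k' ->
  1 <= cB -> 1 <= L -> g <= L * u ->
  norm2 x + kap * (norm2 x + kap * norm2 (b - A *m x)) * u <= cB * norm2 x2 ->
  backward_error A b x2 <=
    g * (20 + 1400 * (C1 * cB) + 14 * cB + 2 * (200 * (100 * (K * C1)) * (L * cB))).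
Proof.
move=> K1 EC1 hZ hpol hx he0 hr1 hr2 cB1 L1 gL hB.
have gg0 := rnd_g0 Hr; have hh0 := rnd_h0 H Hr; have ggh := rnd_gh H Hr; have kk := prec_kap0 H.
have uu0 := rnd_u0 Hr.
set hq := kap * g in hZ hh0 ggh hpol *.
have C10 : 600 * 100 * 30 * K <= C1 by rewrite EC1; clear; lra.
have C11 : 1000 <= C1 by clear - C10 K1; lra.
have KC : 0 <= K * C1 by apply: mul_ge0; clear - K1 C11; lra.
have KC1 : K * 1000 <= K * C1 by apply: mul_lel => //; clear - K1; lra.
have KC2 : 120 * C1 <= K * C1 by apply: mul_ler => //; clear - C11; lra.
have hKC : 1000 * (1000 * (1000 * (K * C1 * hq))) <= 1 by clear - hZ; lra.
have hK := mul_ler hh0 KC1; have hC := mul_ler hh0 KC2.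
set ep := K * hq in hpol.
have ep0 : 0 <= ep by rewrite /ep; apply: mul_ge0 => //; clear - K1; lra.
have hep : 120 * hq <= ep by apply: mul_ler.
have ep1 : 100 * (100 * ep) <= 1 / 10 by rewrite /ep; clear - hKC hK; lra.
have hq1 : hq <= 1 / 1000 / 1000.
  have hep' : 120 * hq <= K * hq := hep.
  clear - hep' hK hKC hh0; lra.
have [w1 [v1 [Ex1 nw1 nv1]]] := refineP_err H Hr hpol hep ep1 hx hr1.
have [w2 [v2 [Ex2 nw2 nv2]]] := refineP_err H Hr hpol hep ep1 hx hr2.
have e1 := refine_contract H Hr hep ep1 Ex1 nw1 nv1.
have px (z : 'cV[R]_n) : norm2 z <= norm2 x + 12 * (kap * norm2 (T *m (x - z))).
  have := norm2_near z x; rewrite norm2C; have := prec_x H (x - z); clear; lra.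
have p1 := mul_lel gg0 (px x1).
clear nw1 nv1 Ex1 px hr1 hr2.
rewrite -/hq in e1 nv2.
set rho := norm2 (b - A *m x) in he0 e1 nw2 nv2 hB *; set xi := norm2 x in he0 e1 p1 hB *.
set e0 := norm2 (T *m (x - x0)) in he0 e1; set ee := norm2 (T *m (x - x1)) in e1 nw2 nv2 p1.
set X1 := norm2 x1 in nw2 nv2 p1; set X2 := norm2 x2 in nv2 hB *.
have rho0 : 0 <= rho := norm2_ge0 _; have xi0 : 0 <= xi := norm2_ge0 _.
have ee0 : 0 <= ee := norm2_ge0 _; have X20 : 0 <= X2 := norm2_ge0 _.
have hr := mul_ge0 hh0 rho0; have gxi := mul_ge0 gg0 xi0.
have p1' : g * X1 <= g * xi + 12 * (hq * ee) by move: p1; rewrite /hq; clear; lra.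
have he1 : ee <= C1 * (hq * rho + g * xi).
  have z1 : ep * e0 <= ep * (30 * (rho + g * xi)) by apply: mul_lel.
  have z2 : K * hq * (g * xi) <= K * 1 * (g * xi).
    by apply: mul_ler => //; apply: mul_lel; clear - K1 hq1; lra.
  have Z : C1 * (hq * rho + g * xi) = 22 * (hq * rho + g * xi) + 600 * (100 * (30 * (K * hq * rho + K * 1 * (g * xi)))).
    by rewrite EC1; ring.
  rewrite Z; clear - z1 z2 e1; rewrite /ep in z1 e1; lra.
pose Q := hq * (hq * rho).
have Q0 : 0 <= Q by apply: mul_ge0.
have C1h : 1000 * (1000 * (C1 * hq)) <= 1 by clear - hKC hC; lra.
have C1h0 : 0 <= C1 * hq by apply: mul_ge0 => //; clear - C11; lra.
have nw : norm2 w2 <= g * (4 * rho + 700 * (C1 * (g * xi))).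
  apply: le_trans nw2 _; apply: mul_lel => //.
  have z1 : hq * ee <= 1 * ee by apply: mul_ler => //; clear - hq1; lra.
  have z2 : C1 * hq * rho <= 1 / 1000 / 1000 * rho by apply: mul_ler => //; clear - C1h; lra.
  have z3 : 1000 * (g * xi) <= C1 * (g * xi) by apply: mul_ler.
  have z4 : 400 * ee + 110 * (12 * (hq * ee)) <= 500 * ee.
    have : hq * ee <= 1 / 100 * ee by apply: mul_ler => //; clear - hq1; lra.
    clear - ee0; lra.
  clear - z2 z3 z4 p1' he1 rho0 gxi; lra.
have nv : norm2 (A *m v2) <= 5 * (g * xi) + 2 * (g * X2) + 2 * (g * rho) + 200 * (100 * (K * C1)) * Q.
  have z1 : hq * ee <= C1 * Q + C1 * hq * (g * xi).
    have := mul_lel hh0 he1; rewrite /Q; clear; lra.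
  have z2 : C1 * hq * (g * xi) <= 1 / 1000 * (g * xi) by apply: mul_ler => //; clear - C1h; lra.
  have z3 : ep * (hq * rho) = K * Q by rewrite /ep /Q; ring.
  have z4 : ep * ee <= K * C1 * Q + K * C1 * hq * (g * xi).
    have := mul_lel ep0 he1; rewrite /Q /ep; clear; lra.
  have z5 : K * C1 * hq * (g * xi) <= 1 / 1000 / 1000 * (g * xi) by apply: mul_ler => //; clear - hKC; lra.
  have z6 := mul_ler Q0 KC1; have z7 := mul_ler Q0 KC2; have z8 := mul_ge0 KC Q0.
  have z3' : 24 * 100 * ep * hq * rho = 24 * 100 * (K * Q) by rewrite -z3; ring.
  rewrite z3' in nv2.
  clear - nv2 p1' z1 z2 z4 z5 z6 z7 z8 gxi Q0; lra.
have hB1 : xi <= cB * X2.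
  apply: le_trans hB; rewrite lerDl; apply: mul_ge0 => //; apply: mul_ge0 => //.
  by apply: addr_ge0 => //; exact: mul_ge0.
have cBX : 0 <= cB * X2 := le_trans xi0 hB1.
(* the only use of the full lower bound on the computed solution *)
have hQ : Q <= g * (L * (cB * X2)).
  have z1 : kap * (kap * rho) * u <= cB * X2.
    apply: le_trans hB; have := mul_ge0 (mul_ge0 kk xi0) uu0; clear - xi0; lra.
  have z2 : 0 <= kap * (kap * rho) by rewrite !mul_ge0.
  have z3 : kap * (kap * rho) * g <= kap * (kap * rho) * (L * u) by apply: mul_lel.
  have z4 : L * (kap * (kap * rho) * u) <= L * (cB * X2) by apply: mul_lel => //; clear - L1; lra.
  have -> : Q = g * (kap * (kap * rho) * g) by rewrite /Q /hq; ring.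
  apply: mul_lel => //; clear - z3 z4; lra.
have gx := mul_lel gg0 hB1.
pose D := 200 * (100 * (K * C1)) * (L * cB).
have D0 : 0 <= D.
  by rewrite /D; apply: mul_ge0; [|apply: mul_ge0]; clear - KC cB1 L1; lra.
have nv' : norm2 (A *m v2) <= g * ((5 * cB + 2 + D) * X2) + 2 * (g * rho).
  have KC' : 0 <= 200 * (100 * (K * C1)) by clear - KC; lra.
  have := mul_lel KC' hQ; rewrite /D; clear - nv gx; lra.
have cB0 : 0 <= cB by clear - cB1; lra.
have C1B : C1 * 1 <= C1 * cB by apply: mul_lel => //; clear - C11; lra.
have uA := gram_unit H.
have gD : 0 <= g * D by apply: mul_ge0.
have g1 : g <= 1 by clear - ggh hq1; lra.
pose F := 20 + 1400 * (C1 * cB) + 14 * cB + 2 * D.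
rewrite -/D -/F; clear nv nw2 nv2 p1 p1' he1 he0 e1.
have [case1|case1] := ltP X2 rho.
  have hw : norm2 (w2 + A^T *m (A *m v2)) <= (g * (6 + 700 * (C1 * cB) + (5 * cB + 2 + D))) * rho.
    have z1 : norm2 (A^T *m (A *m v2)) <= 1 * norm2 (A *m v2).
      by apply: norm2_adj => // y; rewrite mul1r; exact: precA1 H y.
    have z2 : g * (C1 * (g * xi)) <= g * (C1 * (cB * rho)).
      apply: mul_lel => //; apply: mul_lel; first by clear - C11; lra.
      apply: (@le_trans _ _ (1 * xi)); first by apply: mul_ler.
      rewrite mul1r; apply: le_trans hB1 _; apply: mul_lel => //; exact: ltW.
    have z3 : g * ((5 * cB + 2 + D) * X2) <= g * ((5 * cB + 2 + D) * rho).
      by apply: mul_lel => //; apply: mul_lel; [clear - cB0 D0; lra|exact: ltW].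
    have := norm2D w2 (A^T *m (A *m v2)).
    clear - nw nv' z1 z2 z3; lra.
  have Ex : x2 - x = invmx (A^T *m A) *m (w2 + A^T *m (A *m v2)) + 0.
    by rewrite addr0 mulmxDr [A^T *m (A *m v2)]mulmxA mulKmx.
  have hA0 : norm2 (A *m (0 : 'cV[R]_n)) <= 0 * norm2 x2 by rewrite mulmx0 norm2_0 mul0r.
  have a0 : 0 <= g * (6 + 700 * (C1 * cB) + (5 * cB + 2 + D)).
    by apply: (mul_ge0 gg0); clearbody D; clear - C1B C11 cB0 D0; lra.
  apply: le_trans (backward_error_split uA hx Ex a0 (lexx 0) hw hA0) _.
  rewrite mulr0 addr0; apply: (mul_lel gg0); rewrite /F; clearbody D; clear - C1B C11 cB0 D0; lra.
have nv3 : norm2 (A *m v2) <= g * (5 * cB + 4 + D) * X2.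
  have := mul_lel gg0 case1; clear - nv'; lra.
have [case2|case2] := leP (g * xi) rho.
  have hw : norm2 w2 <= (g * (4 + 700 * C1)) * rho.
    have : g * (C1 * (g * xi)) <= g * (C1 * rho).
      by apply: mul_lel => //; apply: mul_lel => //; clear - C11; lra.
    clear - nw; lra.
  have a0 : 0 <= g * (4 + 700 * C1) by apply: (mul_ge0 gg0); clear - C11; lra.
  have c0 : 0 <= g * (5 * cB + 4 + D) by apply: (mul_ge0 gg0); clearbody D; clear - cB0 D0; lra.
  apply: le_trans (backward_error_split uA hx Ex2 a0 c0 hw nv3) _.
  have -> : g * (4 + 700 * C1) + 2 * (g * (5 * cB + 4 + D)) = g * (12 + 700 * C1 + 10 * cB + 2 * D).
    by ring.
  by apply: (mul_lel gg0); rewrite /F; clearbody D; clear - C1B C11 cB0 D0; lra.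
have Ex : x2 - x = invmx (A^T *m A) *m 0 + (invmx (A^T *m A) *m w2 + v2).
  by rewrite mulmx0 add0r.
have h0 : norm2 (0 : 'cV[R]_n) <= 0 * norm2 (b - A *m x) by rewrite norm2_0 mul0r.
have c0 : 0 <= g * (6 * cB + 4 + D) by apply: (mul_ge0 gg0); clearbody D; clear - cB0 D0; lra.
have hh : norm2 (A *m (invmx (A^T *m A) *m w2 + v2)) <= g * (6 * cB + 4 + D) * norm2 x2.
  rewrite mulmxDr; apply: le_trans (norm2D _ _) _.
  have z1 := gram_solve_w H w2.
  have z2 : kap * norm2 w2 <= hq * (4 * rho + 700 * (C1 * (g * xi))).
    by have := mul_lel kk nw; rewrite /hq mulrA.
  have z3 : hq * rho <= hq * (g * xi) by apply: mul_lel => //; exact: ltW.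
  have z4 : C1 * hq * (g * xi) <= 1 / 1000 / 1000 * (g * xi) by apply: mul_ler => //; clear - C1h; lra.
  have z5 : hq * (g * xi) <= 1 / 1000 * (g * xi) by apply: mul_ler => //; clear - hq1; lra.
  rewrite -/X2; clear - z1 z2 z3 z4 z5 nv3 gx gxi; lra.
apply: le_trans (backward_error_split uA hx Ex (lexx 0) c0 h0 hh) _.
rewrite add0r mulrCA; apply: (mul_lel gg0); rewrite /F; clearbody D; clear - C1B C11 cB0 D0; lra.
Qed.

End Combination.

(** * Preconditioner and starting point obtained from the sketch *)

Section Instance.
Context {R : realType}.

Lemma sketch_vec d m n (S : 'M[R]_(d, m)) (A : 'M[R]_(m, n)) (b : 'cV[R]_m) (eta : R) :
  sketching S (row_mx A b) eta -> forall y z,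
  (1 - eta) * norm2 (A *m y + z *: b) <= norm2 (S *m (A *m y + z *: b)) /\
  norm2 (S *m (A *m y + z *: b)) <= (1 + eta) * norm2 (A *m y + z *: b).
Proof.
case=> _ h y z; have := h (col_mx y z%:M).
rewrite -mulmxA mul_row_col mul_mx_scalar => /andP[]; by split.
Qed.

Lemma lb_dim d n (B : 'M[R]_(d, n)) (c : R) : 0 < c ->
  (forall y, c * norm2 y <= norm2 (B *m y)) -> (n <= d)%N.
Proof.
move=> c0 h; have : row_free B^T.
  rewrite -kermx_eq0; apply/eqP/row_matrixP => i; rewrite row0.
  set v := row i _; have vB : v *m B^T = 0 by rewrite -row_mul mulmx_ker row0.
  have : norm2 v^T <= 0.
    rewrite -(pmulr_rle0 _ c0); apply: le_trans (h _) _.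
    by rewrite -[B]trmxK -trmx_mul vB trmx0 norm2_0.
  move=> h'; have : norm2 v^T == 0 by rewrite eq_le h' norm2_ge0.
  by rewrite norm2_eq0 => /eqP /(congr1 trmx); rewrite trmxK trmx0.
by rewrite /row_free => /eqP <-; exact: rank_leq_col.
Qed.

Lemma upper_unit_diag n (T : 'M[R]_n) : T \in unitmx ->
  (forall i j : 'I_n, (j < i)%N -> T i j = 0) -> forall i, T i i != 0.
Proof.
move=> uT up i; have trig : is_trig_mx T^T.
  by apply/is_trig_mxP => a b ab; rewrite mxE up.
move: uT; rewrite unitmxE unitfE -det_tr det_trig // => /prodf_neq0 /(_ i isT).
by rewrite mxE.
Qed.

(** The polynomial in the dimensions comes from the number of operations in a row
    and from passing to Frobenius norms. *)
Lemma rounding_intro m n (A : 'M[R]_(m, n)) (T : 'M[R]_n) (u N : R) :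
  0 <= u -> 1 <= N -> m%:R <= N -> n%:R <= N -> 100 * N * u <= 1 ->
  opnorm A = 1 -> T \in unitmx -> (forall y, norm2 (T *m y) <= 2 * norm2 y) ->
  (forall i j : 'I_n, (j < i)%N -> T i j = 0) ->
  rounding A T u (40 * N ^+ 2 * u).
Proof.
move=> u0 N1 mN nN hs A1 uT T2 up.
have Nu : 0 <= N * u by apply: mul_ge0 => //; clear - N1; lra.
have N0 : 0 <= N by clear - N1; lra.
have g_of k (l : R) : 0 <= l -> l <= 3 -> k%:R <= l * N -> gam u k <= 2 * (l * N * u).
  move=> l0 l1 kN; have h : k%:R * u <= l * N * u by apply: mul_ler.
  have h2 : l * (N * u) <= 3 * (N * u) by apply: mul_ler.
  have h3 : k%:R * u <= 1 / 2 by clear - h h2 hs; lra.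
  by have := gam_lin u0 h3; clear - h; lra.
have gn : gam u n <= 2 * (N * u) by have := g_of n 1 ler01 ltac:(lra) ltac:(rewrite mul1r; exact: nN); clear; lra.
have gm : gam u m <= 2 * (N * u) by have := g_of m 1 ler01 ltac:(lra) ltac:(rewrite mul1r; exact: mN); clear; lra.
have gn1 : gam u n.+1 <= 4 * (N * u).
  have h : n.+1%:R <= 2 * N by rewrite -natr1; clear - nN N1; lra.
  by have := g_of n.+1 2 ltac:(lra) ltac:(lra) h; clear; lra.
have nA : normF A <= N.
  by apply: le_trans (normF_le_opnorm A) _; rewrite A1 mulr1.
have nT : normF T <= N * 2.
  apply: le_trans (normF_le_opnorm T) _; apply: mul_le => //; first exact: opnorm_ge0.
  by apply: opnorm_le.
have gn12 : gam u n.+1 <= 1 / 2 by clear - gn1 hs; lra.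
have diag := upper_unit_diag uT up.
have Enorm (E : 'M[R]_n) : (forall i j, `|E i j| <= 4 * gam u n.+1 * `|T i j|) -> normF E <= 40 * N ^+ 2 * u.
  move=> hE; have g40 : 0 <= 4 * gam u n.+1 by apply: mul_ge0 => //; exact: gam_ge0.
  apply: le_trans (normF_entry_le g40 hE) _.
  have : 4 * gam u n.+1 * normF T <= 4 * (4 * (N * u)) * (N * 2).
    apply: mul_le => //; first exact: normF_ge0.
    by clear - gn1; lra.
  have := mul_ge0 N0 Nu; clear; lra.
have NNu := mul_ge0 N0 Nu.
split => //.
- have : 1 * u <= N * u by apply: mul_ler.
  have : 1 * (N * u) <= N * (N * u) by apply: mul_ler.
  clear - Nu; lra.
- move=> x y k /(mulvP_err u0) /le_trans; apply; apply: mul_ler; first exact: norm2_ge0.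
  have : gam u n * normF A <= 2 * (N * u) * N by apply: mul_le => //; [exact: gam_ge0|exact: normF_ge0].
  clear - NNu; lra.
- move=> x y k /(mulvP_err u0) /le_trans; apply; apply: mul_ler; first exact: norm2_ge0.
  have : gam u m * normF A^T <= 2 * (N * u) * N.
    by rewrite normF_tr; apply: mul_le => //; [exact: gam_ge0|exact: normF_ge0].
  clear - NNu; lra.
- move=> c z k /(solveP_back u0) /(_ gn12 diag up) [E hE <-].
  rewrite mulmxDl opprD addrA subrr add0r norm2N.
  apply: le_trans (norm2_mul _ _) _; apply: mul_ler; [exact: norm2_ge0|exact: Enorm].
- move=> c z k /(solvetP_back u0) /(_ gn12 diag up) [E hE <-].
  rewrite linearD /= mulmxDl opprD addrA subrr add0r norm2N.
  apply: le_trans (norm2_mul _ _) _; rewrite normF_tr.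
  by apply: mul_ler; [exact: norm2_ge0|exact: Enorm].
Qed.

Lemma rounding_le m n (A : 'M[R]_(m, n)) (T : 'M[R]_n) (u g g' : R) :
  rounding A T u g -> g <= g' -> rounding A T u g'.
Proof.
case=> h1 h2 h3 h4 h5 h6 gg; split => //; first exact: le_trans gg.
all: move=> x y k H.
- by apply: le_trans (h3 _ _ _ H) _; apply: mul_ler => //; exact: norm2_ge0.
- by apply: le_trans (h4 _ _ _ H) _; apply: mul_ler => //; exact: norm2_ge0.
- by apply: le_trans (h5 _ _ _ H) _; apply: mul_ler => //; exact: norm2_ge0.
- by apply: le_trans (h6 _ _ _ H) _; apply: mul_ler => //; exact: norm2_ge0.
Qed.

(** The iteration count makes the initial error of the inner solver, which is
    multiplied by [sqrt e] at each step, smaller than [kap u]. *)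
Lemma q0_power (kap u eta : R) (q : nat) : 0 < eta -> eta <= 9 / 10 -> 0 < kap * u ->
  polyak_q0 kap u eta <= q%:R ->
  inflated eta ^+ q.-1 <= (kap * u) ^+ 2 /\ (3 <= q)%N.
Proof.
move=> eta0 eta1 ku; rewrite /polyak_q0 ge_max => /andP[h1 h2].
have q3 : (3 <= q)%N by rewrite -(ler_nat R); apply: le_trans h2; rewrite ler_nat.
split => //.
have Ee : inflated eta = 101 / 100 * eta by [].
set e := inflated eta in Ee h1 *.
have e0 : 0 < e by clear - Ee eta0; lra.
have e1 : e < 1 by clear - Ee eta1; lra.
have le1 : 0 < ln (1 / e) by rewrite ln_gt0 // div1r invf_gt1.
rewrite -ler_ln ?posrE ?exprn_gt0 //.
rewrite !lnXn //.
have E1 : ln (1 / e) = - ln e by rewrite div1r lnV.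
have E2 : ln (1 / (kap * u)) = - ln (kap * u) by rewrite div1r lnV.
have Eq : q%:R = q.-1%:R + 1 :> R by rewrite natr1 prednK // (leq_trans _ q3).
move: h1; rewrite Eq addrC lerD2r mulrA ler_pdivrMr // E1 E2.
move=> h; rewrite -[leLHS]mulr_natl -[leRHS]mulr_natl; set t := q.-1%:R in h *; clear - h; lra.
Qed.

Lemma norm2_mulF_le m n (A : 'M[R]_(m, n)) x (a c : R) : normF A <= a -> norm2 x <= c ->
  norm2 (A *m x) <= a * c.
Proof.
move=> h1 h2; apply: le_trans (norm2_mul _ _) _.
by apply: mul_le => //; [exact: normF_ge0|exact: norm2_ge0].
Qed.

(** As [|T y|] is nearly [|S A y|], the distortion of the sketch is that of [T], up
    to [kap g]. Up to rounding errors, [T (x - x0)] is [- Q^T S (b - A x)], which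
    has the order of the residual because [S] also embeds [b]. *)
Lemma fossils_start d m n (S : 'M[R]_(d, m)) (A : 'M[R]_(m, n)) (b : 'cV[R]_m)
    (x : 'cV[R]_n) (u eta kap N : R) SA Sb Q T y0 x0 k1 k2 k3 :
  1 <= N -> m%:R <= N -> n%:R <= N -> d%:R <= N -> 0 <= u ->
  opnorm A = 1 -> norm2 b = 1 -> 1 <= kap ->
  (forall y, norm2 y <= kap * norm2 (A *m y)) ->
  1000 * (1000 * (1000 * N ^+ 3 * (kap * u))) <= 1 ->
  eta <= 9 / 10 -> sketching S (row_mx A b) eta ->
  opnorm (SA - S *m A) <= N * u -> norm2 (Sb - S *m b) <= N * u ->
  qrP u SA (Q, T) k1 -> mulvP u Q^T Sb y0 k2 -> solveP u T y0 x0 k3 ->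
  let g := 1000 * N ^+ 3 * u in
  [/\ precond A T kap (eta + kap * g), rounding A T u g &
      norm2 (T *m (x - x0)) <= 30 * (norm2 (b - A *m x) + g * norm2 x)].
Proof.
move=> N1 mN nN dN u0 A1 b1 kap1 Ak hs eta1 hS hSA hSb hqr hy0 hx0 g.
have [/andP[eta0 _] _] := hS.
have sk := sketch_vec hS.
have N0 : 0 <= N by clear - N1; lra.
have k0 : 0 <= kap by clear - kap1; lra.
have uku : u <= kap * u by rewrite -{1}[u]mul1r; apply: mul_ler.
pose v := N * u; have v0 : 0 <= v by apply: mul_ge0.
have N2 : 1 <= N ^+ 2 by rewrite exprn_ege1.
have N3 : 1 <= N ^+ 3 by rewrite exprn_ege1.
have gE : g = 1000 * (N * (N * v)) by rewrite /g /v; ring.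
have Nv0 : 0 <= N * v by apply: mul_ge0.
have NNv0 : 0 <= N * (N * v) by apply: mul_ge0.
have vNv : v <= N * v by rewrite -{1}[v]mul1r; apply: mul_ler.
have NvNNv : N * v <= N * (N * v) by apply: mul_lel.
have uv : u <= v by rewrite -{1}[u]mul1r; apply: mul_ler.
have g0 : 0 <= g by rewrite gE; clear - NNv0; lra.
have gk : g <= kap * g by rewrite -{1}[g]mul1r; apply: mul_ler.
have hk : kap * g <= 1 / 1000 / 1000.
  have -> : kap * g = 1000 * N ^+ 3 * (kap * u) by rewrite /g; ring.
  by clear - hs; lra.
clearbody g.
have NNv1 : N * (N * v) <= 1 / 1000 / 1000 / 1000 by clear - gE gk hk; lra.
have Al y : norm2 (A *m y) <= norm2 y by have := opnormP A y; rewrite A1 mul1r.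
have skA y : (1 - eta) * norm2 (A *m y) <= norm2 (S *m (A *m y)) /\
    norm2 (S *m (A *m y)) <= (1 + eta) * norm2 (A *m y).
  by have := sk y 0; rewrite scale0r addr0.
have hSAy y : norm2 (SA *m y - S *m (A *m y)) <= v * norm2 y.
  rewrite mulmxA -mulmxBl; apply: le_trans (opnormP _ _) _.
  by apply: mul_ler; [exact: norm2_ge0|exact: hSA].
have kv : kap * v <= 1 / 1000 / 1000.
  by have := mul_lel k0 vNv; have := mul_lel k0 NvNNv; move: hk; rewrite gE; clear; lra.
have nd : (n <= d)%N.
  apply: (@lb_dim d n (S *m A) (1 / 100 / kap)).
    by rewrite divr_gt0 //; clear - kap1; lra.
  move=> y; rewrite -mulmxA; have [h1 _] := skA y.
  have h2 : 1 / 100 * norm2 (A *m y) <= (1 - eta) * norm2 (A *m y).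
    by apply: mul_ler; [exact: norm2_ge0|clear - eta1; lra].
  apply: le_trans h1; apply: le_trans h2.
  rewrite mulrAC ler_pdivrMr ?(lt_le_trans ltr01) //.
  by have := Ak y; clear; lra.
have d1 : d.+1%:R * u <= 2 * v.
  have : d.+1%:R <= 2 * N by rewrite -natr1; clear - dN N1; lra.
  by move=> h; rewrite /v mulrA; apply: mul_ler.
have hG : gam u d.+1 <= 4 * v.
  have h : d.+1%:R * u <= 1 / 2 by clear - d1 NNv1 vNv NvNNv; lra.
  by have := gam_lin u0 h; clear - d1; lra.
have G1 : 4 * v <= 1 / 100 by clear - NNv1 vNv NvNNv; lra.
have [up [Qt [QQ hQT hQQ]]] := qrP_back u0 hG G1 nd hqr.
have he : gam (40 * (4 * v)) n <= 320 * (N * v).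
  have h1 : n%:R * (40 * (4 * v)) <= N * (40 * (4 * v)) by apply: mul_ler => //; clear - v0; lra.
  have h2 : n%:R * (40 * (4 * v)) <= 1 / 2 by clear - h1 NNv1 NvNNv; lra.
  have h3 : 0 <= 40 * (4 * v) by clear - v0; lra.
  by have := gam_lin h3 h2; clear - h1; lra.
set e := gam _ _ in he hQT hQQ.
have e0 : 0 <= e by apply: gam_ge0; clear - v0; lra.
have nSA : normF SA <= N * 3.
  apply: le_trans (normF_le_opnorm SA) _; apply: mul_le => //; first exact: opnorm_ge0.
  apply: opnorm_le => // y.
  have h1 := norm2_near (SA *m y) (S *m (A *m y)); have h2 := hSAy y; have [_ h3] := skA y.
  have h4 := Al y; have y0' := norm2_ge0 y; have ay := norm2_ge0 (A *m y).
  have h5 : (1 + eta) * norm2 (A *m y) <= 19 / 10 * norm2 (A *m y).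
    by apply: mul_ler => //; clear - eta1; lra.
  have h6 : v * norm2 y <= 1 * norm2 y by apply: mul_ler => //; clear - NNv1 vNv NvNNv; lra.
  clear - h1 h2 h3 h4 h5 h6 y0'; lra.
have hF : normF (Qt *m T - SA) <= 960 * (N * (N * v)).
  apply: le_trans hQT _.
  have : e * normF SA <= 320 * (N * v) * (N * 3) by apply: mul_le => //; exact: normF_ge0.
  by clear; lra.
have QTS y : norm2 (Qt *m (T *m y) - S *m (A *m y)) <= g * norm2 y.
  have -> : Qt *m (T *m y) - S *m (A *m y) = (Qt *m T - SA) *m y + (SA *m y - S *m (A *m y)).
    by rewrite mulmxBl mulmxA addrA subrK.
  apply: le_trans (norm2D _ _) _.
  have h1 := norm2_mulF_le hF (lexx (norm2 y)); have h2 := hSAy y.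
  have h3 : v * norm2 y <= N * (N * v) * norm2 y.
    by apply: mul_ler; [exact: norm2_ge0|exact: le_trans NvNNv].
  rewrite gE; have := mul_ge0 NNv0 (norm2_ge0 y); clear - h1 h2 h3; lra.
have nTy y : norm2 (T *m y) = norm2 (Qt *m (T *m y)) by rewrite (norm2_orth _ QQ).
have gA y : g * norm2 y <= kap * g * norm2 (A *m y).
  by have := mul_lel g0 (Ak y); clear; lra.
have Tlo y : (1 - (eta + kap * g)) * norm2 (A *m y) <= norm2 (T *m y).
  rewrite nTy; have h1 := norm2_near (S *m (A *m y)) (Qt *m (T *m y)).
  rewrite norm2C in h1; have h2 := QTS y; have [h3 _] := skA y; have h4 := gA y.
  clear - h1 h2 h3 h4; lra.
have Thi y : norm2 (T *m y) <= (1 + (eta + kap * g)) * norm2 (A *m y).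
  rewrite nTy; have h1 := norm2_near (Qt *m (T *m y)) (S *m (A *m y)).
  have h2 := QTS y; have [_ h3] := skA y; have h4 := gA y.
  clear - h1 h2 h3 h4; lra.
have s0 : 0 <= eta + kap * g by apply: addr_ge0; [exact: ltW|exact: mul_ge0].
have s1 : eta + kap * g <= 91 / 100 by clear - eta1 hk; lra.
have H : precond A T kap (eta + kap * g) by [].
have Hr : rounding A T u g.
  have h100 : 100 * N * u <= 1 by rewrite -mulrA -/v; clear - NNv1 vNv NvNNv; lra.
  have T2 y : norm2 (T *m y) <= 2 * norm2 y.
    by apply: le_trans (prec_T H y) _; apply: mul_lel.
  apply: (rounding_le (rounding_intro u0 N1 mN nN h100 A1 (prec_unit H) T2 up)).
  rewrite gE; have -> : 40 * N ^+ 2 * u = 40 * (N * v) by rewrite /v; ring.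
  by clear - NvNNv NNv0; lra.
split => //.
set rho := norm2 (b - A *m x); set xi := norm2 x.
have rho0 : 0 <= rho := norm2_ge0 _; have xi0 : 0 <= xi := norm2_ge0 _.
have nb : 1 <= rho + xi.
  have := norm2_near b (A *m x); rewrite b1 -/rho; have := Al x; rewrite -/xi; clear; lra.
have Sr : norm2 (S *m (b - A *m x)) <= 2 * rho.
  have E : A *m (- x) + 1 *: b = b - A *m x by rewrite scale1r mulmxN addrC.
  have [_ h] := sk (- x) 1; rewrite E -/rho in h.
  apply: le_trans h _; apply: mul_ler => //; clear - eta1; lra.
have Sbn : norm2 (S *m b) <= 2.
  have := sk 0 1; rewrite mulmx0 add0r scale1r b1 mulr1 => -[_ h]; clear - h eta1; lra.
have Sbn' : norm2 Sb <= 3.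
  have := norm2_near Sb (S *m b); have := hSb; rewrite -/v; clear - Sbn NNv1 vNv NvNNv; lra.
have Qt_t z : norm2 (Qt^T *m z) <= norm2 z.
  have := @norm2_adj _ _ _ Qt 1 ler01 _ z; rewrite mul1r; apply => y.
  by rewrite (norm2_orth _ QQ) mul1r.
have nQt : normF Qt <= N.
  apply: le_trans (normF_le_opnorm Qt) _; rewrite -[leRHS]mulr1.
  apply: mul_le => //; first exact: opnorm_ge0.
  by apply: opnorm_le => // y; rewrite (norm2_orth _ QQ) mul1r.
have hQd : normF (Q - Qt) <= 320 * (N * (N * v)).
  apply: le_trans hQQ _.
  have : e * n%:R <= 320 * (N * v) * N by apply: mul_le.
  by clear; lra.
have nQ : normF Q <= N * 2.
  have := normFD (Q - Qt) Qt; rewrite subrK; clear - nQt hQd NNv1 N1; lra.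
pose f := y0 - Qt^T *m (S *m b).
have nf : norm2 f <= g.
  have -> : f = (y0 - Q^T *m Sb) + ((Q - Qt)^T *m Sb + Qt^T *m (Sb - S *m b)).
    rewrite /f linearB /= mulmxBl mulmxBr.
    move: (Q^T *m Sb) (Qt^T *m Sb) (Qt^T *m (S *m b)) => p1 p2 p3.
    by apply/matrixP => i j; rewrite !mxE; ring.
  have n1 := norm2D (y0 - Q^T *m Sb) ((Q - Qt)^T *m Sb + Qt^T *m (Sb - S *m b)).
  have n2 := norm2D ((Q - Qt)^T *m Sb) (Qt^T *m (Sb - S *m b)).
  have n3 := Qt_t (Sb - S *m b).
  have n4 : norm2 ((Q - Qt)^T *m Sb) <= 320 * (N * (N * v)) * 3.
    by apply: norm2_mulF_le => //; rewrite normF_tr.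
  have n5 : norm2 (y0 - Q^T *m Sb) <= 4 * v * (N * 2) * 3.
    apply: le_trans (mulvP_err u0 hy0) _; apply: mul_le => //; [|exact: norm2_ge0|].
      by apply: mul_ge0; [exact: gam_ge0|exact: normF_ge0].
    apply: mul_le; [exact: gam_ge0|exact: normF_ge0| |by rewrite normF_tr].
    by apply: le_trans hG; apply: gam_le.
  rewrite -/v in hSb; rewrite gE; clear - n1 n2 n3 n4 n5 hSb vNv NvNNv NNv0; lra.
have hx0' := rnd_solve Hr hx0.
have E0 : T *m (x - x0) = Qt^T *m (Qt *m (T *m x) - S *m (A *m x))
    - Qt^T *m (S *m (b - A *m x)) - f - (T *m x0 - y0).
  rewrite /f !mulmxBr (mulmxA Qt^T Qt) QQ mul1mx.
  move: (T *m x) (T *m x0) (Qt^T *m (S *m b)) (Qt^T *m (S *m (A *m x))) => p1 p2 p3 p4.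
  by apply/matrixP => i j; rewrite !mxE; ring.
have m1 := norm2B (Qt^T *m (Qt *m (T *m x) - S *m (A *m x)) - Qt^T *m (S *m (b - A *m x)) - f) (T *m x0 - y0).
have m2 := norm2B (Qt^T *m (Qt *m (T *m x) - S *m (A *m x)) - Qt^T *m (S *m (b - A *m x))) f.
have m3 := norm2B (Qt^T *m (Qt *m (T *m x) - S *m (A *m x))) (Qt^T *m (S *m (b - A *m x))).
rewrite -E0 in m1.
have m4 := Qt_t (Qt *m (T *m x) - S *m (A *m x)); have m5 := Qt_t (S *m (b - A *m x)).
have m6 := QTS x; rewrite -/xi in m6.
have m7 : norm2 x0 <= xi + 12 * (kap * norm2 (T *m (x - x0))).
  have := norm2_near x0 x; rewrite norm2C -/xi; have := prec_x H (x - x0); clear; lra.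
have m8 := mul_lel g0 m7.
have e0' := norm2_ge0 (T *m (x - x0)).
have m9 : kap * g * norm2 (T *m (x - x0)) <= 1 / 1000 * norm2 (T *m (x - x0)).
  by apply: mul_ler => //; clear - hk; lra.
have m10 := mul_lel g0 nb.
have m11 : g * rho <= 1 * rho by apply: mul_ler => //; clear - gk hk; lra.
have m12 := mul_ge0 g0 xi0.
clear - m1 m2 m3 m4 m5 m6 m8 m9 m10 m11 m12 nf Sr hx0' rho0.
lra.
Qed.

End Instance.

(** * Backward stability with explicit constants *)

Section Stability.
Context {R : realType}.

(** The relative error of the inner solver is [solver_const * (kap * g)], and the
    error after one refinement step is [forward_const] times the level of forward
    stability. *)
Definition solver_const : R := 500 * (30 * (1 + 1100 * 100)).
Definition forward_const : R := 22 + 600 * (100 * (30 * solver_const)).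

Lemma cond_ge1 m n (A : 'M[R]_(m, n)) : opnorm A = 1 -> 0 < sigma_min A -> 1 <= cond A.
Proof.
move=> A1 s0; have [n0|n0] := posnP n.
  have : opnorm A <= 0.
    apply: opnorm_le => // y; have -> : y = 0.
      by apply/matrixP => i; case: i => i hi; exfalso; rewrite n0 in hi.
    by rewrite mulmx0 !norm2_0 mulr0.
  by rewrite A1; lra.
pose y : 'cV[R]_n := delta_mx (Ordinal n0) 0.
have y1 : norm2 y = 1 by exact: norm2_delta.
have h1 := opnorm_le_cond y s0; have h2 := opnormP A y.
rewrite A1 y1 !mul1r in h1 h2.
have a0 := norm2_ge0 (A *m y); rewrite leNgt; apply/negP => c1.
have h3 := mul_ler a0 (ltW c1).
have a1 : norm2 (A *m y) = 1 by lra.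
by rewrite a1 in h1; lra.
Qed.

(** A single number [N] bounds the dimensions and all the prefactors of the
    hypotheses. *)
Lemma fossils_backward (m n d : nat) (A : 'M[R]_(m, n)) (b : 'cV[R]_m) (x : 'cV[R]_n)
    (u eta alpha beta N : R) (q : nat) (S : 'M[R]_(d, m))
    (mulS : forall p, 'M[R]_(m, p) -> prog 'M[R]_(d, p)) xhat ops :
  1 <= N -> m%:R <= N -> n%:R <= N -> d%:R <= N ->
  opnorm A = 1 -> norm2 b = 1 -> is_argmin A b x -> 0 < u ->
  sketching S (row_mx A b) eta -> eta <= 9 / 10 ->
  fossilsP u mulS A b alpha beta q xhat ops -> 0 < sigma_min A ->
  1000 * (1000 * (1000 * (solver_const * forward_const))) * (1000 * N ^+ 3 * (cond A * u)) <= 1 ->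
  norm2 x + cond A * (norm2 x + cond A * norm2 (b - A *m x)) * u <= N * norm2 xhat ->
  (forall SA k, mulS n A SA k -> opnorm (SA - S *m A) <= N * u) ->
  (forall Sb k, mulS 1%N b Sb k -> norm2 (Sb - S *m b) <= N * u) ->
  `|alpha - polyak_alpha eta| <= N * u -> `|beta - polyak_beta eta| <= N * u ->
  polyak_q0 (cond A) u eta <= q%:R ->
  backward_error A b xhat <= 1000 * N ^+ 3 * u *
    (20 + 1400 * (forward_const * N) + 14 * N
      + 2 * (200 * (100 * (solver_const * forward_const)) * (1000 * N ^+ 3 * N))).
Proof.
move=> N1 mN nN dN A1 b1 hx u0 hS eta1 hrun smin hZ hB hSA hSb hal hbe hq.
have [/andP[eta0 _] _] := hS.
have kap1 := cond_ge1 A1 smin.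
have Ak y : norm2 y <= cond A * norm2 (A *m y).
  by have := opnorm_le_cond y smin; rewrite A1 mul1r.
set kap := cond A in hZ hB hq kap1 Ak *.
have K1 : 120 <= solver_const by rewrite /solver_const; clear; lra.
have EC : forward_const = 22 + 600 * (100 * (30 * solver_const)) by [].
have EK : solver_const = 500 * (30 * (1 + 1100 * 100)) by [].
set K := solver_const in EC hZ K1 EK *; set C1 := forward_const in hZ EC *.
clearbody K C1.
have C11 : 1000 <= C1 by clear - EC K1; lra.
pose L := 1000 * N ^+ 3; pose g := L * u.
have u0' := ltW u0.
have N3 : 1 <= N ^+ 3 by rewrite exprn_ege1.
have L1 : 1 <= L by rewrite /L; clear - N3; lra.
have L0 : 0 <= L by clear - L1; lra.
have k0 : 0 <= kap by clear - kap1; lra.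
have g0 : 0 < g by apply: mulr_gt0 => //; clear - L1; lra.
have Eh : L * (kap * u) = kap * g by rewrite /g; ring.
rewrite -/L Eh in hZ.
have hh0 : 0 <= kap * g by apply: mul_ge0 => //; exact: ltW.
have KC : K * 1000 <= K * C1 by apply: mul_lel => //; clear - K1; lra.
have hh1 : 1000 * (1000 * (1000 * (K * 1000 * (kap * g)))) <= 1.
  by have := mul_ler hh0 KC; clear - hZ; lra.
have hsol : 100 * 100 * 100 * (1100 * (100 * (kap * g))) <= 1 / 1000.
  by rewrite EK in hh1; clear - hh1 hh0; lra.
have hstart : 1000 * (1000 * (1000 * N ^+ 3 * (kap * u))) <= 1.
  by rewrite -/L Eh; clear - hsol hh0; lra.
case: hrun => SA [k1 [k1' [h1 [[Q T] [k2 [k2' [h2 [Sb [k3 [k3' [h3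
  [y0 [k4 [k4' [h4 [x0 [k5 [k5' [h5 h6 _]]]] _]]]] _]]]] _]]]] _]]].
rewrite /= in h4 h5 h6.
have := fossils_start x N1 mN nN dN u0' A1 b1 kap1 Ak hstart eta1 hS (hSA _ _ h1) (hSb _ _ h3) h2 h4 h5.
move=> /=; rewrite -/L -/g => -[H Hr he0].
case: h6 => x1 [k6 [k6' [hr1 [x2 [k7 [k7' [hr2 [Ex _] _]]] _]]]].
rewrite Ex in hB *.
have ku : 0 < kap * u by apply: mulr_gt0 => //; clear - kap1; lra.
have [hp q3] := q0_power eta0 eta1 ku hq.
have hp' : inflated eta ^+ q.-1 <= (kap * g) ^+ 2.
  apply: le_trans hp _; rewrite ler_sqr ?nnegrE // ?(ltW ku) //.
  apply: mul_lel => //; rewrite /g -{1}[u]mul1r; exact: mul_ler.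
have Nug : N * u <= g.
  apply: mul_ler => //; have : N ^+ 1 <= N ^+ 3 by rewrite ler_weXn2l.
  by rewrite expr1 /L; clear - N1; lra.
have hpol c dy k' : polyakP u A T alpha beta q c dy k' ->
    norm2 (dy - prec_sol A T c) <= K * (kap * g) * norm2 c.
  move=> hd; have := polyak_err H Hr eta0 eta1 (lexx _) g0 hsol (le_trans hal Nug) (le_trans hbe Nug) hp' q3 hd.
  move=> h; apply: le_trans h _; rewrite EK le_eqVlt; apply/orP; left; apply/eqP.
  by clear; move: (norm2 c) (kap * g) => a1 a2; ring.
exact: (two_steps_backward H Hr K1 EC hZ hpol (argmin_normal hx) he0 hr1 hr2 N1 L1 (lexx g) hB).
Qed.

End Stability.

(** * Operation counts *)

Section OperationCount.
Context {R : realType}.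
Variable u : R.
Hypothesis u0 : 0 <= u.

Lemma foldP_count (T U : Type) (f : U -> T -> prog U) (b : nat) :
  (forall y x y' k, f y x y' k -> (k <= b)%N) ->
  forall s y y' k, foldP f y s y' k -> (k <= size s * b)%N.
Proof.
move=> hb; elim=> [|x s IH] y y' k /=; first by case=> _ ->.
by case=> y1 [k1 [k2 [h1 /IH h2 ->]]]; rewrite mulSn leq_add // (hb _ _ _ _ h1).
Qed.

Lemma iterP_count (T : Type) (f : T -> prog T) (b : nat) :
  (forall x y k, f x y k -> (k <= b)%N) ->
  forall p x y k, iterP p f x y k -> (k <= p * b)%N.
Proof.
move=> hb; elim=> [|p IH] x y k /=; first by case=> _ ->.
by case=> x1 [k1 [k2 [h1 /IH h2 ->]]]; rewrite mulSn leq_add // (hb _ _ _ h1).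
Qed.

Lemma dotP_rows_count d k (f g : 'I_d -> R) t c :
  dotP u (rows_from d k) f g t c -> (c <= 2 * d)%N.
Proof.
move=> /(dotP_theta u0) /(_ (enum_uniqS _)) [h _]; apply: leq_trans h _.
by rewrite leq_mul2l size_enumS orbT.
Qed.

Lemma reflectP_count d (y : 'cV[R]_d) h y' c :
  reflectP u y h y' c -> (c <= 4 * d + 1)%N.
Proof.
case: h => [[k v] tau] [t [c1 [c2 [/dotP_rows_count h1 [s [c3 [c4 [/fl_count -> h2 ->]]]] ->]]]].
have : (c4 <= d * 1 * 2)%N.
  apply: (entriesP_count h2) => i j x a; case: ifP => _.
    by case=> p [a1 [a2 [/fl_count -> /fl_count -> ->]]].
  by case=> _ ->.
move: h1; clear; lia.
Qed.

Lemma hqr_stepP_count d n st (k : 'I_n) st' c :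
  @hqr_stepP R u d n st k st' c ->
  (c <= 5 * d + 2 + n * (4 * d + 1))%N /\ size st'.2 = (size st.2).+1.
Proof.
case: st => W hs [xx [c1 [c1' [h1 [sg [c2 [c2' [/fl_count -> [v [c3 [c3' [h3
  [vv [c4 [c4' [h4 [tau [c5 [c5' [/fl_count -> [W' [c6 [c6' [h6 [-> ->] ->]]]] ->]]]]
  ->]]]] ->]]]] ->]]]] ->]]]].
split; last by rewrite /= size_rcons.
have {}h1 := dotP_rows_count h1; have {}h4 := dotP_rows_count h4.
have e3 : (c3 <= d * 1 * 1)%N.
  apply: (entriesP_count h3) => i j x a; case: ifP => _; first by case=> _ ->.
  by case: ifP => _; [move/fl_count=> ->|case=> _ ->].
have e6 : (c6 <= n * (4 * d + 1))%N.
  apply: (columnsP_count h6) => j x a; case: ifP => _; first by case=> _ ->.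
  by case: ifP => _; [case=> _ ->|exact: reflectP_count].
move: h1 h4 e3 e6; clear; set a := (n * (4 * d + 1))%N; lia.
Qed.

Lemma qrP_count d n (B : 'M[R]_(d, n)) QT c :
  qrP u B QT c ->
  (c <= n * (5 * d + 2 + n * (4 * d + 1)) + n * (n * (4 * d + 1)))%N.
Proof.
case=> st [c1 [c2 [h1 [Q [c3 [c4 [h3 [_ ->] ->]]]] ->]]].
have hs : size st.2 = n.
  have := @foldP_enum n _ (@hqr_stepP R u d n) (fun k s => size s.2 = k) (B, [::]) st c1 _ _ h1.
  by apply => // k s s' a <- /hqr_stepP_count [].
have e1 : (c1 <= n * (5 * d + 2 + n * (4 * d + 1)))%N.
  have := foldP_count _ h1; rewrite size_enum_ord; apply => y x y' k.
  by case/hqr_stepP_count.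
have e3 : (c3 <= n * (n * (4 * d + 1)))%N.
  apply: (columnsP_count h3) => j x a h.
  rewrite -{1}hs -size_rev; apply: (foldP_count _ h) => y r y' k; exact: reflectP_count.
by rewrite addn0 leq_add.
Qed.

Lemma polyak_stepP_count m n (A : 'M[R]_(m, n)) T al be c dy dy' k : (n <= m)%N -> (0 < n)%N ->
  polyak_stepP u A T al be c dy dy' k -> (k <= 16 * (m * n))%N.
Proof.
move=> nm n0; case: dy => cur prev.
case=> [t1 [k1 [k1' [/(substP_count u0) e1 [t2 [k2 [k2' [/(mulvP_count u0) e2 [t3 [k3 [k3' [/(mulvP_count u0) e3 [t4 [k4 [k4' [/(substP_count u0) e4 [r [k5 [k5' [/subvP_count e5 [ar [k6 [k6' [/scalevP_count e6 [p [k7 [k7' [/subvP_count e7 [bp [k8 [k8' [/scalevP_count e8 [sm [k9 [k9' [/addvP_count e9 [nx [k10 [k10' [/addvP_count e10 [_ ->] ->]]]] ->]]]] ->]]]] ->]]]] ->]]]] ->]]]] ->]]]] ->]]]] ->]]]] ->]]]].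
have nn : (n * n <= m * n)%N by rewrite leq_mul2r nm orbT.
have n1 : (n <= n * n)%N by rewrite leq_pmull.
move: e1 e2 e3 e4 e5 e6 e7 e8 e9 e10 nn n1; clear.
have -> : (n * (2 * n + 1) = 2 * (n * n) + n)%N by ring.
have -> : (m * (2 * n) = 2 * (m * n))%N by ring.
have -> : (n * (2 * m) = 2 * (m * n))%N by ring.
by set a := (n * n)%N; set b := (m * n)%N; lia.
Qed.

Lemma refineP_count m n (A : 'M[R]_(m, n)) b T al be q x y k :
  (n <= m)%N -> (0 < n)%N -> (0 < q)%N ->
  refineP u A b T al be q x y k -> (k <= 28 * (m * n * q))%N.
Proof.
move=> nm n0 q0.
case=> [Ax [k1 [k1' [/(mulvP_count u0) e1 [r [k2 [k2' [/subvP_count e2 [gv [k3 [k3' [/(mulvP_count u0) e3 [c [k4 [k4' [/(substP_count u0) e4 [dy [k5 [k5' [h5 [dx [k6 [k6' [/(substP_count u0) e6 /addvP_count e7 ->]]]] ->]]]] ->]]]] ->]]]] ->]]]] ->]]]].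
have e5 : (k5 <= q.-1 * (16 * (m * n)))%N.
  case: h5 => st [a1 [a2 [h [_ ->] ->]]]; rewrite addn0.
  by apply: (iterP_count _ h) => s s' a; exact: polyak_stepP_count.
have nn : (n * n <= m * n)%N by rewrite leq_mul2r nm orbT.
have n1 : (n <= n * n)%N by rewrite leq_pmull.
have m1 : (m <= m * n)%N by rewrite leq_pmulr.
have q1 : (m * n * q = m * n + q.-1 * (m * n))%N by rewrite -{1}(prednK q0) mulnS [(_ * q.-1)%N]mulnC.
rewrite q1; move: e1 e2 e3 e4 e5 e6 e7 nn n1 m1; clear.
have -> : (n * (2 * n + 1) = 2 * (n * n) + n)%N by ring.
have -> : (m * (2 * n) = 2 * (m * n))%N by ring.
have -> : (n * (2 * m) = 2 * (m * n))%N by ring.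
have -> : (q.-1 * (16 * (m * n)) = 16 * (q.-1 * (m * n)))%N by ring.
by set a := (n * n)%N; set b := (m * n)%N; set e := (q.-1 * b)%N; lia.
Qed.

Lemma fossilsP_count d m n (mulS : forall p, 'M[R]_(m, p) -> prog 'M[R]_(d, p))
    (A : 'M[R]_(m, n)) b al be q xhat ops s1 s2 :
  (n <= m)%N -> (0 < n)%N -> (0 < d)%N -> (0 < q)%N ->
  (forall SA k, mulS n A SA k -> (k <= s1)%N) ->
  (forall Sb k, mulS 1%N b Sb k -> (k <= s2)%N) ->
  fossilsP u mulS A b al be q xhat ops ->
  (ops <= s1 + s2 + 20 * (n * n * d) + 60 * (m * n * q))%N.
Proof.
move=> nm n0 d0 q0 hs1 hs2.
case=> [SA [k1 [k1' [/hs1 e1 [QT [k2 [k2' [/qrP_count e2 [Sb [k3 [k3' [/hs2 e3 [y0 [k4 [k4' [/(mulvP_count u0) e4 [x0 [k5 [k5' [/(substP_count u0) e5 h6 ->]]]] ->]]]] ->]]]] ->]]]] ->]]]].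
have e6 : (k5' <= 2 * (28 * (m * n * q)))%N.
  by apply: (iterP_count _ h6) => s s' a; exact: refineP_count.
have nn : (n * n <= m * n * q)%N.
  by rewrite (leq_trans _ (leq_pmulr _ q0)) // leq_mul2r nm orbT.
have n1 : (n <= n * n)%N by rewrite leq_pmull.
have nd : (n * d <= n * n * d)%N by rewrite leq_mul2r n1 orbT.
have nnd : (n * n <= n * n * d)%N by rewrite leq_pmulr.
move: e1 e2 e3 e4 e5 e6 nn n1 nd nnd; clear.
have -> : (n * (5 * d + 2 + n * (4 * d + 1)) + n * (n * (4 * d + 1)) =
  8 * (n * n * d) + 2 * (n * n) + 5 * (n * d) + 2 * n)%N by ring.
have -> : (n * (2 * d) = 2 * (n * d))%N by ring.
have -> : (n * (2 * n + 1) = 2 * (n * n) + n)%N by ring.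
by set a := (n * n * d)%N; set b' := (n * n)%N; set c := (m * n * q)%N; set e := (n * d)%N; lia.
Qed.

End OperationCount.

(** * Sparse sign embeddings *)

Section SparseSign.
Context {R : realType}.

Lemma normF_mul m n p (A : 'M[R]_(m, n)) (B : 'M[R]_(n, p)) :
  normF (A *m B) <= normF A * normF B.
Proof.
rewrite -ler_sqr ?nnegrE ?mulr_ge0 ?normF_ge0 // exprMn normF_cols (normF_cols B) mulr_sumr.
apply: ler_sum => j _; rewrite -exprMn ler_sqr ?nnegrE ?mulr_ge0 ?normF_ge0 ?norm2_ge0 //.
by rewrite colE -mulmxA -colE norm2_mul.
Qed.

Definition absmx m n (A : 'M[R]_(m, n)) : 'M[R]_(m, n) := \matrix_(i, j) `|A i j|.

Lemma normF_absmx m n (A : 'M[R]_(m, n)) : normF (absmx A) = normF A.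
Proof.
rewrite /normF; congr Num.sqrt; apply: eq_bigr => i _; apply: eq_bigr => j _.
by rewrite mxE real_normK ?num_real.
Qed.

Lemma mulmx_theta_err m n p (A : 'M[R]_(m, n)) (B : 'M[R]_(n, p)) (X : 'M[R]_(m, p)) (P : R) :
  0 <= P ->
  (forall i j, exists th : 'I_n -> R, (forall k, `|th k| <= P) /\
     X i j = \sum_k A i k * B k j * (1 + th k)) ->
  normF (X - A *m B) <= P * (normF A * normF B).
Proof.
move=> P0 H; apply: (@le_trans _ _ (P * normF (absmx A *m absmx B))); last first.
  apply: mul_lel => //; apply: le_trans (normF_mul _ _) _.
  by rewrite !normF_absmx.
apply: normF_entry_le => // i j; have [th [hth EX]] := H i j.
rewrite !mxE EX -sumrB.
have -> : \sum_k absmx A i k * absmx B k j = \sum_k `|A i k * B k j|.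
  by apply: eq_bigr => k _; rewrite !mxE normrM.
have S0 : 0 <= \sum_k `|A i k * B k j| by apply: sumr_ge0 => k _; exact: normr_ge0.
rewrite (ger0_norm S0).
apply: le_trans (ler_norm_sum _ _ _) _; rewrite mulr_sumr; apply: ler_sum => k _.
have -> : A i k * B k j * (1 + th k) - A i k * B k j = A i k * B k j * th k by ring.
by rewrite normrM mulrC ler_wpM2r.
Qed.

Lemma sse_card d m zeta (w : sse_sample d m zeta) k : #|sse_support w k| = zeta.
Proof. by rewrite /sse_support; case: (w k).1 => J /= /eqP. Qed.

Lemma sse_sign_sq d m zeta (w : sse_sample d m zeta) i j : (sse_sign w i j : R) ^+ 2 = 1.
Proof. by rewrite /sse_sign sqrr_sign. Qed.

(** Each of the [m] columns has norm 1, or 0 if there are no nonzero entries. *)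
Lemma sse_normF d m zeta (w : sse_sample d m zeta) : normF (sse_mx w : 'M[R]_(d, m)) <= m%:R.
Proof.
rewrite -ler_sqr ?nnegrE ?normF_ge0 //.
have -> : normF (sse_mx w : 'M[R]_(d, m)) ^+ 2 =
    (Num.sqrt zeta%:R)^-1 ^+ 2 * (m%:R * zeta%:R).
  have -> : m%:R * zeta%:R = \sum_(k < m) zeta%:R :> R.
    by rewrite sumr_const card_ord mulr_natl.
  rewrite normF_sqE exchange_big /= mulr_sumr.
  apply: eq_bigr => k _.
  have Ez : zeta%:R = \sum_(i in sse_support w k) 1 :> R by rewrite sumr_const sse_card.
  rewrite [X in _ * X]Ez mulr_sumr.
  rewrite [RHS]big_mkcond /=; apply: eq_bigr => i _; rewrite !mxE.
  by case: ifP => _; [rewrite exprMn sse_sign_sq|rewrite mulr0 expr0n].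
have [z0|z0] := posnP zeta.
  by rewrite z0 sqrtr0 invr0 expr0n /= mul0r sqr_ge0.
have zp : 0 < zeta%:R :> R by rewrite ltr0n.
rewrite exprVn sqr_sqrtr ?ler0n // mulrCA mulVf ?gt_eqF // mulr1.
by rewrite -natrX ler_nat; case: (m) => // k; rewrite expnS expn1 leq_pmull.
Qed.

(** The constant 4 allows for the division by the rounded square root of [zeta]. *)
Lemma sse_mul_err d m zeta (w : sse_sample d m zeta) (u : R) p (B : 'M[R]_(m, p)) X k :
  0 <= u ->
  gam u m.+2 <= 1 / 2 -> sse_mulP u w B X k ->
  normF (X - sse_mx w *m B) <= 4 * gam u m.+2 * (m%:R * normF B).
Proof.
move=> u0 G2 [r [k1 [k2 [/flP [d1 hd1 Er] [s [k3 [k4 [/flP [d2 hd2 Es] [c [hc _]] _]]]] _]]]].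
have G0 : 0 <= gam u m.+2 by apply: gam_ge0.
have P0 : 0 <= 4 * gam u m.+2 by clear - G0; lra.
apply: le_trans (mulmx_theta_err P0 (A := sse_mx w) (B := B) _) _; last first.
  by apply: mul_lel => //; apply: mul_ler; [exact: normF_ge0|exact: sse_normF].
move=> i j; have [t [k5 [k6 [ht /flP [d3 hd3 EX] _]]]] := hc i j.
set l := [seq k <- enum 'I_m | i \in sse_support w k] in ht.
have [th hth Et] := sumP_theta u0 ht erefl (enum_uniqS _).
have g1G : gam u 1 <= gam u m.+2 by apply: gam_le.
have hd1' : ab d1 <= gam u m.+2 := le_trans hd1 g1G.
have [a1 a2] := ab_le hd1'.
have d10 : 1 + d1 != 0 by apply/eqP; clear - a1 G2; lra.
pose psi k := (1 + th k) * (1 + d2) * (1 + d3) / (1 + d1) - 1.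
exists psi; split=> [k'|].
  have hth' : `|th k'| <= gam u m.
    apply: le_trans (hth k') _; apply: gam_le => //.
    by apply: leq_trans (leq_pred _) _; exact: size_enumS.
  have h1 := gamM hth' hd2.
  have -> : psi k' = ((1 + th k') * (1 + d2) * (1 + d3) - 1 - d1) / (1 + d1).
    by rewrite /psi; field.
  have := gamM h1 hd3.
  have -> : (1 + ((1 + th k') * (1 + d2) - 1)) * (1 + d3) - 1 = (1 + th k') * (1 + d2) * (1 + d3) - 1.
    by ring.
  rewrite addn1 addn1 -!/(ab _); set z := _ - 1 => hz.
  rewrite abM (@ab_id _ (1 + d1)^-1); last by rewrite invr_ge0; clear - a1 G2; lra.
  rewrite ler_pdivrMr; last by clear - a1 G2; lra.
  have h3 := abB z d1.
  have h4 : 4 * gam u m.+2 * (1 / 2) <= 4 * gam u m.+2 * (1 + d1).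
    by apply: mul_lel => //; clear - a1 G2; lra.
  clear - h3 h4 hz hd1'; lra.
have -> : \sum_k sse_mx w i k * B k j * (1 + psi k) =
   \sum_(k <- l) (Num.sqrt zeta%:R)^-1 * (sse_sign w i k * B k j) * (1 + psi k).
  rewrite /l big_filter big_enum_cond /= [RHS]big_mkcond /=; apply: eq_bigr => k' _.
  by rewrite !mxE; case: ifP => _; rewrite ?mulr0 ?mul0r // mulrA.
rewrite EX Es Er Et mulr_sumr mulr_suml; apply: eq_bigr => k' _.
rewrite /psi; have [z0|z0] := eqVneq (Num.sqrt zeta%:R : R) 0.
  by rewrite z0 !(mul0r, invr0, mulr0).
by field; apply/andP; split.
Qed.

Lemma sse_mul_count d m zeta (w : sse_sample d m zeta) (u : R) p (B : 'M[R]_(m, p)) X k :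
  sse_mulP u w B X k -> (k <= 2 + p * (m * zeta + d))%N.
Proof.
case=> r [k1 [k2 [/fl_count -> [s [k3 [k4 [/fl_count -> [c [hc ->]] ->]]]] ->]]].
rewrite addnA leq_add2l.
pose sz i := (\sum_(k < m) (i \in sse_support w k))%N.
have szE : (\sum_i sz i = m * zeta)%N.
  have -> : (m * zeta = \sum_(k < m) zeta)%N by rewrite sum_nat_const card_ord.
  rewrite /sz exchange_big /=; apply: eq_bigr => k' _.
  by rewrite -[RHS](sse_card w k') -sum1_card [RHS]big_mkcond /=; apply: eq_bigr => i _; case: (i \in _).
have hb i j : (c i j <= sz i + 1)%N.
  have [t [k5 [k6 [ht /fl_count -> ->]]]] := hc i j.
  rewrite leq_add2r (sumP_count ht) size_map.
  apply: leq_trans (leq_pred _) _; rewrite size_filter -sum1_count big_enum_cond /= big_mkcond /=.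
  by apply: leq_sum => k' _; case: (i \in _).
apply: (@leq_trans (\sum_i \sum_(j < p) (sz i + 1))%N).
  by apply: leq_sum => i _; apply: leq_sum => j _.
rewrite exchange_big /= sum_nat_const card_ord leq_mul2l.
by rewrite big_split /= szE sum1_card card_ord leqnn orbT.
Qed.

End SparseSign.

(** * Polynomial prefactors *)

Section Prefactors.
Context {R : realType}.
Implicit Types c : {poly {poly R}}.

Lemma pvalD c1 c2 m n : pval (c1 + c2) m n = pval c1 m n + pval c2 m n.
Proof. by rewrite /pval !hornerD. Qed.

Lemma pvalM c1 c2 m n : pval (c1 * c2) m n = pval c1 m n * pval c2 m n.
Proof. by rewrite /pval !hornerM. Qed.

Lemma pvalXn c k m n : pval (c ^+ k) m n = pval c m n ^+ k.
Proof. by rewrite /pval !horner_exp. Qed.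

Lemma pvalC (r : R) m n : pval r%:P%:P m n = r.
Proof. by rewrite /pval !hornerC. Qed.

Lemma pval_m m n : pval ('X : {poly {poly R}}) m n = m%:R.
Proof. by rewrite /pval hornerX hornerMn hornerC. Qed.

Lemma pval_n m n : pval ('X%:P : {poly {poly R}}) m n = n%:R.
Proof. by rewrite /pval hornerC hornerX. Qed.

Definition pvalE := (pvalD, pvalM, pvalXn, pvalC, pval_m, pval_n).

(** Obtained by replacing the coefficients by their absolute values. *)
Lemma pval_dominated c : exists P : {poly {poly R}}, forall m n, ab (pval c m n) <= pval P m n.
Proof.
elim/poly_ind: c => [|c a [P hP]].
  by exists 0 => m n; rewrite /pval !horner0 /ab normr0.
have [Q hQ] : exists Q : {poly {poly R}}, forall m n, ab (pval a%:P m n) <= pval Q m n.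
  elim/poly_ind: a => [|a r [Q hQ]].
    by exists 0 => m n; rewrite /pval !horner0 /ab normr0.
  exists (Q * 'X%:P + (ab r)%:P%:P) => m n.
  rewrite rmorphD rmorphM /= !pvalE; apply: le_trans (abD _ _) _; apply: lerD => //.
  by rewrite abM (@ab_id _ n%:R) //; apply: mul_ler.
exists (P * 'X + Q) => m n; rewrite !pvalE; apply: le_trans (abD _ _) _; apply: lerD => //.
by rewrite abM (@ab_id _ m%:R) //; apply: mul_ler.
Qed.

Lemma prefactor_bound (cB cC cD cd : {poly {poly R}}) :
  exists N : {poly {poly R}}, forall m n,
    [/\ 1 <= pval N m n, m%:R <= pval N m n, n%:R <= pval N m n,
        pval cd m n <= pval N m n &
        [/\ pval cB m n <= pval N m n, pval cC m n <= pval N m n & pval cD m n <= pval N m n]].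
Proof.
have [PB hB] := pval_dominated cB; have [PC hC] := pval_dominated cC.
have [PD hD] := pval_dominated cD; have [Pd hd] := pval_dominated cd.
exists (1%:P%:P + 'X + 'X%:P + PB + PC + PD + Pd) => m n; rewrite !pvalE.
have [_ b1] := ab_le (hB m n); have [_ c1] := ab_le (hC m n).
have [_ d1] := ab_le (hD m n); have [_ e1] := ab_le (hd m n).
have b0 := le_trans (ab_ge0 _) (hB m n); have c0 := le_trans (ab_ge0 _) (hC m n).
have d0 := le_trans (ab_ge0 _) (hD m n); have e0 := le_trans (ab_ge0 _) (hd m n).
have m0 : 0 <= m%:R :> R by []; have n0 : 0 <= n%:R :> R by [].
by split; [| | | |split]; lra.
Qed.

(** The bound [cd] on the number of rows is a parameter because it is not the same
    for general sketches and for sparse sign embeddings. *)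
Lemma fossils_backward_stable (cB cC cD cd : {poly {poly R}}) :
  exists cA cBE : {poly {poly R}}, (forall m n, 0 < pval cA m n) /\
  forall (m n d : nat) (A : 'M[R]_(m, n)) (b : 'cV[R]_m) (x : 'cV[R]_n)
    (u eta alpha beta : R) (q : nat) (S : 'M[R]_(d, m))
    (mulS : forall p, 'M[R]_(m, p) -> prog 'M[R]_(d, p)) xhat ops,
  d%:R <= pval cd m n -> opnorm A = 1 -> norm2 b = 1 -> is_argmin A b x -> 0 < u ->
  sketching S (row_mx A b) eta -> eta <= 9 / 10 ->
  fossilsP u mulS A b alpha beta q xhat ops -> 0 < sigma_min A ->
  muchless cA m n (cond A * u) 1 ->
  lesssim cB m n
    (norm2 x + cond A * (norm2 x + cond A * norm2 (b - A *m x)) * u) (norm2 xhat) ->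
  forward_stable_multiply u cC mulS S A b ->
  lesssim cD m n `|alpha - polyak_alpha eta| u ->
  lesssim cD m n `|beta - polyak_beta eta| u ->
  polyak_q0 (cond A) u eta <= q%:R ->
  backward_stable cBE u A b xhat.
Proof.
have [N hN] := prefactor_bound cB cC cD cd.
pose Z : R := 1000 * (1000 * (1000 * (solver_const * forward_const))).
have Z0 : 0 < Z.
  have f0 : 0 < forward_const :> R by rewrite /forward_const /solver_const; clear; lra.
  have s0 : 0 < solver_const :> R by rewrite /solver_const; clear; lra.
  by rewrite /Z; do !(apply: mulr_gt0; first by rewrite ltr0n); apply: mulr_gt0.
pose W : R := 200 * (100 * (solver_const * forward_const)).
pose F : R := forward_const.
exists (Z%:P%:P * (1000%:P%:P * N ^+ 3)).
exists (1000%:P%:P * N ^+ 3 * (20%:P%:P + 1400%:P%:P * (F%:P%:P * N) + 14%:P%:P * N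
      + 2%:P%:P * (W%:P%:P * (1000%:P%:P * N ^+ 3 * N)))).
have W0 : 0 <= W.
  have f0 : 0 <= forward_const :> R by rewrite /forward_const /solver_const; clear; lra.
  have s0 : 0 <= solver_const :> R by rewrite /solver_const; clear; lra.
  by rewrite /W; do !(apply: mulr_ge0; first exact: ler0n); apply: mulr_ge0.
have F0 : 0 <= F by rewrite /F /forward_const /solver_const; clear; lra.
have pos m n : 0 < Z * (1000 * pval N m n ^+ 3).
  have [N1 _ _ _ _] := hN m n; apply: (mulr_gt0 Z0); apply: mulr_gt0; first by rewrite ltr0n.
  exact/exprn_gt0/(lt_le_trans ltr01).
have main : forall N', 1 <= N' -> 0 <= 1000 * N' ^+ 3 * (20 + 1400 * (F * N') + 14 * N'
      + 2 * (W * (1000 * N' ^+ 3 * N'))).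
  move=> N' N1; have N0 : 0 <= N' by apply: le_trans N1.
  have k0 : 0 <= 1000 * N' ^+ 3 by apply: mulr_ge0; [exact: ler0n|exact: exprn_ge0].
  have h1 : 0 <= F * N' by exact: mulr_ge0.
  have h2 : 0 <= W * (1000 * N' ^+ 3 * N') by apply: (mulr_ge0 W0); apply: mulr_ge0.
  by apply: (mulr_ge0 k0); clear - h1 h2 N0; move: (F * N') h1 (W * _) h2 => a ? b ?; lra.
split=> [m n|]; first by rewrite !pvalE; exact: pos.
move=> m n d A b x u eta alpha beta q S mulS xhat ops dd nA nb hx u0 skS eta9 run sA.
rewrite /muchless /lesssim /backward_stable !pvalE => hA hB hC hAl hBe hq.
have [N1 mN nN dN [BN CN DN]] := hN m n.
set N' := pval N m n in hA N1 mN nN dN BN CN DN *.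
have P0 : 0 < Z * (1000 * N' ^+ 3) := pos m n.
have k0 := cond_ge1 nA sA.
have wk (c y z : R) : 0 <= z -> c <= N' -> y <= c * z -> y <= N' * z.
  by move=> z0 cN /le_trans; apply; apply: ler_wpM2r.
have hZ : Z * (1000 * N' ^+ 3 * (cond A * u)) <= 1.
  by rewrite mulrA mulrC -ler_pdivlMr.
have u0' := ltW u0.
have hSA SA k : mulS n A SA k -> opnorm (SA - S *m A) <= N' * u.
  by move=> h; apply: wk CN _ => //; have := hC.1 _ _ h; rewrite /lesssim nA mul1r.
have hSb Sb k : mulS 1%N b Sb k -> norm2 (Sb - S *m b) <= N' * u.
  by move=> h; apply: wk CN _ => //; have := hC.2 _ _ h; rewrite /lesssim nb mul1r.
have hB' := wk _ _ _ (norm2_ge0 _) BN hB.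
have BE := fossils_backward N1 mN nN (le_trans dd dN) nA nb hx u0 skS eta9 run sA hZ hB'
  hSA hSb (wk _ _ _ u0' DN hAl) (wk _ _ _ u0' DN hBe) hq.
apply: le_trans BE _.
have E (a c e : R) : a * u * c * e = a * c * e * u by ring.
rewrite -[leLHS]mulr1 -/F -/W E; apply: ler_wpM2r => //.
by apply: (ler_wpM2l (main _ N1)); rewrite -nA; exact: opnorm_le_normF.
Qed.

End Prefactors.

(** * Cost in terms of the unit roundoff *)

Section FinalCosts.
Context {R : realType}.

(** The constant 1000 makes [1 / u] larger than [expR 1], which is at most 4. *)
Lemma ln_inv_bounds (kap u nn : R) : 1 <= kap -> 1 <= nn -> 0 < u -> 1000 * u <= 1 ->
  1 <= ln (nn / u) /\ ln (1 / (kap * u)) <= ln (nn / u).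
Proof.
move=> k1 n1 u0 hu.
have ku : 0 < kap * u by apply: mulr_gt0 => //; apply: lt_le_trans k1.
have uV : 1000 <= u^-1 by rewrite -[u^-1]mul1r ler_pdivlMr.
have V0 : 0 <= u^-1 by rewrite invr_ge0 ltW.
have nu : u^-1 <= nn / u by rewrite -[leLHS]mul1r; exact: mul_ler.
have nu0 : 0 < nn / u by clear - uV nu; lra.
split.
  have e4 : expR 1 <= 4 :> R.
    have h := expR_ge1Dx (- (1 / 2) : R).
    have Ee : expR (- (1 / 2)) * (expR (- (1 / 2)) * expR 1) = 1 :> R.
      rewrite -!expRD; have -> : - (1 / 2) + (- (1 / 2) + 1) = 0 :> R by clear; lra.
      exact: expR0.
    have e0 := expR_ge0 (1 : R); move: (expR (- (1 / 2))) (expR 1) h Ee e0 => a e h Ee e0.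
    have h1 : 1 / 2 * (1 / 2 * e) <= a * (a * e).
      by apply: mul_le; [clear; lra|clear - e0; lra|clear - h; lra|apply: mul_ler => //; clear - h; lra].
    by clear - h1 Ee; lra.
  rewrite -[leLHS]expRK ler_ln ?posrE ?expR_gt0 //; clear - e4 nu uV; lra.
rewrite ler_ln ?posrE //; last by rewrite divr_gt0.
rewrite mul1r; apply: le_trans nu; rewrite lef_pV2 ?posrE //.
by rewrite -{1}[u]mul1r; apply: mul_ler k1; exact: ltW.
Qed.

Lemma q_le (kap u nn eta : R) (q : nat) : 1 <= kap -> 1 <= nn -> 0 < u -> 1000 * u <= 1 ->
  0 < ln (1 / inflated eta) ->
  q%:Z = Num.ceil (polyak_q0 kap u eta) ->
  polyak_q0 kap u eta <= q%:R /\
  q%:R <= (12 + 2 / ln (1 / inflated eta)) * ln (nn / u).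
Proof.
move=> k1 n1 u0 hu L0 hq; have [l1 l2] := ln_inv_bounds k1 n1 u0 hu.
have Eq : q%:R = (Num.ceil (polyak_q0 kap u eta))%:~R :> R by rewrite -hq.
split; first by rewrite Eq ceil_ge.
have := ceilB1_lt (polyak_q0 kap u eta); rewrite rmorphB /= -Eq.
set c := 2 / _; have c0 : 0 <= c by rewrite divr_ge0 // ltW.
have h1 : c * ln (1 / (kap * u)) <= c * ln (nn / u) by exact: mul_lel.
suff : polyak_q0 kap u eta <= (11 + c) * ln (nn / u) by clear - l1; lra.
have cl : 0 <= c * ln (nn / u) by apply: mul_ge0 => //; clear - l1; lra.
rewrite /polyak_q0 ge_max; apply/andP; split; last by clear - cl l1; lra.
have -> : 2 * (ln (1 / (kap * u)) / ln (1 / inflated eta)) = c * ln (1 / (kap * u)).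
  by rewrite /c; ring.
by clear - h1 l1; lra.
Qed.

(** The terms that do not grow with [l] are absorbed by it because [l >= 1], while
    the part of the QR cost that grows with [lam] is of order [n^3 lam]. *)
Lemma ops_arith (M n d z q lam l hd hz cq o s1 s2 : R) :
  1 <= n -> n <= M -> 0 <= lam -> lam <= l -> 1 <= l -> 0 <= d -> 0 <= z ->
  0 <= hd -> 0 <= hz -> 0 <= cq ->
  z <= 2 * hz * lam + 1 -> d <= 4 * hd * n * lam + 1 -> q <= cq * l ->
  s1 <= 2 + n * (M * z + d) -> s2 <= 2 + (M * z + d) ->
  o <= s1 + s2 + 20 * (n * n * d) + 60 * (M * n * q) ->
  o <= (28 + 4 * hz + 60 * cq + 88 * hd) * (M * n * l + n ^+ 3 * lam).
Proof.
move=> n1 nM lam0 laml l1 d0 z0 hd0 hz0 cq0 hz1 hd1 hq h1 h2 ho.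
have n0 : 0 <= n by clear - n1; lra.
have M0 : 0 <= M by clear - n0 nM; lra.
have Mn0 : 0 <= M * n by exact: mul_ge0.
have Mn1 : 1 <= M * n by apply: (le_trans n1); rewrite -[leLHS]mul1r; apply: mul_ler => //; exact: le_trans nM.
have nn0 : 0 <= n * n by exact: mul_ge0.
have l0 : 0 <= l by clear - l1; lra.
have Mz0 : 0 <= M * z + d by apply: addr_ge0 => //; exact: mul_ge0.
have e1 : M * z + d <= n * (M * z + d) by rewrite -[leLHS]mul1r; exact: mul_ler.
have e2 : n * d <= n * n * d.
  apply: mul_ler => //; rewrite -[leLHS]mul1r; exact: mul_ler.
have hzl : hz * lam <= hz * l by exact: mul_lel.
have e3 : M * n * z <= M * n * ((2 * hz + 1) * l).
  apply: mul_lel => //; apply: le_trans hz1 _.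
  by clear - l1 hzl; lra.
have e4 : n * n * d <= n * n * (4 * hd * n * lam + 1) by exact: mul_lel.
have e5 : n * n <= M * n * l.
  rewrite -[leLHS]mulr1; apply: mul_le => //; exact: mul_ler.
have e6 : M * n * q <= M * n * (cq * l) by exact: mul_lel.
have e7 : 1 <= M * n * l by rewrite -[leLHS]mulr1; exact: mul_le.
have T0 : 0 <= n ^+ 3 * lam by apply: mul_ge0 => //; exact: exprn_ge0.
have z1 : 0 <= hz * (n ^+ 3 * lam) by exact: mul_ge0.
have z3 : 0 <= cq * (n ^+ 3 * lam) by exact: mul_ge0.
have E4 : n * n * (4 * hd * n * lam + 1) = 4 * (hd * (n ^+ 3 * lam)) + n * n by ring.
have z2 : 0 <= hd * (M * n * l) by apply: mul_ge0 => //; exact: mul_ge0.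
have E3 : M * n * ((2 * hz + 1) * l) = 2 * (hz * (M * n * l)) + M * n * l by ring.
have E6 : M * n * (cq * l) = cq * (M * n * l) by ring.
have E7 : n * (M * z + d) = M * n * z + n * d by ring.
rewrite E4 in e4; rewrite E3 in e3; rewrite E6 in e6; rewrite E7 in e1 h1.
have -> : (28 + 4 * hz + 60 * cq + 88 * hd) * (M * n * l + n ^+ 3 * lam) =
    28 * (M * n * l) + 4 * (hz * (M * n * l)) + 60 * (cq * (M * n * l)) + 88 * (hd * (M * n * l))
    + 28 * (n ^+ 3 * lam) + 4 * (hz * (n ^+ 3 * lam)) + 60 * (cq * (n ^+ 3 * lam))
    + 88 * (hd * (n ^+ 3 * lam)) by ring.
clear - ho h1 h2 e1 e2 e3 e4 e5 e6 e7 T0 z1 z2 z3.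
lra.
Qed.
End FinalCosts.

(** * The algorithm with sparse sign embeddings *)

Section Sparse.
Context {R : realType}.

Lemma half_inflated : 0 < ln (1 / inflated (1 / 2)) :> R.
Proof. by apply: ln_gt0; rewrite /inflated; clear; lra. Qed.

(** A sketch of a nonzero matrix needs at least one row, and a matrix of norm 1
    at least one column. *)
Lemma sketch_dims d m n (A : 'M[R]_(m, n)) (b : 'cV[R]_m) (S : 'M[R]_(d, m)) eta :
  opnorm A = 1 -> sketching S (row_mx A b) eta -> (0 < n)%N /\ (0 < d)%N.
Proof.
move=> A1 hS; have pos : (forall y, norm2 (A *m y) <= 0) -> False.
  move=> h; have : opnorm A <= 0 by apply: opnorm_le => // y; rewrite mul0r; exact: h.
  by rewrite A1; lra.
split; rewrite lt0n; apply/eqP => E; apply: pos => y; subst.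
  by rewrite [y]flatmx0 mulmx0 norm2_0.
have [/andP[e0 e1] _] := hS; have [h _] := sketch_vec hS y 0.
move: h; rewrite scale0r addr0 [S *m _]flatmx0 norm2_0 pmulr_rle0 // subr_gt0 //.
Qed.

Lemma sse_forward_stable d m n zeta (w : sse_sample d m zeta) (u : R) (A : 'M[R]_(m, n)) (b : 'cV[R]_m) :
  0 <= u -> 4 * (m.+2%:R * u) <= 1 -> opnorm A = 1 -> norm2 b = 1 ->
  forward_stable_multiply u (8%:P%:P * ('X + 2%:P%:P) * ('X * ('X%:P + 1%:P%:P))) 
    (@sse_mulP R d m zeta u w) (sse_mx w) A b.
Proof.
move=> u0 hu A1 b1.
have n0 : 0 <= n%:R :> R by []; have m0 : 0 <= m%:R :> R by [].
have hg : gam u m.+2 <= 2 * (m.+2%:R * u) by apply: (gam_lin u0); clear - hu; move: (_ * u) hu => z; lra.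
have hg2 : gam u m.+2 <= 1 / 2 by clear - hg hu; move: (_ * u) hg hu => z; lra.
have g0 : 0 <= gam u m.+2 by exact: gam_ge0.
have E : m.+2%:R = m%:R + 2 :> R by rewrite -addn2 natrD.
have main p (B : 'M[R]_(m, p)) X k : normF B <= n%:R + 1 -> sse_mulP u w B X k ->
    normF (X - sse_mx w *m B) <= 8 * (m%:R + 2) * (m%:R * (n%:R + 1)) * u.
  move=> hB h; apply: le_trans (sse_mul_err u0 hg2 h) _.
  have -> : 8 * (m%:R + 2) * (m%:R * (n%:R + 1)) * u = 4 * (2 * (m.+2%:R * u)) * (m%:R * (n%:R + 1)) :> R.
    by rewrite E; ring.
  apply: mul_le; [by clear - g0; lra| |by clear - hg; move: (_ * u) hg => z; lra|exact: mul_lel].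
  by apply: mul_ge0 => //; exact: normF_ge0.
split=> [SA k h|Sb k h]; rewrite /lesssim !pvalE ?A1 ?b1 mul1r.
  apply: le_trans (opnorm_le_normF _) _; apply: main h.
  by apply: le_trans (normF_le_opnorm _) _; rewrite A1; clear; lra.
rewrite -normF_col1; apply: main h; rewrite normF_col1 b1; clear - n0; lra.
Qed.

Lemma sse_dim_le (d m n : nat) (hi : R) : (0 < n)%N -> 0 <= hi ->
  d%:R <= hi * (n%:R * ln n%:R / (1 / 2) ^+ 2) + 1 ->
  d%:R <= 4 * hi * n%:R * ln n%:R + 1 /\
  d%:R <= pval ((4 * hi)%:P%:P * ('X%:P * 'X%:P) + 1%:P%:P) m n.
Proof.
move=> n0 h0 hd; have n0' : 0 < n%:R :> R by rewrite ltr0n.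
have hl := ltW (ln_sublinear n0').
have e1 : d%:R <= 4 * hi * n%:R * ln n%:R + 1.
  apply: le_trans hd _; rewrite le_eqVlt; apply/orP; left; apply/eqP; by field.
split=> //.
rewrite !pvalE; apply: (le_trans e1); rewrite lerD2r -!mulrA.
do 3!(apply: mul_lel => //).
Qed.

Lemma ln_inv_unit_le (n : nat) (u : R) : (0 < n)%N -> 0 < u -> u <= 1 ->
  ln n%:R <= ln (n%:R / u) :> R.
Proof.
move=> n0 u0 u1; have n0' : 0 < n%:R :> R by rewrite ltr0n.
rewrite ler_ln ?posrE //; last exact: divr_gt0.
by rewrite ler_pdivlMr // -[leRHS]mulr1; apply: mul_lel => //; exact: ltW.
Qed.

(** The constant of the operation count depends only on those of the embedding,
    while [cA] and [cBE] also depend on the given prefactors. Two summands are added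
    to the smallness condition: one for the forward stability of the embedding, and
    one for [ln (n / u) >= 1]. *)
Lemma sse_fossils_backward_stable (lo_d hi_d lo_z hi_z : R) :
  0 < lo_d <= hi_d -> 0 < lo_z <= hi_z ->
  exists cops : R, forall cB cD : {poly {poly R}},
  exists cA cBE : {poly {poly R}}, (forall m n, 0 < pval cA m n) /\
  forall (m n d zeta : nat) (A : 'M[R]_(m, n)) (b : 'cV[R]_m) (x : 'cV[R]_n)
    (u alpha beta : R) (q : nat) (w : sse_sample d m zeta) (xhat : 'cV[R]_n) (ops : nat),
  (n <= m)%N -> opnorm A = 1 -> norm2 b = 1 -> is_argmin A b x -> 0 < u ->
  sse_parameters d zeta n (1 / 2) lo_d hi_d lo_z hi_z ->
  sketching (sse_mx w) (row_mx A b) (1 / 2) ->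
  fossilsP u (sse_mulP u w) A b alpha beta q xhat ops ->
  0 < sigma_min A -> muchless cA m n (cond A * u) 1 ->
  lesssim cB m n
    (norm2 x + cond A * (norm2 x + cond A * norm2 (b - A *m x)) * u) (norm2 xhat) ->
  lesssim cD m n `|alpha - polyak_alpha (1 / 2)| u ->
  lesssim cD m n `|beta - polyak_beta (1 / 2)| u ->
  q%:Z = Num.ceil (polyak_q0 (cond A) u (1 / 2)) ->
  backward_stable cBE u A b xhat /\
  ops%:R <= cops * (m%:R * n%:R * ln (n%:R / u) + n%:R ^+ 3 * ln n%:R).
Proof.
move=> /andP[ld0 ld] /andP[lz0 lz].
have hd0 : 0 <= hi_d by clear - ld0 ld; lra.
have hz0 : 0 <= hi_z by clear - lz0 lz; lra.
pose cq := 12 + 2 / ln (1 / inflated (1 / 2)) : R.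
have cq0 : 0 <= cq.
  have : 0 <= 2 / ln (1 / inflated (1 / 2)) :> R by rewrite divr_ge0 // ltW // half_inflated.
  by rewrite /cq; move: (2 / _) => z; clear; lra.
exists (28 + 4 * hi_z + 60 * cq + 88 * hi_d) => cB cD.
have [cA [cBE [cA0 main]]] := fossils_backward_stable cB
  (8%:P%:P * ('X + 2%:P%:P) * ('X * ('X%:P + 1%:P%:P))) cD
  ((4 * hi_d)%:P%:P * ('X%:P * 'X%:P) + 1%:P%:P).
exists (cA + (4%:P%:P * ('X + 2%:P%:P) + 1000%:P%:P)), cBE.
have v2 m : 0 <= 4 * (m%:R + 2) :> R by apply: mul_ge0 => //; apply: addr_ge0.
split=> [m n|m n d zeta A b x u alpha beta q w xhat ops nm A1 b1 hx u0 [hd hz] hS run sA].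
  by rewrite pvalD; apply: (ltr_wpDr _ (cA0 m n)); rewrite !pvalE; exact: (addr_ge0 (v2 m) (ler0n _ 1000)).
move=> hA hB hal hbe hq.
have [n0 d0] := sketch_dims A1 hS.
have k1 := cond_ge1 A1 sA.
have a0 := cA0 m n.
have u0' := ltW u0.
have ku : u <= cond A * u by rewrite -[leLHS]mul1r; exact: mul_ler.
have ku0 : 0 <= cond A * u by exact: le_trans ku.
have h2 := v2 m.
have hA1 : (pval cA m n + (4 * (m%:R + 2) + 1000)) * (cond A * u) <= 1.
  have := hA; rewrite /muchless pvalD ler_pdivlMr; last first.
    by apply: (ltr_wpDr _ a0); rewrite !pvalE; exact: (addr_ge0 (v2 m) (ler0n _ 1000)).
  by rewrite mulrC !pvalE.
rewrite mulrDl mulrDl in hA1.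
have p1 : 0 <= pval cA m n * (cond A * u) by apply: mul_ge0 => //; exact: ltW.
have p2 : 0 <= 4 * (m%:R + 2) * (cond A * u) by exact: mul_ge0.
have p3 : 4 * (m%:R + 2) * u <= 4 * (m%:R + 2) * (cond A * u) by exact: mul_lel.
have hu : 1000 * u <= 1 by clear - ku hA1 p1 p2; lra.
have hm : 4 * (m.+2%:R * u) <= 1.
  by rewrite -addn2 natrD; clear - hA1 p1 p3 ku0; lra.
have hA2 : muchless cA m n (cond A * u) 1.
  by rewrite /muchless ler_pdivlMr // mulrC; clear - hA1 p2 ku0; lra.
have n1 : 1 <= n%:R :> R by rewrite ler1n.
have [q1 q2] := q_le k1 n1 u0 hu half_inflated hq.
have [_ hd2] := andP hd; have [_ hz2] := andP hz.
have [d1 d2] := sse_dim_le m n0 hd0 hd2.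
split.
  apply: (main m n d A b x u (1 / 2) alpha beta q (sse_mx w) (fun p => @sse_mulP R d m zeta u w p)
    xhat ops d2 A1 b1 hx u0 hS _ run sA hA2 hB _ hal hbe q1).
    by clear; lra.
  exact: sse_forward_stable.
have q0 : (0 < q)%N.
  by rewrite -(ltr_nat R); apply: lt_le_trans q1; rewrite /polyak_q0 lt_max; apply/orP; right; clear; lra.
have cnt := fossilsP_count u0' nm n0 d0 q0 (fun SA k h => sse_mul_count h) (fun Sb k h => sse_mul_count h) run.
have [l1 _] := ln_inv_bounds k1 n1 u0 hu.
have u1 : u <= 1 by clear - hu u0'; lra.
have hz3 : zeta%:R <= 2 * hi_z * ln n%:R + 1.
  by apply: le_trans hz2 _; rewrite le_eqVlt; apply/orP; left; apply/eqP; field.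
apply: (ops_arith (s1 := 2 + n%:R * (m%:R * zeta%:R + d%:R)) (s2 := 2 + (m%:R * zeta%:R + d%:R))
   n1 _ (ln_ge0 n1) (ln_inv_unit_le n0 u0 u1) l1 (ler0n _ d) (ler0n _ zeta) hd0 hz0 cq0 hz3 d1 q2 _ _ _) => //.
  by rewrite ler_nat.
move: cnt; rewrite -(ler_nat R) mul1n !(natrD, natrM).
exact.
Qed.

End Sparse.

Unset Implicit Arguments.

Theorem theorem7p1 (R : realType) :
  (* FOSSILS is backward stable *)
  (forall cB cC cD : {poly {poly R}},
   exists cA cBE : {poly {poly R}},
     (forall m n, 0 < pval cA m n) /\
     forall (m n d : nat) (A : 'M[R]_(m, n)) (b : 'cV[R]_m) (x : 'cV[R]_n)
       (u eta alpha beta : R) (q : nat) (S : 'M[R]_(d, m))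
       (mulS : forall p, 'M[R]_(m, p) -> prog 'M[R]_(d, p))
       (xhat : 'cV[R]_n) (ops : nat),
     (n <= m)%N -> opnorm A = 1 -> norm2 b = 1 ->
     is_argmin A b x ->
     0 < u ->
     sketching S (row_mx A b) eta ->
     fossilsP u mulS A b alpha beta q xhat ops ->
     (* (A) *)
     0 < sigma_min A -> muchless cA m n (cond A * u) 1 ->
     (* (B) *)
     lesssim cB m n
       (norm2 x + cond A * (norm2 x + cond A * norm2 (b - A *m x)) * u)
       (norm2 xhat) ->
     (* (C) *)
     sketching S A eta -> (d <= n ^ 3)%N -> eta <= 9%:R / 10%:R ->
     forward_stable_multiply u cC mulS S A b ->
     (* (D) *)
     lesssim cD m n `|alpha - polyak_alpha eta| u ->
     lesssim cD m n `|beta - polyak_beta eta| u ->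
     polyak_q0 (cond A) u eta <= q%:R ->
     backward_stable cBE u A b xhat)
  /\
  (* sparse sign embeddings with distortion 1/2 *)
  (forall lo_d hi_d lo_z hi_z : R,
   0 < lo_d <= hi_d -> 0 < lo_z <= hi_z ->
   exists cops : R, forall cB cD : {poly {poly R}},
   exists cA cBE : {poly {poly R}},
     (forall m n, 0 < pval cA m n) /\
     forall (m n d zeta : nat) (A : 'M[R]_(m, n)) (b : 'cV[R]_m) (x : 'cV[R]_n)
       (u alpha beta : R) (q : nat) (w : sse_sample d m zeta)
       (xhat : 'cV[R]_n) (ops : nat),
     let eta := 1 / 2 in
     (n <= m)%N -> opnorm A = 1 -> norm2 b = 1 ->
     is_argmin A b x ->
     0 < u ->
     sse_parameters d zeta n eta lo_d hi_d lo_z hi_z ->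
     sketching (sse_mx w) (row_mx A b) eta ->
     fossilsP u (sse_mulP u w) A b alpha beta q xhat ops ->
     (* (A) *)
     0 < sigma_min A -> muchless cA m n (cond A * u) 1 ->
     (* (B) *)
     lesssim cB m n
       (norm2 x + cond A * (norm2 x + cond A * norm2 (b - A *m x)) * u)
       (norm2 xhat) ->
     (* (D) *)
     lesssim cD m n `|alpha - polyak_alpha eta| u ->
     lesssim cD m n `|beta - polyak_beta eta| u ->
     q%:Z = Num.ceil (polyak_q0 (cond A) u eta) ->
     backward_stable cBE u A b xhat /\
     ops%:R <= cops * (m%:R * n%:R * ln (n%:R / u)
                       + n%:R ^+ 3 * ln n%:R)).
Proof.
split; last exact: sse_fossils_backward_stable.
move=> cB cC cD; have [cA [cBE [cA0 main]]] := fossils_backward_stable cB cC cD ('X%:P ^+ 3).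
exists cA, cBE; split=> // m n d A b x u eta alpha beta q S mulS xhat ops nm A1 b1 hx u0 hS run sA.
move=> hA hB _ hd eta9 hC hal hbe hq.
apply: (main m n d A b x u eta alpha beta q S mulS xhat ops _ A1 b1 hx u0 hS eta9 run sA hA hB hC hal hbe hq).
by rewrite pvalXn pval_n -natrX ler_nat.
Qed.
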